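(* Let the band matrix model be as described in the context, and let $[\mathcal N_k]_{k=1}^\infty$ be a sequence of finite nonempty sets of letters, of cardinalities $N_k$, such that $N_k\to\infty$ and $\theta_{\mathcal N_k}\Rightarrow\theta$. Let $\mu=\mu_\theta$ and $\mu_{\mathcal N}=\mu_{\theta_{\mathcal N}}$ be the probability measures on $\mathbb R$ defined in the context. Then: (i) $L(\mathcal N_k)\Rightarrow\mu$ in probability, i.e. for every bounded continuous $f:\mathbb R\to\mathbb R$, $\langle L(\mathcal N_k),f\rangle\to\langle\mu,f\rangle$ in probability as $k\to\infty$. (ii) $\mu_{\mathcal N_k}\Rightarrow\mu$.
   Context: $\Rightarrow$ denotes weak convergence of probability measures; $\langle\mu,f\rangle=\int f\,d\mu$; $|\cdot|_\infty$ is the supremum norm. Colors. Color space is a fixed Polish space with its Borel $\sigma$-algebra, and $\theta$ is a fixed probability measure on it. $D$ is a fixed bounded measurable real-valued function on color space. For each integer $k\ge1$, $d^{(k)}$ is a fixed bounded measurable nonnegative function on color space and $s^{(k)}$ is a fixed symmetric bounded measurable nonnegative function on the product of two copies of color space. Assumptions: $d^{(k)}$ is constant for $k\ne2$; $s^{(k)}$ is constant for $k\notin\{2,4\}$; the discontinuity set of $s^{(k)}$ has $\theta\otimes\theta$-measure zero; the discontinuity sets of $D$, of $d^{(k)}$ and of the diagonal restriction $c\mapsto s^{(k)}(c,c)$ have $\theta$-measure zero. Letters. There is a fixed countably infinite set of letters and a fixed function $\kappa_0$ from letters to colors. For a nonempty finite set $\mathcal N$ of letters of cardinality $N$, put $\theta_{\mathcal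 N}=N^{-1}\sum_{\alpha\in\mathcal N}\delta_{\kappa_0(\alpha)}$. Random variables. $\{\xi_e\}$ is a fixed family of independent real-valued mean zero random variables indexed by unordered pairs $e=\{\alpha,\beta\}$ of letters ($\alpha=\beta$ allowed) such that for all letters $\alpha,\beta$ and all $k\ge1$: $E|\xi_{\{\alpha,\beta\}}|^k\le s^{(k)}(\kappa_0(\alpha),\kappa_0(\beta))$ if $\alpha\neq\beta$, and $E|\xi_{\{\alpha,\alpha\}}|^k\le d^{(k)}(\kappa_0(\alpha))$; moreover equality holds whenever $k=2$, and whenever $\alpha\ne\beta$ and $k=4$. Matrices. $X(\mathcal N)$ is the $N\times N$ real symmetric random matrix with entries $X(\mathcal N)_{\alpha\beta}=D(\kappa_0(\alpha))\delta_{\alpha\beta}+N^{-1/2}\xi_{\{\alpha,\beta\}}$ for $\alpha,\beta\in\mathcal N$; $\lambda_1(\mathcal N)\le\dots\le\lambda_N(\mathcal N)$ are its eigenvalues, and $L(\mathcal N)=N^{-1}\sum_{i=1}^N\delta_{\lambda_i(\mathcal N)}$. The measures $\mu_\sigma$. For a probability measure $\sigma$ on color space, let $[\Phi_{n,\sigma}]_{n=1}^\infty$ be the unique sequence of bounded measurable real functions on color space such that the formal power series $\Phi_\sigma(c,t)=\sum_{n\ge1}\Phi_{n,\sigma}(c)t^n$ satisfies (as an identity of formal power series in $t$) $$\Phi_\sigma(c,t)=\Big(\tfrac{t}{1-D(c)t}\Big)\Big(1-\tfrac{t}{1-D(c)t}\int s^{(2)}(c,c')\Phi_\sigma(c',t)\,\sigma(dc')\Big)^{-1}.$$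 For $\sigma=\theta$ or $\sigma=\theta_{\mathcal N}$, $\mu_\sigma$ denotes the unique probability measure on $\mathbb R$ with $\langle\mu_\sigma,x^n\rangle=\langle\sigma,\Phi_{n+1,\sigma}\rangle$ for all $n\ge0$ and with support contained in $[-C,C]$, $C=2(|D|_\infty+|s^{(2)}|_\infty^{1/2})$ (such a measure exists and is unique). *)

(* Defs.v *)
From HB Require Import structures.
From mathcomp Require Import all_boot all_order all_algebra.
From mathcomp Require Import finmap.
From mathcomp Require Import all_classical all_reals all_analysis.
From mathcomp Require Import complex.

Set Implicit Arguments.
Unset Strict Implicit.
Unset Printing Implicit Defensive.

Import Order.TTheory GRing.Theory Num.Theory.
Import numFieldNormedType.Exports.

Local Open Scope classical_set_scope.
Local Open Scope ring_scope.

Notation borel T := (g_sigma_algebraType (@open T)).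

Section topology.

Definition separable (T : topologicalType) :=
  exists2 A : set T, countable A & dense A.

Definition discontinuity_set (T U : topologicalType) (f : T -> U) : set T :=
  [set x | ~ {for x, continuous f}].

Definition Cb (R : realType) (T : topologicalType) : set (T -> R) :=
  [set f | continuous f /\ [bounded f x | x in [set: T]]].

Definition supnorm (R : realType) (T : Type) (f : T -> R) : R :=
  sup (range (fun x => `|f x|)).

End topology.
Arguments Cb R T : clear implicits.

Section measures.
Context (R : realType).

(* The topology enters only through the class [F] of test functions, because
   the Borel structures on [R] and on [borel T] are given differently.  Weak
   convergence is the case where [F] is [Cb]. *)
Definition weak_cvg d (T : measurableType d) (F : set (T -> R))
    (mu_ : nat -> {measure set T -> \bar R}) (mu : {measure set T -> \bar R}) :=
  forall f, F f ->
    (\int[mu_ k]_x f x)%R @[k --> \oo] --> (\int[mu]_x f x)%R.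

Definition cvg_in_probability d (Omega : measurableType d)
    (P : probability Omega R) (X : nat -> Omega -> R) (l : R) :=
  forall e : R, 0 < e -> P [set w | e <= `|X k w - l|] @[k --> \oo] --> 0%E.

Definition empirical d (T : measurableType d) (s : seq T) :
    {measure set T -> \bar R} :=
  mscale ((size s)%:R^-1)%:nng (msum (fun i => \d_(nth point s i)) (size s)).

Definition msupport (mu : {measure set R -> \bar R}) : set R :=
  [set x | forall U : set R, open U -> U x -> (0 < mu U)%E].

Definition mutually_independent d (Omega : measurableType d)
    (P : probability Omega R) (I : choiceType) (X : I -> Omega -> R) :=
  forall (J : {fset I}) (B : I -> set R), (forall i, measurable (B i)) ->
    P (\bigcap_(i in [set` J]) (X i @^-1` B i)) =
    (\prod_(i <- J) P (X i @^-1` B i))%E.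

End measures.

Section power_series.
Context (R : realType).

(* The formal power series \sum_n a_n t^n is represented by n |-> a_n. *)
Implicit Types a b : nat -> R.

Definition fps1 : nat -> R := fun n => (n == 0%N)%:R.
Definition fpsX : nat -> R := fun n => (n == 1%N)%:R.
Definition fps_mul a b : nat -> R :=
  fun n => \sum_(i < n.+1) a i * b (n - i)%N.

Fixpoint fps_inv_coefs a (n : nat) : seq R :=
  if n is m.+1 then
    let s := fps_inv_coefs a m in
    rcons s ((a 0%N)^-1 * ((m == 0%N)%:R - \sum_(i < m) a i.+1 * s`_(m - i.+1)))
  else [::].

Definition fps_inv a : nat -> R := fun n => (fps_inv_coefs a n.+1)`_n.

Lemma fps_mulV a : a 0%N != 0 -> fps_mul a (fps_inv a) = fps1.
Proof.
move=> a0.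
have sz n : size (fps_inv_coefs a n) = n.
  by elim: n => //= n IH; rewrite size_rcons IH.
have coefE n i : (i < n)%N -> (fps_inv_coefs a n)`_i = fps_inv a i.
  elim: n => // n IH; rewrite ltnS leq_eqVlt => /predU1P[->//|lt_in].
  by rewrite /= nth_rcons sz lt_in IH.
apply/funext => n; rewrite /fps_mul big_ord_recl subn0 /=.
rewrite {1}/fps_inv /= nth_rcons sz ltnn eqxx mulrA divff// mul1r.
rewrite -[RHS]subr0 -addrA; congr (_ + _); apply/eqP.
rewrite oppr0 addrC subr_eq0; apply/eqP/eq_bigr => i _.
by rewrite /bump /= coefE// ltn_subrL /= (leq_ltn_trans _ (ltn_ord i)).
Qed.

End power_series.

Section limit_measure.
Context (R : realType) (C : completePseudoMetricType R).
Variables (D : C -> R) (s2 : C * C -> R).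

(* t / (1 - D(c) t) *)
Definition fpsD (c : C) : nat -> R :=
  fps_mul (@fpsX R) (fps_inv (fps1 R \- (fun n => D c * fpsX R n))).

(* Phi is indexed from 0 with Phi_0 = 0, so that n |-> Phi n c is the
   coefficient sequence of Phi(c, t). *)
Definition is_Phi (sigma : {measure set (borel C) -> \bar R})
    (Phi : nat -> C -> R) :=
  [/\ forall n, measurable_fun [set: borel C] (Phi n : borel C -> R),
      forall n, [bounded Phi n c | c in [set: C]],
      Phi 0%N = cst 0 &
      forall c,
        (fun n => Phi n c) =
        fps_mul (fpsD c)
          (fps_inv (fps1 R \- fps_mul (fpsD c)
             (fun n => (\int[sigma]_c' (s2 (c, c') * Phi n c'))%R)))].

Definition is_mu (sigma : {measure set (borel C) -> \bar R})
    (mu : probability R R) :=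
  let K := 2 * (supnorm D + Num.sqrt (supnorm s2)) in
  msupport mu `<=` `[- K, K] /\
  exists2 Phi, is_Phi sigma Phi &
    forall n, (\int[mu]_x (x ^+ n))%R = (\int[sigma]_c Phi n.+1 c)%R.

End limit_measure.

Section eigenvalues.
Context (R : realType).

Definition is_spectrum n (A : 'M[R]_n) (s : seq R) :=
  sorted <=%R s /\ char_poly A = \prod_(a <- s) ('X - a%:P).

(* Eigenvalues with multiplicity, in increasing order.  The default [::] is
   never used on symmetric matrices, by eigenvaluesP. *)
Definition eigenvalues n (A : 'M[R]_n) : seq R := xget [::] (is_spectrum A).

Lemma eigenvaluesP n (A : 'M[R]_n) :
  A^T = A -> is_spectrum A (eigenvalues A).
Proof.
move=> symA; apply: (@xgetPex _ [::] (is_spectrum A)).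
pose f := real_complex R; pose B : 'M[R[i]]_n := map_mx f A.
have hB : B \is hermsymmx.
  apply: realsym_hermsym.
    by apply/is_hermitianmxP; rewrite expr0 scale1r map_mx_id// /B map_trmx symA.
  by apply/mxOverP => i j; rewrite mxE complex_real eqxx.
have /mxOverP rB := hermitian_spectral_diag_real hB.
have /orthomx_spectralP := hermitian_normalmx hB.
set P := spectralmx B; set d := spectral_diag B in rB * => defB.
have uP : P \in unitmx by exact: spectral_unit.
pose r i : R := complex.Re (d 0 i).
have dE i : d 0 i = f (r i) by exact/esym/RRe_real.
have cB : char_poly B = \prod_i ('X - (d 0 i)%:P).
  transitivity (char_poly (diag_mx d)); last first.
    rewrite char_poly_trig ?diag_mx_is_trig//.
    by apply: eq_bigr => i _; rewrite mxE eqxx.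
  pose Q := map_mx polyC P; pose Q' := map_mx polyC (invmx P).
  have QQ : Q' *m Q = 1%:M by rewrite -map_mxM mulVmx// map_mx1.
  rewrite /char_poly (_ : char_poly_mx B = Q' *m char_poly_mx (diag_mx d) *m Q).
    by rewrite !det_mulmx mulrC mulrA -det_mulmx (mulmx1C QQ) det1 mul1r.
  rewrite /char_poly_mx mulmxBr mulmxBl -!map_mxM -defB; congr (_ - _).
  by rewrite scalar_mxC -mulmxA QQ mulmx1.
exists (sort <=%R [seq r i | i <- enum 'I_n]); split.
  by apply: sort_sorted; exact: le_total.
rewrite (perm_big [seq r i | i <- enum 'I_n]) /=; last by rewrite perm_sort.
rewrite big_map big_enum /=.
apply: (map_poly_inj f); rewrite map_char_poly -/B cB rmorph_prod /=.
by apply: eq_bigr => i _; rewrite dE rmorphB /= map_polyX map_polyC.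
Qed.

End eigenvalues.

Section model.
Context (L : choiceType).

(* Unordered pairs {a, b} of letters, a = b allowed. *)
Definition upair := {e : {fset L} | (0 < #|` e| <= 2)%N}.

Lemma upair_subproof (a b : L) : (0 < #|` [fset a; b]%fset| <= 2)%N.
Proof. by rewrite cardfs2; case: (a != b). Qed.

Definition mk_upair (a b : L) : upair :=
  exist _ [fset a; b]%fset (upair_subproof a b).

Definition letter (N : {fset L}) (i : 'I_#|` N|) : L :=
  tnth (in_tuple (enum_fset N)) i.

Context (R : realType) (C : completePseudoMetricType R) (kappa : L -> C).

Definition theta_ (N : {fset L}) : {measure set (borel C) -> \bar R} :=
  empirical R ([seq kappa a | a <- enum_fset N] : seq (borel C)).

Definition band_matrix (D : C -> R) (xi : upair -> R) (N : {fset L}) :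
    'M[R]_#|` N| :=
  \matrix_(i, j) (D (kappa (letter i)) *+ (letter i == letter j)
    + (Num.sqrt #|` N|%:R)^-1 * xi (mk_upair (letter i) (letter j))).

End model.
Arguments theta_ {L} R {C} kappa N.

(* Main.v *)
Require Import Defs.
From mathcomp Require Import all_boot all_order all_algebra.
From mathcomp Require Import finmap.
From mathcomp Require Import all_classical all_reals all_analysis.
From mathcomp Require Import measurable_realfun.
From mathcomp Require Import complex ring lra zify.

Set Implicit Arguments.
Unset Strict Implicit.
Unset Printing Implicit Defensive.

Import Order.TTheory GRing.Theory Num.Theory.
Import numFieldNormedType.Exports.

Local Open Scope classical_set_scope.
Local Open Scope ring_scope.

(** The method of moments, with integration by parts in place of a count of
    walks.

    Let [X] be the matrix on the set of letters [N], [n = #|N|], and let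
    [Phi_m] be the coefficients of the power series attached to the uniform
    measure on the colors of [N].  The equation for [Phi] amounts to the recursion
    [Phi_(m+1)(c) = D(c) Phi_m(c) + sum_(i+j=m) Phi_i(c) * int s2(c,.) Phi_j]
    for [m >= 1] ([fps_solve]), and the point is that the diagonal entries
    [(X ^+ m) a a] are close in mean square to [Phi_(m+1)] at the color of [a],
    uniformly in [a] ([deviation_small]).

    Two facts make this work.  First, all mixed moments of entries of powers of
    [X] are bounded independently of [n] ([moment_bound]).  Secondly, if [xi] is
    the variable of the pair [{a, b}], one can expand a product [F] of entries of
    powers in [xi]; the coefficients are independent of [xi] and of the same kind.
    As [xi] is centred, [E (xi * F)] equals [n^(-1/2) * E (xi ^+ 2)] times the
    expectation of the derivative of [F], up to [O(n^-1)] ([Ex_xi_mono]).  Apply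
    this to [E ((X ^+ m) a a * G)], where [G] is the difference between
    [(X ^+ m) a a] and its limit, after writing [X ^+ m = X * X ^+ (m-1)].  The
    main terms are [D(a) * E ((X ^+ (m-1)) a a * G)] and the means over [b] of
    [s2(a,b) * E ((X ^+ i) b b * (X ^+ j) a a * G)], and all others contain two
    entries between [a] and [b] and are negligible since
    [\sum_b (X ^+ i) b a ^+ 2 = (X ^+ (2 * i)) a a] is bounded in mean.  By
    induction on the power the diagonal entries in the main terms may be replaced
    by their limits, and the recursion for [Phi] shows that [E (G ^+ 2)] is small
    ([deviation_step]).  Hence [n^-1 * \tr (X ^+ m)] is close in mean square to the
    [m]-th moment of [mu_N] ([trace_small]).

    The moments of [mu_N] converge to those of [mu]: although [s2] and [D] are
    only almost everywhere continuous and the coefficients depend on the measure,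
    one shows by induction that they converge jointly, at almost every color, when
    the measure and the color vary together ([Phi_cvg]).  The induction step is an
    extended mapping theorem for weak convergence ([extended_mapping]).

    Finally moments determine weak limits here because the limiting measures are
    carried by a fixed segment: part (ii) follows from polynomial approximation
    ([weak_cvg_of_moments]), and part (i) from polynomial approximation together
    with a polynomial bound for the contribution of eigenvalues outside a segment
    ([spectral_cvg]). *)

(** * Random variables with moments of all orders *)

Section expectation.
Context d (Omega : measurableType d) (R : realType) (P : probability Omega R).

Implicit Types Z W : Omega -> R.

Definition Ex (Z : Omega -> R) : R := (\int[P]_w Z w)%R.

Definition has_moments (Z : Omega -> R) :=
  measurable_fun [set: Omega] Z /\
  forall p, P.-integrable [set: Omega] (fun w => (`|Z w| ^+ p)%:E).

Lemma has_moments_integrable Z : has_moments Z ->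
  P.-integrable [set: Omega] (EFin \o Z).
Proof.
move=> [mZ /(_ 1%N) iZ]; apply: le_integrable iZ => //.
- exact/measurable_EFinP.
- by move=> w _ /=; rewrite expr1 normr_id.
Qed.

Lemma has_moments_le Z W : measurable_fun [set: Omega] Z ->
  (forall w, `|Z w| <= `|W w|) -> has_moments W -> has_moments Z.
Proof.
move=> mZ ZW [mW iW]; split => // p; apply: le_integrable (iW p) => //.
- apply/measurable_EFinP; apply: measurable_funX.
  exact: measurableT_comp.
- by move=> w _ /=; rewrite lee_fin !normrX !normr_id lerXn2r// nnegrE.
Qed.

Lemma has_moments_cst r : has_moments (cst r).
Proof.
split => // p.
exact: (finite_measure_integrable_cst P (`|r| ^+ p) measurableT).
Qed.

Lemma has_momentsX Z k : has_moments Z -> has_moments (fun w => Z w ^+ k).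
Proof.
move=> [mZ iZ]; split; first exact: measurable_funX.
by move=> p; under eq_fun do rewrite normrX -exprM; exact: iZ.
Qed.

Lemma has_moments_norm Z : has_moments Z -> has_moments (fun w => `|Z w|).
Proof.
move=> [mZ iZ]; split; first exact: measurableT_comp.
by move=> p; under eq_fun do rewrite normr_id; exact: iZ.
Qed.

Lemma has_momentsD Z W : has_moments Z -> has_moments W ->
  has_moments (fun w => Z w + W w).
Proof.
move=> [mZ iZ] [mW iW]; split; first exact: measurable_funD.
move=> p.
have iZW : P.-integrable [set: Omega]
    (fun w => (2 ^+ p * (`|Z w| ^+ p + `|W w| ^+ p))%:E).
  under eq_fun do rewrite EFinM EFinD.
  by apply: integrableZl => //; apply: integrableD.
apply: le_integrable iZW => //.
- apply/measurable_EFinP; apply: measurable_funX.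
  by apply: measurableT_comp => //; exact: measurable_funD.
- move=> w _ /=; rewrite lee_fin !normrX normr_id normrM.
  rewrite normrX (@ger0_norm _ 2)// ger0_norm ?addr_ge0//.
  apply: (@le_trans _ _ ((2 * Num.max `|Z w| `|W w|) ^+ p)).
    rewrite lerXn2r ?nnegrE// ?mulr_ge0// ?le_max ?normr_ge0//.
    rewrite (le_trans (ler_normD _ _))// mulr2n mulrDl mul1r lerD//.
      by rewrite le_max lexx.
    by rewrite le_max lexx orbT.
  rewrite exprMn ler_wpM2l ?exprn_ge0//.
  by case: (leP `|Z w| `|W w|) => _; rewrite ?lerDl ?lerDr.
Qed.

Lemma has_momentsM Z W : has_moments Z -> has_moments W ->
  has_moments (fun w => Z w * W w).
Proof.
move=> hZ hW; apply: (@has_moments_le _ (fun w => Z w ^+ 2 + W w ^+ 2)).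
- by apply: measurable_funM; [case: hZ|case: hW].
- move=> w; rewrite [leRHS]ger0_norm ?addr_ge0 ?sqr_ge0// normrM.
  rewrite -(real_normK (num_real (Z w))) -(real_normK (num_real (W w))).
  have : 0 <= (`|Z w| - `|W w|) ^+ 2 by exact: sqr_ge0.
  have : 0 <= `|Z w| * `|W w| by exact: mulr_ge0.
  rewrite sqrrB => h1 h2; lra.
- by apply: has_momentsD; exact: has_momentsX.
Qed.

Lemma has_momentsZ r Z : has_moments Z -> has_moments (fun w => r * Z w).
Proof. by move=> hZ; apply: has_momentsM => //; exact: has_moments_cst. Qed.

Lemma has_momentsN Z : has_moments Z -> has_moments (fun w => - Z w).
Proof.
by move=> /(has_momentsZ (-1)); under eq_fun do rewrite mulN1r.
Qed.

Lemma has_momentsB Z W : has_moments Z -> has_moments W ->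
  has_moments (fun w => Z w - W w).
Proof. by move=> hZ hW; apply/has_momentsD => //; exact: has_momentsN. Qed.

Lemma has_moments_sum (I : Type) (r : seq I) (Q : pred I) (F : I -> Omega -> R) :
  (forall i, has_moments (F i)) ->
  has_moments (fun w => \sum_(i <- r | Q i) F i w).
Proof.
move=> hF; elim: r => [|i r IH].
  under eq_fun do rewrite big_nil; exact: has_moments_cst.
under eq_fun do rewrite big_cons.
by case: (Q i) => //; exact: has_momentsD.
Qed.

Lemma ExD Z W : has_moments Z -> has_moments W ->
  Ex (fun w => Z w + W w) = Ex Z + Ex W.
Proof.
by move=> /has_moments_integrable iZ /has_moments_integrable iW; exact: RintegralD.
Qed.

Lemma ExB Z W : has_moments Z -> has_moments W ->
  Ex (fun w => Z w - W w) = Ex Z - Ex W.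
Proof.
by move=> /has_moments_integrable iZ /has_moments_integrable iW; exact: RintegralB.
Qed.

Lemma ExZ r Z : has_moments Z -> Ex (fun w => r * Z w) = r * Ex Z.
Proof. by move=> /has_moments_integrable iZ; exact: RintegralZl. Qed.

Lemma Ex_cst r : Ex (fun=> r) = r.
Proof.
rewrite /Ex Rintegral_cst// -[RHS]mulr1 -[X in _ = _ * X]/(fine 1%:E); congr (_ * fine _).
exact: probability_setT.
Qed.

Lemma Ex_sum (I : Type) (r : seq I) (Q : pred I) (F : I -> Omega -> R) :
  (forall i, has_moments (F i)) ->
  Ex (fun w => \sum_(i <- r | Q i) F i w) = \sum_(i <- r | Q i) Ex (F i).
Proof.
move=> hF; elim: r => [|i r IH].
  rewrite big_nil -[RHS](Ex_cst 0); congr Ex.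
  by apply/funext => w; rewrite big_nil.
rewrite big_cons -IH; under [in LHS]eq_fun do rewrite big_cons.
by case: (Q i) => //; rewrite ExD//; exact: has_moments_sum.
Qed.

Lemma le_Ex Z W : has_moments Z -> has_moments W ->
  (forall w, Z w <= W w) -> Ex Z <= Ex W.
Proof.
move=> /has_moments_integrable iZ /has_moments_integrable iW ZW.
by apply: le_Rintegral => // w _; exact: ZW.
Qed.

Lemma Ex_ge0 Z : (forall w, 0 <= Z w) -> 0 <= Ex Z.
Proof. by move=> Z0; apply: Rintegral_ge0 => w _; exact: Z0. Qed.

Lemma ler_norm_Ex Z : has_moments Z -> `|Ex Z| <= Ex (fun w => `|Z w|).
Proof. by move=> /has_moments_integrable iZ; exact: le_normr_Rintegral. Qed.

(** Weighted AM-GM under the expectation; [eps] is left free so that one factor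
    may be small and the other merely bounded. *)
Lemma Ex_AMGM eps Z W : 0 < eps -> has_moments Z -> has_moments W ->
  `|Ex (fun w => Z w * W w)| <=
  eps^-1 * Ex (fun w => Z w ^+ 2) + eps * Ex (fun w => W w ^+ 2).
Proof.
move=> e0 hZ hW.
rewrite -!ExZ -?ExD; try by [apply: has_momentsZ; exact: has_momentsX
  | exact: has_momentsX].
apply: (le_trans (ler_norm_Ex (has_momentsM hZ hW))); apply: le_Ex.
- exact/has_moments_norm/has_momentsM.
- by apply: has_momentsD; apply: has_momentsZ; exact: has_momentsX.
move=> w; rewrite normrM.
have := sqr_ge0 (`|Z w| - eps * `|W w|).
rewrite sqrrB exprMn !real_normK ?num_real// => h.
have h1 : 0 <= `|Z w| * `|W w| by exact: mulr_ge0.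
have h2 : `|Z w| * `|W w| * eps <= Z w ^+ 2 + eps ^+ 2 * W w ^+ 2.
  have : 0 <= `|Z w| * `|W w| * eps by rewrite mulr_ge0// ltW.
  move: h; rewrite -mulr_natr mulrA (mulrAC _ eps) => h' h''; lra.
rewrite -(ler_pM2r e0) (le_trans h2)// le_eqVlt; apply/orP; left; apply/eqP.
by field; rewrite gt_eqF.
Qed.

(** The joint law of [U] and [V] is the product of their laws, so this is
    Fubini's theorem. *)
Lemma Ex_indep (U V : Omega -> R) :
  has_moments U -> has_moments V ->
  (forall A B, measurable A -> measurable B ->
    P (U @^-1` A `&` V @^-1` B) = (P (U @^-1` A) * P (V @^-1` B))%E) ->
  Ex (fun w => U w * V w) = Ex U * Ex V.
Proof.
move=> hU hV UV; have [mU _] := hU; have [mV _] := hV.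
pose U' : {mfun Omega >-> R} := mfun_Sub (mem_set mU).
pose V' : {mfun Omega >-> R} := mfun_Sub (mem_set mV).
have mUV : measurable_fun [set: Omega] (fun w => (U w, V w)).
  exact: measurable_fun_pair.
pose W' : {mfun Omega >-> (R * R)%type} := mfun_Sub (mem_set mUV).
pose m1 := distribution P U'; pose m2 := distribution P V'.
pose m := distribution P W'.
have mE X : measurable X -> (m1 \x m2)%E X = m X.
  by apply: product_measure_unique => A B mA mB; rewrite -UV.
have mf : measurable_fun [set: R * R] (fun x : R * R => (x.1 * x.2)%:E).
  by apply/measurable_EFinP; apply: measurable_funM.
have iUV := has_moments_integrable (has_momentsM hU hV).
have if' : (m1 \x m2)%E.-integrable [set: R * R] (fun x : R * R => (x.1 * x.2)%:E).
  have : m.-integrable [set: R * R] (fun x : R * R => (x.1 * x.2)%:E).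
    by apply: integrable_pushforward.
  move=> /integrableP[_ h]; apply/integrableP; split => //.
  by rewrite (@eq_measure_integral _ _ _ _ m)// => A mA _; exact: mE.
have E1 : (\int[P]_w (U w * V w)%:E = \int[m]_x (x.1 * x.2)%:E)%E.
  by rewrite /m integral_distribution.
have iU : m1.-integrable [set: R] EFin.
  by apply: integrable_pushforward => //; exact: has_moments_integrable.
have iV : m2.-integrable [set: R] EFin.
  by apply: integrable_pushforward => //; exact: has_moments_integrable.
have EV : (\int[m2]_y y%:E)%E = (Ex V)%:E.
  rewrite /m2 integral_distribution//; last exact: has_moments_integrable.
  by rewrite fineK// integrable_fin_num//; exact: has_moments_integrable.
have EU : (\int[m1]_y y%:E)%E = (Ex U)%:E.
  rewrite /m1 integral_distribution//; last exact: has_moments_integrable.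
  by rewrite fineK// integrable_fin_num//; exact: has_moments_integrable.
rewrite {1}/Ex /Rintegral E1 -(@eq_measure_integral _ _ _ _ m (m1 \x m2)%E); last first.
  by move=> A mA _; exact: mE.
rewrite -integral12_prod_meas1//.
under eq_integral => x _.
  rewrite /fubini_F /=; under eq_integral do rewrite EFinM.
  rewrite integralZl// EV.
  over.
by rewrite integralZr// EU -EFinM.
Qed.

End expectation.

(** * Expansion of products of matrix entries along a direction *)

Section expansion.
Context (R : comNzRingType) (n : nat).

(* [(m, (a, b))] stands for the function [X |-> (X ^+ m) a b]. *)
Definition entry_mono := seq (nat * ('I_n * 'I_n)).

Definition mono_eval (X : 'M[R]_n) (v : entry_mono) : R :=
  \prod_(f <- v) (X ^+ f.1) f.2.1 f.2.2.

Definition mono_deg (v : entry_mono) : nat := \sum_(f <- v) f.1.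

Implicit Types (X Y : 'M[R]_n) (u : R) (v : entry_mono).
Implicit Types p q : seq (nat * entry_mono).

Definition poly_eval Y u p : R := \sum_(x <- p) u ^+ x.1 * mono_eval Y x.2.

Definition poly_mul p q : seq (nat * entry_mono) :=
  [seq ((x.1 + y.1)%N, x.2 ++ y.2) | x <- p, y <- q].

Definition poly_coef Y p k : R := \sum_(x <- p | x.1 == k) mono_eval Y x.2.

Lemma mono_eval_nil X : mono_eval X [::] = 1.
Proof. by rewrite /mono_eval big_nil. Qed.

Lemma mono_eval_cons X f v :
  mono_eval X (f :: v) = (X ^+ f.1) f.2.1 f.2.2 * mono_eval X v.
Proof. by rewrite /mono_eval big_cons. Qed.

Lemma mono_eval_cat X v v' :
  mono_eval X (v ++ v') = mono_eval X v * mono_eval X v'.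
Proof. by rewrite /mono_eval big_cat. Qed.

Lemma mono_deg_cons f v : mono_deg (f :: v) = (f.1 + mono_deg v)%N.
Proof. by rewrite /mono_deg big_cons. Qed.

Lemma mono_deg_cat v v' : mono_deg (v ++ v') = (mono_deg v + mono_deg v')%N.
Proof. by rewrite /mono_deg big_cat. Qed.

Lemma poly_eval_mul Y u p q :
  poly_eval Y u (poly_mul p q) = poly_eval Y u p * poly_eval Y u q.
Proof.
rewrite /poly_eval /poly_mul big_allpairs_dep/= mulr_suml.
apply: eq_bigr => x _; rewrite mulr_sumr; apply: eq_bigr => y _.
by rewrite exprD mono_eval_cat mulrACA.
Qed.

Lemma poly_coef_mul0 Y p q :
  poly_coef Y (poly_mul p q) 0 = poly_coef Y p 0 * poly_coef Y q 0.
Proof.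
rewrite /poly_coef /poly_mul big_mkcond big_allpairs_dep/= mulr_suml [RHS]big_mkcond.
apply: eq_bigr => x _; rewrite mulr_sumr [in RHS]big_mkcond/=.
case: x.1 => [|k] /=; last by rewrite big1.
by apply: eq_bigr => y _; rewrite add0n mono_eval_cat.
Qed.

Lemma poly_coef_mul1 Y p q :
  poly_coef Y (poly_mul p q) 1 =
  poly_coef Y p 1 * poly_coef Y q 0 + poly_coef Y p 0 * poly_coef Y q 1.
Proof.
rewrite /poly_coef /poly_mul big_mkcond big_allpairs_dep/= !mulr_suml.
rewrite [X in _ = X + _]big_mkcond [X in _ = _ + X]big_mkcond -big_split/=.
apply: eq_bigr => x _; rewrite !mulr_sumr.
rewrite [X in X + _](_ : _ = \sum_(y <- q) if (x.1 == 1)%N && (y.1 == 0)%N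
    then mono_eval Y x.2 * mono_eval Y y.2 else 0); last first.
  by case: (x.1 == 1)%N => /=; [rewrite [LHS]big_mkcond|rewrite big1].
rewrite [X in _ + X](_ : _ = \sum_(y <- q) if (x.1 == 0)%N && (y.1 == 1)%N
    then mono_eval Y x.2 * mono_eval Y y.2 else 0); last first.
  by case: (x.1 == 0)%N => /=; [rewrite [LHS]big_mkcond|rewrite big1].
rewrite -big_split/=; apply: eq_bigr => y _; rewrite mono_eval_cat.
by move: x.1 y.1 => [|[|k]] [|[|l]] /=; rewrite ?addr0 ?add0r// addnS.
Qed.

Section direction.
Variable E : seq ('I_n * 'I_n).

Definition direction : 'M[R]_n := \sum_(e <- E) delta_mx e.1 e.2.

(** The expansion of [(Y ^+ i *m (Y + u *: direction) ^+ m) a b] in powers of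
    [u], obtained by choosing [Y] or one of the matrix units of [E] in each of
    the [m] factors and merging consecutive choices of [Y]. *)
Fixpoint expand_entry (b : 'I_n) (m i : nat) (a : 'I_n) :
    seq (nat * entry_mono) :=
  if m is m'.+1 then
    expand_entry b m' i.+1 a ++
    [seq (x.1.+1, (i, (a, e.1)) :: x.2) | e <- E, x <- expand_entry b m' 0 e.2]
  else [:: (0%N, [:: (i, (a, b))])].

Definition expand_mono v : seq (nat * entry_mono) :=
  foldr (fun f p => poly_mul (expand_entry f.2.2 f.1 0 f.2.1) p) [:: (0%N, [::])] v.

Lemma poly_eval_entry Y u b m i a :
  poly_eval Y u (expand_entry b m i a) =
  (Y ^+ i *m (Y + u *: direction) ^+ m) a b.
Proof.
elim: m i a => [|m IH] i a /=.
  by rewrite /poly_eval big_seq1 mono_eval_cons mono_eval_nil mulr1 mul1r expr0 mulmx1.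
rewrite /poly_eval big_cat/= -/(poly_eval _ _ _) IH big_allpairs_dep/=.
set Z := Y + u *: direction.
rewrite (_ : Z ^+ m.+1 = Z *m Z ^+ m); last by rewrite exprS.
rewrite {1}/Z mulmxDl mulmxDr [RHS]mxE.
rewrite (mulmxA (Y ^+ i) Y) (_ : Y ^+ i *m Y = Y ^+ i.+1); last by rewrite exprSr.
congr (_ + _).
rewrite -scalemxAl -scalemxAr /direction  mulmx_suml mulmx_sumr.
rewrite scaler_sumr summxE; apply: eq_bigr => e _.
transitivity (u * ((Y ^+ i) a e.1 * (Z ^+ m) e.2 b)); last first.
  rewrite [RHS]mxE; congr (u * _); apply/esym; rewrite mxE (bigD1 e.1)//= big1 ?addr0; last first.
    move=> j je; rewrite mxE big1 ?mulr0// => k _.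
    by rewrite mxE (negbTE je) mul0r.
  congr (_ * _); rewrite mxE (bigD1 e.2)//= big1 ?addr0; last first.
    by move=> j je; rewrite mxE (negbTE je) andbF mul0r.
  by rewrite mxE !eqxx mul1r.
have := IH 0%N e.2; rewrite expr0 mul1mx => <-.
rewrite /poly_eval !mulr_sumr; apply: eq_bigr => x _.
by rewrite mono_eval_cons/= exprS; ring.
Qed.

(** Multiplicativity of [poly_eval] reduces the expansion of a monomial to that
    of its factors. *)
Lemma poly_eval_mono Y u v :
  poly_eval Y u (expand_mono v) = mono_eval (Y + u *: direction) v.
Proof.
elim: v => [|f v IH].
  by rewrite /poly_eval big_seq1 !mono_eval_nil mulr1 expr0.
rewrite /= poly_eval_mul IH mono_eval_cons poly_eval_entry.
by rewrite expr0 mul1mx.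
Qed.

(** Each of the [m] factors offers [(size E).+1] choices. *)
Lemma size_expand_entry b m i a :
  size (expand_entry b m i a) = ((size E).+1 ^ m)%N.
Proof.
elim: m i a => //= m IH i a; rewrite size_cat IH size_allpairs_dep expnS mulSn.
congr (_ + _)%N; rewrite (eq_map (g := fun=> ((size E).+1 ^ m)%N)) => [|e]; last exact: IH.
set k := ((size E).+1 ^ m)%N; clearbody k.
by elim: E => //= e E' ->; rewrite mulSn.
Qed.

Lemma size_expand_mono v : size (expand_mono v) = ((size E).+1 ^ mono_deg v)%N.
Proof.
elim: v => [|f v IH]; first by rewrite /mono_deg big_nil.
by rewrite /= size_allpairs IH size_expand_entry mono_deg_cons expnD.
Qed.

Lemma expand_entry_deg b m i a x : x \in expand_entry b m i a ->
  (x.1 + mono_deg x.2 = i + m)%N.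
Proof.
elim: m i a x => [|m IH] i a x /=.
  by rewrite inE => /eqP -> /=; rewrite mono_deg_cons /mono_deg big_nil !addn0 add0n.
rewrite mem_cat => /orP[/IH ->|/allpairsPdep[e [y [_ /IH + ->]]]].
  by rewrite addSnnS.
by rewrite /= mono_deg_cons/=; lia.
Qed.

Lemma expand_mono_deg v x : x \in expand_mono v ->
  (x.1 + mono_deg x.2 = mono_deg v)%N.
Proof.
elim: v x => [|f v IH] x /=.
  by rewrite inE => /eqP -> /=; rewrite /mono_deg big_nil.
move=> /allpairsPdep[y [z [/expand_entry_deg + /IH + ->]]] /=.
by rewrite mono_deg_cons mono_deg_cat => h1 h2; rewrite addnACA h1 h2.
Qed.

Lemma coef0_expand_entry Y b m i a :
  poly_coef Y (expand_entry b m i a) 0 = (Y ^+ (i + m)) a b.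
Proof.
elim: m i a => [|m IH] i a /=.
  by rewrite /poly_coef big_mkcond big_seq1/= mono_eval_cons mono_eval_nil mulr1 addn0.
rewrite /poly_coef big_cat/= -/(poly_coef _ _ _) IH addSnnS.
by rewrite [X in _ + X]big_mkcond big_allpairs_dep big1 ?addr0// => e _; rewrite big1.
Qed.

Lemma coef0_expand_mono Y v : poly_coef Y (expand_mono v) 0 = mono_eval Y v.
Proof.
elim: v => [|f v IH].
  by rewrite /poly_coef big_mkcond big_seq1.
by rewrite /= poly_coef_mul0 IH coef0_expand_entry mono_eval_cons.
Qed.

Definition entry_deriv Y m (a b : 'I_n) : R :=
  \sum_(j < m) \sum_(e <- E) (Y ^+ j) a e.1 * (Y ^+ (m - j.+1)) e.2 b.

Lemma coef1_expand_entry Y b m i a :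
  poly_coef Y (expand_entry b m i a) 1 =
  \sum_(j < m) \sum_(e <- E) (Y ^+ (i + j)) a e.1 * (Y ^+ (m - j.+1)) e.2 b.
Proof.
elim: m i a => [|m IH] i a /=.
  by rewrite /poly_coef big_mkcond big_seq1/= big_ord0.
rewrite /poly_coef big_cat/= -/(poly_coef _ _ _) IH big_ord_recl addrC /=.
congr (_ + _); last first.
  by apply: eq_bigr => j _; rewrite /bump/= add1n addSnnS subSS.
rewrite big_mkcond big_allpairs_dep/= addn0 subn1/=; apply: eq_bigr => e _.
rewrite -{2}[m]add0n -coef0_expand_entry /poly_coef mulr_sumr [RHS]big_mkcond.
by apply: eq_bigr => x _; rewrite mono_eval_cons.
Qed.

Definition mono_deriv Y v := poly_coef Y (expand_mono v) 1.

Lemma mono_deriv_nil Y : mono_deriv Y [::] = 0.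
Proof. by rewrite /mono_deriv /poly_coef big_mkcond big_seq1. Qed.

Lemma mono_deriv_cons Y f v : mono_deriv Y (f :: v) =
  entry_deriv Y f.1 f.2.1 f.2.2 * mono_eval Y v +
  (Y ^+ f.1) f.2.1 f.2.2 * mono_deriv Y v.
Proof.
rewrite /mono_deriv/= poly_coef_mul1 !coef0_expand_mono coef0_expand_entry.
by rewrite coef1_expand_entry.
Qed.

End direction.

(** Serves both for moments and for measurability with respect to various
    sigma-algebras. *)
Lemma mono_eval_closed (T : Type) (Q : (T -> R) -> Prop) :
  (forall r, Q (fun=> r)) ->
  (forall F G, Q F -> Q G -> Q (fun w => F w + G w)) ->
  (forall F G, Q F -> Q G -> Q (fun w => F w * G w)) ->
  forall X : T -> 'M[R]_n, (forall i j, Q (fun w => X w i j)) ->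
  forall v, Q (fun w => mono_eval (X w) v).
Proof.
move=> Qc QD QM X QX.
have Qsum (r : seq 'I_n) (F : 'I_n -> T -> R) : (forall i, Q (F i)) ->
    Q (fun w => \sum_(i <- r) F i w).
  move=> QF; elim: r => [|i r IH].
    by under eq_fun do rewrite big_nil; exact: Qc.
  by under eq_fun do rewrite big_cons; exact: QD.
have Qpow m i j : Q (fun w => (X w ^+ m) i j).
  elim: m i j => [|m IH] i j.
    by under eq_fun do rewrite expr0 mxE; exact: Qc.
  under eq_fun do rewrite exprS mxE.
  by apply: Qsum => k; exact: QM.
elim => [|f v IH]; first by under eq_fun do rewrite mono_eval_nil; exact: Qc.
by under eq_fun do rewrite mono_eval_cons; exact: QM.
Qed.

End expansion.
Arguments direction R {n} E.

(** * Independence of one variable from all others *)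

Section independence.
Context d (Omega : measurableType d) (R : realType) (P : probability Omega R).
Context (I : choiceType) (X : I -> {RV P >-> R}).
Hypothesis X_indep : mutually_independent P X.

(** A pi-system generating the information carried by the variables other than
    [X e]. *)
Definition others_cylinder (e : I) : set (set Omega) :=
  [set A | exists (J : {fset I}) (B : I -> set R),
    [/\ e \notin J, forall f, measurable (B f) &
        A = \bigcap_(f in [set` J]) (X f @^-1` B f)]].

Lemma others_cylinder_measurable e : others_cylinder e `<=` measurable.
Proof.
move=> _ [J [B [_ mB ->]]]; apply: fin_bigcap_measurable => // f _.
exact: measurable_funPTI.
Qed.

Lemma others_cylinderI e : setI_closed (others_cylinder e).
Proof.
move=> _ _ [J1 [B1 [eJ1 mB1 ->]]] [J2 [B2 [eJ2 mB2 ->]]].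
pose B f := (if f \in J1 then B1 f else setT) `&` (if f \in J2 then B2 f else setT).
exists (J1 `|` J2)%fset, B; split.
- by rewrite inE negb_or eJ1.
- by move=> f; apply: measurableI; case: ifP.
apply/seteqP; split=> w.
  move=> [h1 h2] f /=; rewrite inE => _; rewrite /B.
  split; first by case: ifPn => // fJ; exact: h1.
  by case: ifPn => // fJ; exact: h2.
move=> h; split => f /= fJ.
  have : (X f @^-1` B f) w by apply: h; rewrite /= inE fJ.
  by rewrite /preimage/= /B fJ => -[].
have : (X f @^-1` B f) w by apply: h; rewrite /= inE fJ orbT.
by rewrite /preimage/= /B fJ => -[].
Qed.

Lemma others_cylinderT e : others_cylinder e setT.
Proof.
exists fset0, (fun=> setT); split => //.
by apply/seteqP; split => // w _ f /=; rewrite inE.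
Qed.

(** Both sides are finite measures in [B]; they agree on the pi-system of
    cylinders by mutual independence, hence on the sigma-algebra it generates. *)
Lemma indep_others e A B : measurable A -> <<s others_cylinder e >> B ->
  P (X e @^-1` A `&` B) = (P (X e @^-1` A) * P B)%E.
Proof.
move=> mA sB.
have mXA : measurable (X e @^-1` A) by exact: measurable_funPTI.
have PXA : P (X e @^-1` A) \is a fin_num by exact: fin_num_measure.
pose r : {nonneg R} := NngNum (fine_ge0 (measure_ge0 P (X e @^-1` A))).
have rE : (r%:num)%:E = P (X e @^-1` A) by exact: fineK.
have cyl Z : others_cylinder e Z ->
    P (Z `&` X e @^-1` A) = (P (X e @^-1` A) * P Z)%E.
  move=> [J [B' [eJ mB' ->]]].
  pose B'' f := if f == e then A else B' f.
  have BE f : f \in J -> B'' f = B' f.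
    by move=> fJ; rewrite /B''; case: eqP => // fe; rewrite -fe fJ in eJ.
  have -> : \bigcap_(f in [set` J]) X f @^-1` B' f `&` X e @^-1` A =
            \bigcap_(f in [set` (e |` J)%fset]) X f @^-1` B'' f.
    apply/seteqP; split => w.
      move=> [h hA] f /=; rewrite !inE => /orP[/eqP ->|fJ].
        by rewrite /preimage/= /B'' eqxx.
      by rewrite BE//; exact: h.
    move=> h; split.
      by move=> f fJ /=; rewrite -BE//; apply: h; rewrite /= !inE fJ orbT.
    have : (X e @^-1` B'' e) w by apply: h; rewrite /= !inE eqxx.
    by rewrite /preimage/= /B'' eqxx.
  have mB'' f : measurable (B'' f) by rewrite /B''; case: eqP.
  rewrite X_indep// big_fsetU1//= {1}/B'' eqxx; congr (_ * _)%E.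
  rewrite X_indep//; apply: eq_big_seq => f fJ.
  by rewrite BE.
pose m1 := mrestr P mXA.
pose m2 := mscale r P.
have : m1 B = m2 B.
  apply: (g_sigma_algebra_measure_unique (others_cylinder e)
    (@others_cylinder_measurable e) (fun=> setT)) sB => //.
  - by move=> _; exact: others_cylinderT.
  - by rewrite bigcup_const.
  - exact: others_cylinderI.
  - by move=> Z /cyl; rewrite -rE.
  - by move=> _; rewrite /= /mrestr setTI ltey_eq PXA.
by rewrite /m1 /m2 /mrestr /mscale setIC rE.
Qed.

(** The form of independence used below: [F] may be any function of the
    variables other than [X e]. *)
Lemma Ex_indep_others e k (F : Omega -> R) :
  has_moments P (X e) -> has_moments P F ->
  measurable_fun [set: g_sigma_algebraType (others_cylinder e)]
    (F : g_sigma_algebraType (others_cylinder e) -> R) ->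
  Ex P (fun w => X e w ^+ k * F w) = Ex P (fun w => X e w ^+ k) * Ex P F.
Proof.
move=> hX hF mF; apply: Ex_indep => //; first exact: has_momentsX.
move=> A B mA mB.
have -> : (fun w => X e w ^+ k) @^-1` A = X e @^-1` ((fun x => x ^+ k) @^-1` A).
  by [].
apply: indep_others.
  have mk : measurable_fun [set: R] (fun x : R => x ^+ k) by exact: measurable_funX.
  by have := mk measurableT A mA; rewrite setTI.
by have := mF measurableT B mB; rewrite setTI.
Qed.

Lemma measurable_others e f : f != e ->
  measurable_fun [set: g_sigma_algebraType (others_cylinder e)]
    (X f : g_sigma_algebraType (others_cylinder e) -> R).
Proof.
move=> fe _ B mB; rewrite setTI; apply: sub_sigma_algebra.
exists [fset f]%fset, (fun=> B); split => //.
  by rewrite inE eq_sym.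
apply/seteqP; split => w /=.
  by move=> h g /=; rewrite inE => /eqP ->.
by move=> /(_ f); apply; rewrite /= inE.
Qed.

End independence.

(** * Band matrices *)

Lemma entry_exprS (R : pzRingType) n (X : 'M[R]_n) l a b :
  (X ^+ l.+1) a b = \sum_j X a j * (X ^+ l) j b.
Proof. by rewrite exprS mxE. Qed.

Section band_model.
Context (R : realType) (L : choiceType) (C : completePseudoMetricType R).
Variables (kappa : L -> C) (D : C -> R).
Implicit Types (N : {fset L}) (x : upair L -> R) (S : pred (upair L)).

Lemma letter_inj N : injective (@letter L N).
Proof.
move=> i j; have x0 := letter i; rewrite /letter !(tnth_nth x0) /=.
by move/eqP; rewrite nth_uniq ?fset_uniq// => /eqP /val_inj.
Qed.

Definition edge N (i j : 'I_#|` N|) : upair L := mk_upair (letter i) (letter j).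

Lemma mk_upair_sym (a b : L) : mk_upair a b = mk_upair b a.
Proof. by apply: val_inj; rewrite /= fsetUC. Qed.

Lemma edge_eq N (i j k l : 'I_#|` N|) :
  (edge i j == edge k l) = (i == k) && (j == l) || (i == l) && (j == k).
Proof.
apply/idP/idP; last first.
  by move=> /orP[] /andP[/eqP -> /eqP ->] //; rewrite /edge mk_upair_sym.
move=> /eqP/(congr1 val) /= h.
have m y : (y \in [fset letter i; letter j]%fset) = (y \in [fset letter k; letter l]%fset).
  by rewrite h.
have := m (letter i); have := m (letter j); have := m (letter k); have := m (letter l).
rewrite !inE !(inj_eq (@letter_inj N)) !eqxx ?orbT /=.
rewrite ![k == _]eq_sym ![l == _]eq_sym.
case: (eqVneq i k) => [->|ik]; case: (eqVneq j l) => [->|jl];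
  case: (eqVneq i l) => [il|il]; case: (eqVneq j k) => [jk|jk] //=.
Qed.

Definition erase (S : pred (upair L)) x : upair L -> R :=
  fun e => if S e then 0 else x e.

Definition edge_units n (i j : 'I_n) : seq ('I_n * 'I_n) :=
  if i == j then [:: (i, i)] else [:: (i, j); (j, i)].

Lemma size_edge_units n (i j : 'I_n) : (size (edge_units i j) <= 2)%N.
Proof. by rewrite /edge_units; case: eqP. Qed.

Notation scaling N := ((Num.sqrt (#|` N|%:R : R))^-1).

Lemma band_matrixE x N i j : band_matrix kappa D x N i j =
  D (kappa (letter i)) *+ (i == j) + scaling N * x (edge i j).
Proof. by rewrite mxE (inj_eq (@letter_inj N)). Qed.

(** The dependence on one variable is affine, in the direction of the one or two
    matrix units attached to the pair. *)
Lemma band_matrix_erase N x (i j : 'I_#|` N|) :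
  band_matrix kappa D x N =
  band_matrix kappa D (erase (pred1 (edge i j)) x) N +
  (scaling N * x (edge i j)) *: direction R (edge_units i j).
Proof.
apply/matrixP => k l; rewrite !mxE -addrA; congr (_ + _).
rewrite /erase /= -/(edge k l).
have -> : direction R (edge_units i j) k l = (edge k l == edge i j)%:R.
  rewrite /direction /edge_units summxE edge_eq; case: (eqVneq i j) => [->|ij].
    by rewrite big_seq1 mxE/= orbb.
  rewrite big_cons big_seq1 !mxE/=.
  case: (eqVneq k i) => [ki|]; case: (eqVneq l j) => [lj|] //=;
    rewrite ?add0r ?addr0//.
  by rewrite ki (negbTE ij) addr0.
by case: eqP => [->|_]; rewrite ?mulr0 ?mulr1 ?add0r ?addr0.
Qed.

Lemma band_matrix_tr N x : (band_matrix kappa D x N)^T = band_matrix kappa D x N.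
Proof.
apply/matrixP => i j; rewrite !mxE mk_upair_sym eq_sym.
by case: eqP => [->|].
Qed.

Lemma band_matrixX_sym N x m i j :
  (band_matrix kappa D x N ^+ m) i j = (band_matrix kappa D x N ^+ m) j i.
Proof.
have trX : (band_matrix kappa D x N ^+ m)^T = band_matrix kappa D x N ^+ m.
  elim: m => [|m IH]; first by rewrite expr0 trmx1.
  by rewrite [in LHS]exprS -[_ * _]/(_ *m _) trmx_mul IH band_matrix_tr exprSr.
by rewrite -[in LHS]trX mxE.
Qed.

Lemma scaling_ge0 N : 0 <= scaling N.
Proof. by rewrite invr_ge0 sqrtr_ge0. Qed.

Lemma scaling_sq N : scaling N ^+ 2 = #|` N|%:R^-1.
Proof. by rewrite exprVn sqr_sqrtr. Qed.

Lemma scaling_le1 N : scaling N <= 1.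
Proof.
case: (posnP #|` N|) => [->|N0]; first by rewrite sqrtr0 invr0.
rewrite invf_le1 ?sqrtr_gt0 ?ltr0n//.
by rewrite -[leLHS]sqrtr1 ler_sqrt ?ler1n// ltr0n.
Qed.

Lemma band_matrix_mono_closed (T : Type) (Q : (T -> R) -> Prop) :
  (forall r, Q (fun=> r)) ->
  (forall F G, Q F -> Q G -> Q (fun w => F w + G w)) ->
  (forall F G, Q F -> Q G -> Q (fun w => F w * G w)) ->
  forall x : T -> upair L -> R, (forall e, Q (fun w => x w e)) ->
  forall N v, Q (fun w => mono_eval (band_matrix kappa D (x w) N) v).
Proof.
move=> Qc QD QM x Qx N v; apply: mono_eval_closed => // i j.
by under eq_fun do rewrite band_matrixE; apply: QD => //; exact: QM.
Qed.

Context disp (Omega : measurableType disp) (P : probability Omega R).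
Variable xi : upair L -> {RV P >-> R}.
Hypothesis xi_indep : mutually_independent P xi.
Hypothesis xi_moments : forall e, has_moments P (xi e).
Hypothesis xi_mean0 : forall e, Ex P (xi e) = 0.
Variable c : nat -> R.
Hypothesis c_ge0 : forall k, 0 <= c k.
Hypothesis xi_bound : forall e k, Ex P (fun w => `|xi e w| ^+ k) <= c k.
Variable bD : R.
Hypothesis bD_ge0 : 0 <= bD.
Hypothesis D_bound : forall a, `|D a| <= bD.

Definition erased_matrix (S : pred (upair L)) N (w : Omega) : 'M[R]_#|` N| :=
  band_matrix kappa D (erase S (xi ^~ w)) N.

Lemma erased_matrix_moments S N v :
  has_moments P (fun w => mono_eval (erased_matrix S N w) v).
Proof.
apply: (band_matrix_mono_closed (Q := has_moments P)).
- exact: has_moments_cst.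
- by move=> F G; exact: has_momentsD.
- by move=> F G; exact: has_momentsM.
- move=> e; rewrite /erase; case: (S e); first exact: has_moments_cst.
  exact: xi_moments.
Qed.

Lemma erased_matrix_others S N v (e : upair L) : S e ->
  measurable_fun [set: g_sigma_algebraType (others_cylinder xi e)]
    ((fun w => mono_eval (erased_matrix S N w) v)
       : g_sigma_algebraType (others_cylinder xi e) -> R).
Proof.
move=> Se; pose T := g_sigma_algebraType (others_cylinder xi e).
apply: (band_matrix_mono_closed
  (Q := fun F : T -> R => measurable_fun [set: T] F)).
- by move=> r; exact: measurable_cst.
- by move=> F G; exact: measurable_funD.
- by move=> F G; exact: measurable_funM.
- move=> f; rewrite /erase; case Sf: (S f); first exact: measurable_cst.
  by apply: measurable_others; apply: contraFneq Sf => ->.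
Qed.

Definition erase1 (e : upair L) (S : pred (upair L)) : pred (upair L) :=
  fun f => (f == e) || S f.

Lemma mono_eval_erase1 S N (i j : 'I_#|` N|) v w : ~~ S (edge i j) ->
  mono_eval (erased_matrix S N w) v =
  \sum_(y <- expand_mono (edge_units i j) v)
    scaling N ^+ y.1 * (xi (edge i j) w ^+ y.1 *
      mono_eval (erased_matrix (erase1 (edge i j) S) N w) y.2).
Proof.
move=> Se; rewrite {1}/erased_matrix (band_matrix_erase _ i j) -poly_eval_mono.
rewrite /poly_eval {1}/erase (negbTE Se); apply: eq_bigr => y _.
rewrite exprMn mulrA; congr (_ * mono_eval _ _); rewrite /erased_matrix.
congr (band_matrix kappa D _ N); apply/funext => f.
by rewrite /erase/erase1/=; case: (f == _).
Qed.

(** Once the variable of a pair is erased the rest is independent of it, so that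
    each term of the expansion in this variable factors. *)
Lemma Ex_expand S N (i j : 'I_#|` N|) v r : ~~ S (edge i j) ->
  Ex P (fun w => xi (edge i j) w ^+ r * mono_eval (erased_matrix S N w) v) =
  \sum_(y <- expand_mono (edge_units i j) v)
    scaling N ^+ y.1 * (Ex P (fun w => xi (edge i j) w ^+ (r + y.1)) *
      Ex P (fun w => mono_eval (erased_matrix (erase1 (edge i j) S) N w) y.2)).
Proof.
move=> Se; set e := edge i j; set S' := erase1 e S.
have S'e : S' e by rewrite /S' /erase1 eqxx.
transitivity (Ex P (fun w => \sum_(y <- expand_mono (edge_units i j) v)
    scaling N ^+ y.1 * (xi e w ^+ (r + y.1) *
      mono_eval (erased_matrix S' N w) y.2))).
  congr (Ex P); apply/funext => w; rewrite (mono_eval_erase1 _ _ Se) mulr_sumr.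
  by apply: eq_bigr => y _; rewrite exprD -/e -/S'; ring.
have h y : has_moments P (fun w => xi e w ^+ (r + y.1) *
    mono_eval (erased_matrix S' N w) y.2).
  by apply: has_momentsM; [exact: has_momentsX|exact: erased_matrix_moments].
rewrite Ex_sum => [|y]; last exact: has_momentsZ.
apply: eq_bigr => y _; rewrite ExZ//; congr (_ * _).
apply: Ex_indep_others => //; first exact: erased_matrix_moments.
exact: erased_matrix_others.
Qed.

Let cs m := \sum_(k < m.+1) c k.

Let cs_ge0 m : 0 <= cs m.
Proof. exact: sumr_ge0. Qed.

Lemma Ex_pow_bound e k m : (k <= m)%N ->
  `|Ex P (fun w => xi e w ^+ k)| <= cs m.
Proof.
move=> km; apply: (le_trans (ler_norm_Ex (has_momentsX k (xi_moments e)))).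
under eq_fun do rewrite normrX.
apply: (le_trans (xi_bound e k)).
by rewrite /cs (bigD1 (Ordinal (km : k < m.+1)%N))//= lerDl sumr_ge0.
Qed.

Lemma ler_norm_sum_size (T : eqType) (r : seq T) (Q : pred T) (F : T -> R) B :
  0 <= B -> (forall y, y \in r -> Q y -> `|F y| <= B) ->
  `|\sum_(y <- r | Q y) F y| <= (size r)%:R * B.
Proof.
move=> B0 FB; apply: (le_trans (ler_norm_sum _ _ _)).
rewrite big_seq_cond; apply: (@le_trans _ _ (\sum_(y <- r) B)).
  rewrite [leRHS]big_seq big_mkcond [leRHS]big_mkcond/=; apply: ler_sum => y _.
  by case: (boolP (y \in r)) => //= yr; case: ifP => // Qy; exact: FB.
by rewrite big_const_seq count_predT iter_addr addr0 mulr_natl.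
Qed.

(** The terms of order at least [l]: there are at most [3 ^ m] of them, and a
    term of order [k] carries [scaling N ^+ k <= scaling N ^+ l]. *)
Lemma expand_tail_bound S N (i j : 'I_#|` N|) v r l m (K : R) : (mono_deg v <= m)%N ->
  0 <= K ->
  (forall S v, (mono_deg v <= m)%N ->
    `|Ex P (fun w => mono_eval (erased_matrix S N w) v)| <= K) ->
  `|\sum_(y <- expand_mono (edge_units i j) v | (l <= y.1)%N)
    scaling N ^+ y.1 * (Ex P (fun w => xi (edge i j) w ^+ (r + y.1)) *
      Ex P (fun w => mono_eval (erased_matrix S N w) y.2))| <=
  3 ^+ m * cs (r + m) * K * scaling N ^+ l.
Proof.
move=> vm K0 HK.
have t0 := scaling_ge0 N; have t1 := scaling_le1 N.
have B0 : 0 <= cs (r + m) * K * scaling N ^+ l.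
  by rewrite !mulr_ge0 ?exprn_ge0.
apply: le_trans (ler_norm_sum_size (B := cs (r + m) * K * scaling N ^+ l) B0 _) _.
  move=> y /expand_mono_deg yv ly.
  rewrite !normrM normrX (ger0_norm t0) mulrC ler_pM ?mulr_ge0 ?exprn_ge0//.
    rewrite ler_pM//.
      by apply: Ex_pow_bound; rewrite leq_add2l (leq_trans _ vm)// -yv leq_addr.
    by apply: HK; rewrite (leq_trans _ vm)// -yv leq_addl.
  by rewrite ler_wiXn2l.
rewrite -!mulrA ler_wpM2r ?mulrA//.
rewrite size_expand_mono -natrX ler_nat.
apply: (leq_trans (leq_pexp2l (ltn0Sn _) vm)).
by case: (m) => // m'; rewrite leq_exp2r// ltnS size_edge_units.
Qed.

(** Expand the first step of a power in the variable of the pair it uses.  The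
    term of order 0 vanishes because the variable is centred, and the terms of
    order [k >= 1] have smaller degree and carry a factor
    [scaling N ^+ k.+1 <= #|N|^-1], which compensates for the sum over the second
    letter.  Allowing erased variables makes the induction close. *)
Lemma moment_bound m : exists2 K : R, 0 <= K & forall S N v, (mono_deg v <= m)%N ->
  `|Ex P (fun w => mono_eval (erased_matrix S N w) v)| <= K.
Proof.
elim: m => [|m [K K0 HK]].
  exists 1 => // S N v; rewrite leqn0 => /eqP v0.
  have v01 : forall w, `|mono_eval (erased_matrix S N w) v| <= 1.
    move=> w; elim: v v0 => [|f v IH]; first by rewrite mono_eval_nil normr1.
    rewrite mono_deg_cons => /eqP; rewrite addn_eq0 => /andP[/eqP f0 /eqP v0].
    rewrite mono_eval_cons normrM f0 expr0 mulr_ile1// ?IH//.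
    by rewrite mxE; case: eqP => _; rewrite ?normr1 ?normr0.
  apply: (le_trans (ler_norm_Ex (erased_matrix_moments S v))).
  rewrite -[leRHS](Ex_cst P); apply: le_Ex => //.
    exact/has_moments_norm/erased_matrix_moments.
  exact: has_moments_cst.
pose B := Num.max 1 K + bD * K + 3 ^+ m * cs m.+1 * K.
have B0 : 0 <= Num.max 1 K by rewrite le_max ler01.
have P1 : 0 <= bD * K by exact: mulr_ge0.
have P2 : 0 <= 3 ^+ m * cs m.+1 * K by rewrite !mulr_ge0 ?exprn_ge0.
exists B; first by rewrite !addr_ge0.
move=> S N; have t0 := scaling_ge0 N.
have KB : K <= B.
  have : K <= Num.max 1 K by rewrite le_max lexx orbT.
  by rewrite /B; lra.
elim => [|f v IH] fv.
  under eq_fun do rewrite mono_eval_nil.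
  have : 1 <= Num.max 1 K by rewrite le_max lexx.
  by rewrite Ex_cst normr1 /B; lra.
move: f fv => [[|l] [a b]]; rewrite mono_deg_cons/= => fv.
  under eq_fun do rewrite mono_eval_cons expr0 mxE/=.
  rewrite ExZ ?normrM; last exact: erased_matrix_moments.
  rewrite (le_trans _ (IH _)) ?(leq_trans _ fv)// ler_piMl//.
  by case: eqP => _; rewrite ?normr1 ?normr0.
have lv : (l + mono_deg v <= m)%N by rewrite -ltnS -addSn.
pose vj j : entry_mono #|` N| := (l, (j, b)) :: v.
have vjm j : (mono_deg (vj j) <= m)%N by rewrite mono_deg_cons.
pose F w j := erase S (xi ^~ w) (edge a j) * mono_eval (erased_matrix S N w) (vj j).
have -> : (fun w => mono_eval (erased_matrix S N w) ((l.+1, (a, b)) :: v)) =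
    (fun w => D (kappa (letter a)) * mono_eval (erased_matrix S N w) (vj a) +
       scaling N * \sum_j F w j).
  apply/funext => w; rewrite mono_eval_cons/= entry_exprS.
  rewrite mulr_sumr mulr_suml /F.
  under eq_bigr do rewrite /erased_matrix band_matrixE mulrDl mulrDl.
  rewrite big_split/=; congr (_ + _).
    rewrite (bigD1 a)//= eqxx mulr1n big1 ?addr0; last first.
      by move=> j ja; rewrite eq_sym (negbTE ja) mulr0n !mul0r.
    by rewrite mono_eval_cons/= mulrA.
  by apply: eq_bigr => j _; rewrite mono_eval_cons/= -!mulrA.
have hF j : has_moments P (F ^~ j).
  apply: has_momentsM; last exact: erased_matrix_moments.
  by rewrite /erase; case: (S _); [exact: has_moments_cst|exact: xi_moments].
have hv := erased_matrix_moments S (vj a).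
have hs : has_moments P (fun w => \sum_j F w j) by exact: has_moments_sum.
rewrite ExD ?ExZ ?Ex_sum//; try exact: has_momentsZ.
have FE j : `|Ex P (F ^~ j)| <= 3 ^+ m * cs m.+1 * K * scaling N.
  rewrite /F /erase; case Sj : (S (edge a j)).
    under eq_fun do rewrite mul0r.
    by rewrite Ex_cst normr0 !mulr_ge0 ?exprn_ge0.
  have := @Ex_expand S N a j (vj j) 1 (negbT Sj); rewrite /= => ->.
  rewrite (bigID (fun y => (1 <= y.1)%N))/= [X in _ + X]big1 ?addr0.
    have := @expand_tail_bound (erase1 (edge a j) S) N a j (vj j) 1 1 m K.
    by rewrite expr1 add1n; apply => // S' v'; exact: HK.
  by move=> y; rewrite -ltnNge ltnS leqn0 => /eqP ->; rewrite addn0 xi_mean0 mul0r mulr0.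
apply: (le_trans (ler_normD _ _)); rewrite /B -addrA ler_wpDl// lerD//.
  by rewrite normrM ler_pM// HK.
rewrite normrM (ger0_norm t0).
apply: (le_trans (ler_wpM2l t0 (ler_norm_sum _ _ _))).
apply: (le_trans (ler_wpM2l t0 (ler_sum _ (fun j _ => FE j)))).
rewrite sumr_const card_ord -[X in _ * X <= _]mulr_natl.
set Q := 3 ^+ m * _ * _; have Q0 : 0 <= Q by rewrite !mulr_ge0 ?exprn_ge0.
apply: (@le_trans _ _ (Q * (scaling N ^+ 2 * #|` N|%:R))).
  rewrite le_eqVlt; apply/orP; left; apply/eqP; ring.
rewrite scaling_sq ler_piMr//.
by case: (posnP #|` N|) => [->|N0]; rewrite ?mulr0// mulVf// pnatr_eq0 -lt0n.
Qed.

(** The term of order 0 of the expansion is the moment of the erased matrix. *)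
Lemma erase_cost m : exists2 K : R, 0 <= K & forall S N (i j : 'I_#|` N|) v,
  ~~ S (edge i j) -> (mono_deg v <= m)%N ->
  `|Ex P (fun w => mono_eval (erased_matrix S N w) v) -
    Ex P (fun w => mono_eval (erased_matrix (erase1 (edge i j) S) N w) v)| <=
  K * scaling N.
Proof.
have [K K0 HK] := moment_bound m.
exists (3 ^+ m * cs m * K); first by rewrite !mulr_ge0 ?exprn_ge0.
move=> S N i j v Se vm; have := @Ex_expand S N i j v 0 Se.
under eq_fun do rewrite expr0 mul1r.
move=> ->; rewrite (bigID (fun y => (1 <= y.1)%N))/= -addrA.
set S' := erase1 _ _.
rewrite [X in _ + (X - _)](_ : _ =
    Ex P (fun w => mono_eval (erased_matrix S' N w) v)).
  rewrite subrr addr0.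
  have := @expand_tail_bound S' N i j v 0 1 m K vm K0.
  by rewrite add0n expr1; apply => S1 v1; exact: HK.
under [in RHS]eq_fun do rewrite -(coef0_expand_mono (edge_units i j)) /poly_coef.
rewrite Ex_sum => [|y]; last exact: erased_matrix_moments.
under eq_bigl do rewrite -ltnNge ltnS leqn0.
apply: eq_bigr => y /eqP ->; rewrite !expr0 mul1r.
by under eq_fun do rewrite expr0; rewrite Ex_cst mul1r.
Qed.

(* The band matrix itself, seen as an erased matrix. *)
Definition matrix_of N w := erased_matrix pred0 N w.

(** Approximate integration by parts in the variable of one pair.  In the
    expansion in this variable the term of order 0 vanishes by centring, the term
    of order 1 is the derivative at the erased matrix, where replacing the erased
    matrix by the original one costs one more factor [scaling N], and the
    remaining terms are of order [scaling N ^+ 2]. *)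
Lemma Ex_xi_mono m : exists2 K : R, 0 <= K & forall N (i j : 'I_#|` N|) v,
  (mono_deg v <= m)%N ->
  `|Ex P (fun w => xi (edge i j) w * mono_eval (matrix_of N w) v) -
    scaling N * (Ex P (fun w => xi (edge i j) w ^+ 2) *
      Ex P (fun w => mono_deriv (edge_units i j) (matrix_of N w) v))| <=
  K * scaling N ^+ 2.
Proof.
have [K K0 HK] := moment_bound m.
have [K1 K10 HK1] := erase_cost m.
exists (3 ^+ m * cs m.+1 * K + 3 ^+ m * (cs 2 * K1)).
  by rewrite addr_ge0 ?mulr_ge0 ?exprn_ge0.
move=> N i j v vm; have t0 := scaling_ge0 N.
have := @Ex_expand pred0 N i j v 1 isT.
under eq_fun do rewrite expr1.
move=> ->; rewrite (bigID (fun y => (2 <= y.1)%N))/= -addrA mulrDl.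
set S' := erase1 _ _.
apply: (le_trans (ler_normD _ _)); apply: lerD.
  have := @expand_tail_bound S' N i j v 1 2 m K vm K0.
  by rewrite add1n; apply => S1 v1; exact: HK.
pose EN := expand_mono (edge_units i j) v.
rewrite (_ : \sum_(y <- _ | ~~ _) _ = \sum_(y <- EN | y.1 == 1)
    scaling N * (Ex P (fun w => xi (edge i j) w ^+ 2) *
      Ex P (fun w => mono_eval (erased_matrix S' N w) y.2))); last first.
  rewrite big_mkcond [RHS]big_mkcond; apply: eq_bigr => y _.
  case: y => -[|[|y]] y' //=.
  by rewrite addn0 xi_mean0 mul0r mulr0.
rewrite /mono_deriv /poly_coef Ex_sum => [|y]; last exact: erased_matrix_moments.
rewrite !mulr_sumr -sumrB -/EN.
have -> : 3 ^+ m * (cs 2 * K1) * scaling N ^+ 2 =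
  3 ^+ m * (cs 2 * K1 * scaling N ^+ 2) by rewrite -!mulrA.
have B0 : 0 <= cs 2 * K1 * scaling N ^+ 2 by rewrite !mulr_ge0 ?exprn_ge0.
apply: (le_trans (ler_norm_sum_size B0 _)).
  move=> y /expand_mono_deg yv _; rewrite -!mulrBr !normrM (ger0_norm t0).
  rewrite (_ : _ * scaling N ^+ 2 = scaling N * (cs 2 * (K1 * scaling N))); last first.
    by ring.
  rewrite ler_wpM2l// ler_pM// ?Ex_pow_bound// distrC.
  by apply: HK1 => //; rewrite (leq_trans _ vm)// -yv leq_addl.
rewrite ler_wpM2r// -natrX ler_nat size_expand_mono.
apply: (leq_trans (leq_pexp2l (ltn0Sn _) vm)).
by case: (m) => // m'; rewrite leq_exp2r// ltnS size_edge_units.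
Qed.

Lemma matrix_ofE N w : matrix_of N w = band_matrix kappa D (xi ^~ w) N.
Proof. by []. Qed.

Lemma entry_mono1 N w m a b :
  (matrix_of N w ^+ m) a b = mono_eval (matrix_of N w) [:: (m, (a, b))].
Proof. by rewrite mono_eval_cons mono_eval_nil mulr1. Qed.

Lemma entry_moments N m a b :
  has_moments P (fun w => (matrix_of N w ^+ m) a b).
Proof.
by under eq_fun do rewrite entry_mono1; exact: erased_matrix_moments.
Qed.

Lemma matrix_ofX_sym N w m a b :
  (matrix_of N w ^+ m) a b = (matrix_of N w ^+ m) b a.
Proof. by rewrite matrix_ofE band_matrixX_sym. Qed.

Lemma mono_sq_bound m : exists2 K : R, 0 <= K & forall N (v : entry_mono #|` N|),
  (mono_deg v <= m)%N -> Ex P (fun w => mono_eval (matrix_of N w) v ^+ 2) <= K.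
Proof.
have [K K0 HK] := moment_bound (m + m).
exists K => // N v vm; under eq_fun do rewrite expr2 -mono_eval_cat.
apply: (le_trans (ler_norm _)); apply: HK.
by rewrite mono_deg_cat leq_add.
Qed.

Lemma sum_entry_sq N w m a :
  \sum_b (matrix_of N w ^+ m) b a ^+ 2 = (matrix_of N w ^+ (m + m)) a a.
Proof.
rewrite exprD -[_ * _]/(_ *m _) mxE; apply: eq_bigr => b _.
by rewrite [in RHS]matrix_ofX_sym expr2.
Qed.

(** The reason is that [\sum_b (X ^+ m) b a ^+ 2 = (X ^+ (m + m)) a a] has bounded
    moments; no factor [#|N|] is lost in the sum. *)
Lemma column_sum_bound m : exists2 K : R, 0 <= K &
  forall N (a : 'I_#|` N|) i j W, (i <= m)%N -> (j <= m)%N -> has_moments P W ->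
  \sum_b `|Ex P (fun w =>
     (matrix_of N w ^+ i) b a * (matrix_of N w ^+ j) b a * W w)| <=
  K + Ex P (fun w => W w ^+ 2).
Proof.
have [K K0 HK] := mono_sq_bound (m + m).
exists (4 * K); first by rewrite mulr_ge0.
move=> N a i j W im jm hW.
pose A b w := (matrix_of N w ^+ i) b a; pose B b w := (matrix_of N w ^+ j) b a.
pose Zi w := (matrix_of N w ^+ (i + i)) a a.
pose Zj w := (matrix_of N w ^+ (j + j)) a a.
have hA b : has_moments P (A b) by exact: entry_moments.
have hB b : has_moments P (B b) by exact: entry_moments.
have hZi : has_moments P Zi by exact: entry_moments.
have hZj : has_moments P Zj by exact: entry_moments.
have hAB b : has_moments P (fun w => (A b w ^+ 2 + B b w ^+ 2) * `|W w|).
  by apply: has_momentsM; [apply: has_momentsD; exact: has_momentsX|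
    exact: has_moments_norm].
have hABW b : has_moments P (fun w => A b w * B b w * W w).
  by apply: has_momentsM => //; exact: has_momentsM.
apply: (@le_trans _ _ (\sum_b Ex P (fun w => (A b w ^+ 2 + B b w ^+ 2) * `|W w|))).
  apply: ler_sum => b _; apply: (le_trans (ler_norm_Ex (hABW b))).
  apply: le_Ex => //; first exact: has_moments_norm.
  move=> w; rewrite normrM ler_wpM2r// normrM.
  rewrite -(real_normK (num_real (A b w))) -(real_normK (num_real (B b w))).
  have : 0 <= (`|A b w| - `|B b w|) ^+ 2 by exact: sqr_ge0.
  have : 0 <= `|A b w| * `|B b w| by exact: mulr_ge0.
  rewrite sqrrB => h1 h2; lra.
rewrite -Ex_sum//.
have -> : (fun w => \sum_b (A b w ^+ 2 + B b w ^+ 2) * `|W w|) =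
    (fun w => (Zi w + Zj w) * `|W w|).
  by apply/funext => w; rewrite -mulr_suml big_split/= !sum_entry_sq.
have hi : Ex P (fun w => Zi w ^+ 2) <= K.
  under eq_fun do rewrite /Zi entry_mono1; apply: HK.
  by rewrite mono_deg_cons/= /mono_deg big_nil addn0 leq_add.
have hj : Ex P (fun w => Zj w ^+ 2) <= K.
  under eq_fun do rewrite /Zj entry_mono1; apply: HK.
  by rewrite mono_deg_cons/= /mono_deg big_nil addn0 leq_add.
have hr : has_moments P (fun w => 2 * Zi w ^+ 2 + (2 * Zj w ^+ 2 + W w ^+ 2)).
  by apply: has_momentsD; [apply: has_momentsZ; exact: has_momentsX|];
    apply: has_momentsD; [apply: has_momentsZ|]; exact: has_momentsX.
apply: (@le_trans _ _ (Ex P (fun w => 2 * Zi w ^+ 2 + (2 * Zj w ^+ 2 + W w ^+ 2)))).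
  apply: le_Ex => //.
    by apply: has_momentsM; [exact: has_momentsD|exact: has_moments_norm].
  move=> w; rewrite -(real_normK (num_real (W w))).
  have := sqr_ge0 (Zi w + Zj w - `|W w|); have := sqr_ge0 (Zi w - Zj w).
  have := sqr_ge0 (Zi w + Zj w); have := sqr_ge0 `|W w|.
  nra.
rewrite ExD ?ExD ?ExZ; try by [exact: has_momentsX|apply: has_momentsZ; exact: has_momentsX|
  apply: has_momentsD; [apply: has_momentsZ|]; exact: has_momentsX].
lra.
Qed.

Variable s2 : C * C -> R.
Hypothesis xi_var : forall a b, a <> b ->
  Ex P (fun w => xi (mk_upair a b) w ^+ 2) = s2 (kappa a, kappa b).
Variable bs : R.
Hypothesis s2_bound : forall cc, `|s2 cc| <= bs.

Definition mean N (f : 'I_#|` N| -> R) : R := #|` N|%:R^-1 * \sum_b f b.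

Lemma mean_bound N (f : 'I_#|` N| -> R) B : (forall b, `|f b| <= B) -> 0 <= B ->
  `|mean f| <= B.
Proof.
move=> fB B0; rewrite /mean normrM ger0_norm ?invr_ge0//.
apply: (le_trans (ler_wpM2l _ (ler_norm_sum _ _ _))); first by rewrite invr_ge0.
apply: (le_trans (ler_wpM2l _ (ler_sum _ (fun b _ => fB b)))); first by rewrite invr_ge0.
rewrite sumr_const card_ord -[X in _ * X <= _]mulr_natl.
case: (posnP #|` N|) => [->|N0]; first by rewrite mul0r mulr0.
by rewrite mulrA mulVf ?mul1r// pnatr_eq0 -lt0n.
Qed.

(* The recursion for the coefficients of [Phi], relative to the uniform
   measure on [N]. *)
Definition phi_rec N (phi : nat -> 'I_#|` N| -> R) :=
  (forall a, phi 0%N a = 0) /\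
  forall m a, phi m.+1 a = (m == 0)%:R + D (kappa (letter a)) * phi m a +
    \sum_(i < m.+1) phi i a *
      mean (fun b => s2 (kappa (letter a), kappa (letter b)) * phi (m - i)%N b).

Lemma phi_rec1 N (phi : nat -> 'I_#|` N| -> R) a : phi_rec phi -> phi 1%N a = 1.
Proof. by move=> [h0 ->]; rewrite big_ord1 h0 mul0r mulr0 !addr0. Qed.

Lemma phi_bound m : exists2 B : R, 0 <= B & forall N (phi : nat -> 'I_#|` N| -> R) j a,
  phi_rec phi -> (j <= m)%N -> `|phi j a| <= B.
Proof.
elim: m => [|m [B B0 HB]].
  by exists 0 => // N phi j a [h0 _]; rewrite leqn0 => /eqP ->; rewrite h0 normr0.
exists (B + (1 + bD * B + m.+1%:R * (B * (`|bs| * B)))).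
  by rewrite !addr_ge0// ?mulr_ge0// ?mulr_ge0.
move=> N phi j a rphi; rewrite leq_eqVlt => /orP[/eqP ->|jm]; last first.
  rewrite (le_trans (HB _ _ _ _ rphi jm))// lerDl.
  by rewrite !addr_ge0// ?mulr_ge0// ?mulr_ge0.
apply: (le_trans _ (_ : 1 + bD * B + m.+1%:R * (B * (`|bs| * B)) <= _)); last first.
  by rewrite lerDr.
have [_ ->] := rphi; apply: (le_trans (ler_normD _ _)); apply: lerD.
  apply: (le_trans (ler_normD _ _)); apply: lerD.
    by case: (m == 0); rewrite ?normr1 ?normr0.
  by rewrite normrM ler_pM// HB.
rewrite -[X in _ <= X%:R * _](size_enum_ord m.+1) -big_enum.
apply: ler_norm_sum_size; first by rewrite !mulr_ge0.
move=> i _ _; rewrite normrM ler_pM//.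
  by apply: HB => //; rewrite -ltnS.
apply: mean_bound; last by rewrite mulr_ge0.
move=> b; rewrite normrM ler_pM//.
  by rewrite (le_trans (s2_bound _))// ler_norm.
by apply: HB => //; rewrite leq_subr.
Qed.

Definition deviation N (phi : nat -> 'I_#|` N| -> R) m a w : R :=
  (matrix_of N w ^+ m) a a - phi m.+1 a.

Lemma deviation_moments N (phi : nat -> 'I_#|` N| -> R) m a :
  has_moments P (deviation phi m a).
Proof. by apply: has_momentsB; [exact: entry_moments|exact: has_moments_cst]. Qed.

(** The second factor of an application of [Ex_AMGM] whose first factor is a
    deviation. *)
Lemma mono_deviation_bound m : exists2 K : R, 0 <= K &
  forall N (phi : nat -> 'I_#|` N| -> R) k v a, phi_rec phi -> (k <= m)%N ->
  (mono_deg v <= m)%N ->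
  Ex P (fun w => (mono_eval (matrix_of N w) v * deviation phi k a w) ^+ 2) <= K.
Proof.
have [K K0 HK] := mono_sq_bound (m + m).
have [B B0 HB] := phi_bound m.+1.
exists (2 * K + 2 * B ^+ 2 * K).
  by rewrite addr_ge0 ?mulr_ge0 ?exprn_ge0.
move=> N phi k v a rphi km vm.
pose v' : entry_mono #|` N| := (k, (a, a)) :: v.
have hv : has_moments P (fun w => mono_eval (matrix_of N w) v).
  exact: erased_matrix_moments.
have hv' : has_moments P (fun w => mono_eval (matrix_of N w) v').
  exact: erased_matrix_moments.
apply: (@le_trans _ _ (Ex P (fun w => 2 * mono_eval (matrix_of N w) v' ^+ 2 +
   2 * B ^+ 2 * mono_eval (matrix_of N w) v ^+ 2))).
  apply: le_Ex.
  - by apply/has_momentsX/has_momentsM => //; exact: deviation_moments.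
  - by apply: has_momentsD; apply: has_momentsZ; exact: has_momentsX.
  - move=> w; rewrite mono_eval_cons/= /deviation.
    set z := (matrix_of N w ^+ k) a a; set x := mono_eval (matrix_of N w) v; set f := phi k.+1 a.
    have hf : f ^+ 2 <= B ^+ 2.
      by rewrite -real_normK ?num_real// lerXn2r ?nnegrE// HB.
    have h1 : f ^+ 2 * x ^+ 2 <= B ^+ 2 * x ^+ 2 by rewrite ler_wpM2r// sqr_ge0.
    have := sqr_ge0 (z * x + f * x).
    nra.
rewrite ExD ?ExZ; try by [exact: has_momentsX | apply: has_momentsZ; exact: has_momentsX].
apply: lerD; apply: ler_wpM2l; rewrite ?mulr_ge0 ?exprn_ge0//; apply: HK.
  by rewrite mono_deg_cons/= leq_add.
by rewrite (leq_trans vm)// leq_addr.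
Qed.

(** Two diagonal entries may be replaced by their limits one after the other,
    each time at the cost of a deviation multiplied by bounded factors. *)
Lemma Ex_two_loops m : exists2 K : R, 0 <= K &
  forall N (phi : nat -> 'I_#|` N| -> R) (delta eta : R), phi_rec phi -> 0 < eta ->
  (forall j a, (j <= m)%N -> Ex P (fun w => deviation phi j a w ^+ 2) <= delta) ->
  forall j k a b, (j <= m)%N -> (k <= m)%N ->
  `|Ex P (fun w => (matrix_of N w ^+ j) b b * (matrix_of N w ^+ k) a a *
        deviation phi m.+1 a w) -
    phi j.+1 b * phi k.+1 a * Ex P (deviation phi m.+1 a)| <=
  K * (eta^-1 * delta + eta).
Proof.
have [K K0 HK] := mono_deviation_bound m.+1.
have [B B0 HB] := phi_bound m.+1.
exists ((1 + K) * (1 + B)).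
  by rewrite mulr_ge0// addr_ge0.
move=> N phi delta eta rphi eta0 Hdev j k a b jm km.
set G := deviation phi m.+1 a.
pose Zj w := (matrix_of N w ^+ j) b b; pose Zk w := (matrix_of N w ^+ k) a a.
pose f := phi j.+1 b; pose g := phi k.+1 a.
have hG : has_moments P G by exact: deviation_moments.
have hdj : has_moments P (deviation phi j b) by exact: deviation_moments.
have hdk : has_moments P (deviation phi k a) by exact: deviation_moments.
have hZk : has_moments P Zk by exact: entry_moments.
have d0 : 0 <= delta.
  by apply: le_trans (Hdev _ b jm); apply: Ex_ge0 => w; exact: sqr_ge0.
have r0 : 0 <= eta^-1 * delta + eta.
  by rewrite addr_ge0 ?mulr_ge0// ?invr_ge0 ltW.
have bnd (A W : Omega -> R) : has_moments P A -> has_moments P W ->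
    Ex P (fun w => A w ^+ 2) <= delta -> Ex P (fun w => W w ^+ 2) <= K ->
    `|Ex P (fun w => A w * W w)| <= (1 + K) * (eta^-1 * delta + eta).
  move=> hA hW A2 W2; apply: (le_trans (Ex_AMGM eta0 hA hW)).
  rewrite mulrDr lerD//.
    have e1 : 0 <= eta^-1 by rewrite invr_ge0 ltW.
    apply: (le_trans (ler_wpM2l e1 A2)).
    by rewrite ler_peMl ?mulr_ge0// lerDl.
  apply: (le_trans (ler_wpM2l (ltW eta0) W2)).
  by rewrite mulrC (ler_wpM2r (ltW eta0))// lerDr.
have E1 := bnd _ _ hdj (has_momentsM hZk hG) (Hdev _ _ jm).
have E2 := bnd _ _ hdk hG (Hdev _ _ km).
have -> : Ex P (fun w => Zj w * Zk w * G w) - f * g * Ex P G =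
   Ex P (fun w => deviation phi j b w * (Zk w * G w)) +
   f * Ex P (fun w => deviation phi k a w * G w).
  rewrite -!ExZ//; last exact: has_momentsM.
  rewrite -ExB; try by [exact: has_momentsZ|
    apply: has_momentsM => //; apply: has_momentsM => //; exact: entry_moments].
  rewrite -ExD; try by [apply: has_momentsZ; exact: has_momentsM|
    apply: has_momentsM => //; exact: has_momentsM].
  congr (Ex P); apply/funext => w; rewrite /deviation -/(Zj w) -/(Zk w) -/f -/g; ring.
apply: (le_trans (ler_normD _ _)).
set r := eta^-1 * delta + eta in bnd E1 E2 *.
have -> : (1 + K) * (1 + B) * r = (1 + K) * r + B * ((1 + K) * r) by ring.
rewrite lerD//.
  apply: E1; have := HK N phi m.+1 [:: (k, (a, a))] a rphi (leqnn _).
  rewrite mono_deg_cons /mono_deg big_nil addn0/= => /(_ (leqW km)).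
  by under eq_fun do rewrite -entry_mono1.
rewrite normrM ler_pM//; first by rewrite HB.
apply: E2; have := HK N phi m.+1 [::] a rphi (leqnn _).
rewrite /mono_deg big_nil => /(_ isT).
by under eq_fun do rewrite mono_eval_nil mul1r.
Qed.

(** The derivative along the pair [{a, b}] of
    [(X ^+ m) b a * deviation phi m.+1 a].  [tree_part] collects the terms in
    which the closed walk returns to [a] through the same pair, and splits into a
    closed walk at [b] and one at [a]; [loop_part] collects those that retain two
    entries between [a] and [b]. *)
Definition tree_part N (phi : nat -> 'I_#|` N| -> R) m a b w : R :=
  \sum_(j < m) (matrix_of N w ^+ j) b b * (matrix_of N w ^+ (m - j.+1)) a a *
    deviation phi m.+1 a w.

Definition loop_part N (phi : nat -> 'I_#|` N| -> R) m a b w : R :=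
  \sum_(j < m) (matrix_of N w ^+ j) b a * (matrix_of N w ^+ (m - j.+1)) b a *
    deviation phi m.+1 a w +
  \sum_(j < m.+1)
    ((matrix_of N w ^+ m) b a * (matrix_of N w ^+ (m - j)) b a *
       (matrix_of N w ^+ j) a a +
     (matrix_of N w ^+ m) b a * (matrix_of N w ^+ j) b a *
       (matrix_of N w ^+ (m - j)) a a).

Lemma tree_part_moments N (phi : nat -> 'I_#|` N| -> R) m a b :
  has_moments P (tree_part phi m a b).
Proof.
apply: has_moments_sum => j; apply: has_momentsM; last exact: deviation_moments.
by apply: has_momentsM; exact: entry_moments.
Qed.

Lemma loop_part_moments N (phi : nat -> 'I_#|` N| -> R) m a b :
  has_moments P (loop_part phi m a b).
Proof.
apply: has_momentsD; apply: has_moments_sum => j.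
  apply: has_momentsM; last exact: deviation_moments.
  by apply: has_momentsM; exact: entry_moments.
by apply: has_momentsD; apply: has_momentsM; try exact: entry_moments;
  apply: has_momentsM; exact: entry_moments.
Qed.

(** [Ex_xi_mono] for the two monomials that make up
    [(X ^+ m) b a * deviation phi m.+1 a]. *)
Lemma Ex_xi_deviation m : exists2 K : R, 0 <= K &
  forall N (phi : nat -> 'I_#|` N| -> R) a b, phi_rec phi -> a != b ->
  `|Ex P (fun w => xi (edge a b) w *
       ((matrix_of N w ^+ m) b a * deviation phi m.+1 a w)) -
    scaling N * (s2 (kappa (letter a), kappa (letter b)) *
      (Ex P (tree_part phi m a b) + Ex P (loop_part phi m a b)))| <=
  K * scaling N ^+ 2.
Proof.
have [K K0 HK] := Ex_xi_mono (m + m.+1).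
have [B B0 HB] := phi_bound m.+2.
exists (K * (1 + B)); first by rewrite mulr_ge0// addr_ge0.
move=> N phi a b rphi ab.
pose f := phi m.+2 a.
pose v2 : entry_mono #|` N| := [:: (m, (b, a))].
pose v1 : entry_mono #|` N| := [:: (m, (b, a)); (m.+1, (a, a))].
pose H v := Ex P (fun w => mono_deriv (edge_units a b) (matrix_of N w) v).
pose T v := Ex P (fun w => xi (edge a b) w * mono_eval (matrix_of N w) v).
have hT v : has_moments P (fun w => xi (edge a b) w * mono_eval (matrix_of N w) v).
  by apply: has_momentsM => //; exact: erased_matrix_moments.
have hH v : has_moments P (fun w => mono_deriv (edge_units a b) (matrix_of N w) v).
  by apply: has_moments_sum => y; exact: erased_matrix_moments.
have -> : Ex P (fun w => xi (edge a b) w *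
    ((matrix_of N w ^+ m) b a * deviation phi m.+1 a w)) = T v1 - f * T v2.
  rewrite -ExZ// -ExB//; last exact: has_momentsZ.
  congr (Ex P); apply/funext => w.
  rewrite /v1 /v2 !mono_eval_cons mono_eval_nil/= /deviation -/f; ring.
rewrite -ExD; [|exact: tree_part_moments|exact: loop_part_moments].
have -> : Ex P (fun w => tree_part phi m a b w + loop_part phi m a b w) =
    H v1 - f * H v2.
  rewrite -ExZ// -ExB//; last exact: has_momentsZ.
  congr (Ex P); apply/funext => w.
  rewrite /v1 /v2 !mono_deriv_cons !mono_deriv_nil !mono_eval_cons !mono_eval_nil/=.
  rewrite /entry_deriv /edge_units (negbTE ab).
  under [X in _ = X * _ + _ - _]eq_bigr do rewrite big_cons big_seq1/=.
  under [X in _ = _ + _ * (X * _ + _) - _]eq_bigr do rewrite big_cons big_seq1/= subSS.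
  under [X in _ = _ - _ * (X * _ + _)]eq_bigr do rewrite big_cons big_seq1/=.
  rewrite /tree_part /loop_part -!mulr_suml !big_split/= /deviation -/f.
  rewrite mulr1 !mulr0 !addr0 mulr1.
  rewrite (_ : \sum_(j < m.+1) _ * _ * (matrix_of N w ^+ j) a a =
     (matrix_of N w ^+ m) b a * \sum_(j < m.+1)
       (matrix_of N w ^+ j) a a * (matrix_of N w ^+ (m - j)) b a); last first.
    by rewrite mulr_sumr; apply: eq_bigr => j _; ring.
  rewrite (_ : \sum_(j < m.+1) _ * _ * (matrix_of N w ^+ (m - j)) a a =
     (matrix_of N w ^+ m) b a * \sum_(j < m.+1)
       (matrix_of N w ^+ j) a b * (matrix_of N w ^+ (m - j)) a a); last first.
    rewrite mulr_sumr; apply: eq_bigr => j _.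
    by rewrite [(matrix_of N w ^+ j) a b]matrix_ofX_sym; ring.
  ring.
have -> : s2 (kappa (letter a), kappa (letter b)) =
    Ex P (fun w => xi (edge a b) w ^+ 2).
  by rewrite xi_var// => /letter_inj/eqP; rewrite (negbTE ab).
set V := Ex P (fun w => _ ^+ 2).
have h1 : `|T v1 - scaling N * (V * H v1)| <= K * scaling N ^+ 2.
  by apply: HK; rewrite /v1 !mono_deg_cons /mono_deg big_nil addn0.
have h2 : `|T v2 - scaling N * (V * H v2)| <= K * scaling N ^+ 2.
  by apply: HK; rewrite /v2 !mono_deg_cons /mono_deg big_nil addn0 leq_addr.
have -> : T v1 - f * T v2 - scaling N * (V * (H v1 - f * H v2)) =
  (T v1 - scaling N * (V * H v1)) - f * (T v2 - scaling N * (V * H v2)) by ring.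
have -> : K * (1 + B) * scaling N ^+ 2 =
  K * scaling N ^+ 2 + B * (K * scaling N ^+ 2) by ring.
rewrite (le_trans (ler_normB _ _))// lerD// normrM ler_pM//.
exact: HB.
Qed.

(** A consequence of [column_sum_bound].  As these terms enter
    [deviation_step] with the weight [scaling N ^+ 2], they are negligible. *)
Lemma loop_part_bound m : exists2 K : R, 0 <= K &
  forall N (phi : nat -> 'I_#|` N| -> R) a, phi_rec phi ->
  \sum_b `|Ex P (loop_part phi m a b)| <= K.
Proof.
have [K K0 HK] := column_sum_bound m.
have [K1 K10 HK1] := mono_sq_bound m.
have [K2 K20 HK2] := mono_deviation_bound m.+1.
exists (m%:R * (K + K2) + m.+1%:R * ((K + K1) + (K + K1))).
  by rewrite addr_ge0// mulr_ge0// !addr_ge0.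
move=> N phi a rphi.
pose e k b w := (matrix_of N w ^+ k) b a.
have he k b : has_moments P (e k b) by exact: entry_moments.
have hG := deviation_moments phi m.+1 a.
pose F1 b (j : 'I_m) w := e j b w * e (m - j.+1)%N b w * deviation phi m.+1 a w.
pose F2 b (j : 'I_m.+1) w := e m b w * e (m - j)%N b w * e j a w.
pose F3 b (j : 'I_m.+1) w := e m b w * e j b w * e (m - j)%N a w.
have h3 i j F b : has_moments P F -> has_moments P (fun w => e i b w * e j b w * F w).
  by move=> hF; apply: has_momentsM => //; exact: has_momentsM.
have h1F b j : has_moments P (F1 b j) by exact: h3.
have h2F b j : has_moments P (F2 b j) by exact: h3.
have h3F b j : has_moments P (F3 b j) by exact: h3.
have Z2 j : (j <= m)%N -> Ex P (fun w => e j a w ^+ 2) <= K1.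
  move=> jm; rewrite /e; under eq_fun do rewrite entry_mono1; apply: HK1.
  by rewrite mono_deg_cons /mono_deg big_nil addn0.
have G2 : Ex P (fun w => deviation phi m.+1 a w ^+ 2) <= K2.
  have := HK2 N phi m.+1 [::] a rphi (leqnn _).
  by rewrite /mono_deg big_nil => /(_ isT); under eq_fun do rewrite mono_eval_nil mul1r.
apply: (@le_trans _ _ (\sum_b (\sum_j `|Ex P (F1 b j)| +
    \sum_j (`|Ex P (F2 b j)| + `|Ex P (F3 b j)|)))).
  apply: ler_sum => b _.
  have h23F j : has_moments P (fun w => F2 b j w + F3 b j w).
    by apply: has_momentsD; [exact: h2F|exact: h3F].
  have hs1 : has_moments P (fun w => \sum_j F1 b j w) by exact: has_moments_sum.
  have hs2 : has_moments P (fun w => \sum_j (F2 b j w + F3 b j w)).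
    exact: has_moments_sum.
  rewrite /loop_part (ExD hs1 hs2) !Ex_sum//.
  apply: (le_trans (ler_normD _ _)); apply: lerD.
    exact: ler_norm_sum.
  apply: (le_trans (ler_norm_sum _ _ _)); apply: ler_sum => j _.
  by rewrite ExD; [exact: ler_normD|exact: h2F|exact: h3F].
rewrite big_split/= exchange_big/= [X in _ + X]exchange_big/=; apply: lerD.
  apply: (@le_trans _ _ (\sum_(j < m) (K + K2))); last first.
    by rewrite sumr_const card_ord mulr_natl.
  apply: ler_sum => j _; apply: (le_trans (HK _ _ _ _ _ _ _ hG)).
  - by rewrite ltnW.
  - by rewrite leq_subr.
  - by rewrite lerD2l.
apply: (@le_trans _ _ (\sum_(j < m.+1) ((K + K1) + (K + K1)))); last first.
  by rewrite sumr_const card_ord mulr_natl.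
apply: ler_sum => j _; rewrite big_split/=; have jm : (j <= m)%N by rewrite -ltnS.
apply: lerD; apply: (le_trans (HK _ _ _ _ _ _ _ _)) => //; rewrite ?leq_subr//.
  by rewrite lerD2l Z2.
by rewrite lerD2l Z2// leq_subr.
Qed.

(** The heart of the argument.  Write [G] for the deviation of order [m.+1] at
    [a].  Expanding the first step of [(X ^+ m.+1) a a] in [Ex (G ^+ 2)] and
    integrating by parts gives, up to [scaling N], the mean over [b] of
    [s2 (a, b)] times the expectations of [(X ^+ j) b b * (X ^+ k) a a * G] with
    [j + k = m - 1], plus [D a] times that of [(X ^+ m) a a * G].  By the bounds
    on deviations of smaller order the entries may be replaced by their limits,
    and the recursion satisfied by [phi] says that the result is
    [phi m.+2 a * Ex G], which is the term subtracted in [Ex (G ^+ 2)]. *)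
Lemma deviation_step m : exists2 K : R, 0 <= K &
  forall N (phi : nat -> 'I_#|` N| -> R) (delta eta : R) a, phi_rec phi -> 0 < eta ->
  (forall j a, (j <= m)%N -> Ex P (fun w => deviation phi j a w ^+ 2) <= delta) ->
  Ex P (fun w => deviation phi m.+1 a w ^+ 2) <=
  K * (eta^-1 * delta + eta + scaling N).
Proof.
have [B B0 HB] := phi_bound m.+2.
have [K1 K10 HK1] := Ex_xi_deviation m.
have [K2 K20 HK2] := Ex_two_loops m.
have [K3 K30 HK3] := loop_part_bound m.
have [K4 K40 HK4] := mono_deviation_bound m.+1.
pose Kq := m%:R * (B * B * (1 + K4)).
pose Ka := cs 2 + K4 + `|bs| * Kq.
pose K := bD * K2 + (Ka + (K1 + `|bs| * K3 + `|bs| * (m%:R * K2))).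
have Kq0 : 0 <= Kq by rewrite !mulr_ge0// addr_ge0.
have Ka0 : 0 <= Ka by rewrite !addr_ge0// mulr_ge0.
exists K; first by rewrite /K !addr_ge0 ?mulr_ge0// addr_ge0.
move=> N phi delta eta a rphi eta0 Hdev.
set t := scaling N; have t0 : 0 <= t by exact: scaling_ge0.
have t1 : t <= 1 by exact: scaling_le1.
set r := eta^-1 * delta + eta.
have d0 : 0 <= delta.
  by apply: le_trans (Hdev _ a (leq0n m)); apply: Ex_ge0 => w; exact: sqr_ge0.
have r0 : 0 <= r by rewrite addr_ge0 ?mulr_ge0// ?invr_ge0 ltW.
have n0 : (0 < #|` N|)%N by exact: leq_ltn_trans (ltn_ord a).
have tn : t ^+ 2 * #|` N|%:R = 1.
  by rewrite scaling_sq mulVf// pnatr_eq0 -lt0n.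
set G := deviation phi m.+1 a.
have hG : has_moments P G by exact: deviation_moments.
pose f := phi m.+2 a.
pose e k b c w := (matrix_of N w ^+ k) b c.
have he k b b' : has_moments P (e k b b') by exact: entry_moments.
pose Tm b := Ex P (fun w => xi (edge a b) w * (e m b a w * G w)).
have hT b : has_moments P (fun w => xi (edge a b) w * (e m b a w * G w)).
  by apply: has_momentsM => //; exact: has_momentsM.
pose Da := D (kappa (letter a)).
pose sg (b : 'I_#|` N|) := s2 (kappa (letter a), kappa (letter b)).
have sgb b : `|sg b| <= `|bs| by rewrite (le_trans (s2_bound _))// ler_norm.
pose A b := Ex P (tree_part phi m a b).
pose Rr b := Ex P (loop_part phi m a b).
pose Q b := \sum_(j < m) phi j.+1 b * phi (m - j)%N a * Ex P G.
pose e0 := Da * (Ex P (fun w => e m a a w * G w) - phi m.+1 a * Ex P G).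
pose u b := t * Tm b - t ^+ 2 * (sg b * Q b).
(* [e0] is the contribution of the diagonal matrix [D]; [u b] compares that of
   the pair [{a, b}] to its limit. *)
have EGG : Ex P (fun w => G w ^+ 2) = e0 + \sum_b u b.
  have -> : (fun w => G w ^+ 2) = (fun w =>
     Da * (e m a a w * G w) + t * \sum_b xi (edge a b) w * (e m b a w * G w) -
     f * G w).
    apply/funext => w; rewrite expr2 {1}/G /deviation -/f mulrBl; congr (_ - _).
    rewrite entry_exprS matrix_ofE mulr_suml mulr_sumr.
    under eq_bigr do rewrite band_matrixE 2!mulrDl.
    rewrite big_split/=; congr (_ + _).
      rewrite (bigD1 a)//= eqxx mulr1n big1 ?addr0 -?mulrA//.
      by move=> j ja; rewrite eq_sym (negbTE ja) mulr0n !mul0r.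
    by apply: eq_bigr => b _; rewrite -!mulrA.
  have hs : has_moments P (fun w => \sum_b xi (edge a b) w * (e m b a w * G w)).
    exact: has_moments_sum.
  have hm : has_moments P (fun w => e m a a w * G w) by exact: has_momentsM.
  rewrite ExB; [|by apply: has_momentsD; exact: has_momentsZ|exact: has_momentsZ].
  rewrite ExD ?ExZ ?Ex_sum//; try exact: has_momentsZ.
  have -> : f = Da * phi m.+1 a + \sum_(j < m) phi (m - j)%N a *
      mean (fun b => sg b * phi j.+1 b).
    have [h0 h] := rphi; rewrite /f h/= add0r; congr (_ + _).
    (* The extreme terms vanish because [phi 0] does. *)
    rewrite big_ord_recl h0 mul0r add0r big_ord_recr/= subnn.
    rewrite [X in _ + _ * X](_ : _ = 0) ?mulr0 ?addr0; last first.
      by rewrite /mean big1 ?mulr0// => b _; rewrite h0 mulr0.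
    rewrite (reindex_inj rev_ord_inj)/=; apply: eq_bigr => j _.
    by rewrite /bump/= add1n subSS -subSn// subKn// subSS.
  rewrite /u sumrB /e0 -mulr_sumr -/t.
  have -> : \sum_b t ^+ 2 * (sg b * Q b) =
     (\sum_(j < m) phi (m - j)%N a * mean (fun b => sg b * phi j.+1 b)) * Ex P G.
    rewrite mulr_suml; under eq_bigr do rewrite /Q !mulr_sumr.
    rewrite exchange_big/=; apply: eq_bigr => j _.
    rewrite /mean -scaling_sq -/t mulr_sumr mulr_sumr mulr_suml.
    by apply: eq_bigr => b _; ring.
  rewrite /Tm; ring.
have EG1 : `|Ex P G| <= 1 + K4.
  have := Ex_AMGM ltr01 hG (has_moments_cst P 1).
  rewrite (_ : (fun w => G w * cst 1 w) = G); last first.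
    by apply/funext => w; rewrite mulr1.
  rewrite (_ : (fun w : Omega => cst 1 w ^+ 2) = cst 1); last first.
    by apply/funext => w; rewrite expr1n.
  rewrite Ex_cst invr1 !mul1r addrC => /le_trans; apply; rewrite lerD2l.
  have := HK4 N phi m.+1 [::] a rphi (leqnn _).
  by rewrite /mono_deg big_nil => /(_ isT); under eq_fun do rewrite mono_eval_nil mul1r.
have Qb b : `|Q b| <= Kq.
  rewrite /Kq -[X in _ <= X%:R * _](size_enum_ord m) /Q -big_enum.
  apply: ler_norm_sum_size; first by rewrite !mulr_ge0// addr_ge0.
  move=> j _ _; rewrite !normrM ler_pM// ler_pM//; apply: HB => //.
    by rewrite ltnS ltnW// ltnS ltnW.
  by rewrite (leq_trans (leq_subr _ _))// ltnW// ltnW.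
have e0b : `|e0| <= bD * K2 * r.
  rewrite /e0 normrM -mulrA ler_pM//; first exact: D_bound.
  have := HK2 N phi delta eta rphi eta0 Hdev 0%N m a a (leq0n _) (leqnn _).
  rewrite (phi_rec1 _ rphi) mul1r.
  by under eq_fun do rewrite expr0 mxE eqxx mul1r.

(* The pair [{a, a}] is exceptional but there is only one such pair. *)
have ua : `|u a| <= Ka * t.
  have Ta : `|Tm a| <= cs 2 + K4.
    have hx : has_moments P (fun w => e m a a w * G w) by exact: has_momentsM.
    have := Ex_AMGM ltr01 (xi_moments (edge a a)) hx.
    rewrite invr1 !mul1r => /le_trans; apply; apply: lerD.
      by rewrite (le_trans (ler_norm _))// Ex_pow_bound.
    have := HK4 N phi m.+1 [:: (m, (a, a))] a rphi (leqnn _).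
    rewrite mono_deg_cons /mono_deg big_nil addn0 => /(_ (leqnSn _)).
    by under eq_fun do rewrite -entry_mono1.
  rewrite /u (le_trans (ler_normB _ _))// /Ka mulrDl lerD//.
    by rewrite normrM ger0_norm// mulrC ler_wpM2r.
  rewrite normrM (ger0_norm (exprn_ge0 2 t0)) mulrC ler_pM ?exprn_ge0//.
    by rewrite normrM ler_pM.
  by rewrite expr2 ler_piMl.
have AQ b : `|A b - Q b| <= m%:R * (K2 * r).
  rewrite /A /tree_part Ex_sum => [|j]; last first.
    by apply: has_momentsM => //; apply: has_momentsM; exact: entry_moments.
  rewrite /Q -sumrB -[X in _ <= X%:R * _](size_enum_ord m) -big_enum.
  apply: ler_norm_sum_size; first by rewrite mulr_ge0.
  move=> j _ _; rewrite [(m - j)%N](_ : _ = (m - j.+1).+1); last by rewrite subnSK.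
  by apply: HK2 => //; rewrite ?leq_subr// ltnW.
have ub b : b != a -> `|u b| <= K1 * t ^+ 3 + t ^+ 2 * (`|bs| * `|Rr b|) +
    t ^+ 2 * (`|bs| * (m%:R * (K2 * r))).
  move=> ba; rewrite /u.
  have -> : t * Tm b - t ^+ 2 * (sg b * Q b) =
    t * (Tm b - t * (sg b * (A b + Rr b))) + t ^+ 2 * (sg b * Rr b) +
    t ^+ 2 * (sg b * (A b - Q b)) by ring.
  have t20 : 0 <= t ^+ 2 by rewrite exprn_ge0.
  rewrite (le_trans (ler_normD _ _))// lerD//; last first.
    by rewrite normrM (ger0_norm t20) ler_wpM2l// normrM ler_pM.
  rewrite (le_trans (ler_normD _ _))// lerD//; last first.
    by rewrite normrM (ger0_norm t20) ler_wpM2l// normrM ler_pM.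
  have -> : K1 * t ^+ 3 = t * (K1 * t ^+ 2) by ring.
  rewrite normrM (ger0_norm t0) ler_wpM2l//.
  by apply: HK1; rewrite // eq_sym.
have main : Ex P (fun w => G w ^+ 2) <= bD * K2 * r + (Ka * t +
    (K1 * t + `|bs| * K3 * t ^+ 2 + `|bs| * (m%:R * K2) * r)).
  rewrite EGG; apply: (le_trans (ler_norm _)); apply: (le_trans (ler_normD _ _)).
  apply: lerD => //; rewrite (bigD1 a)//=; apply: (le_trans (ler_normD _ _)).
  apply: lerD => //; apply: (le_trans (ler_norm_sum _ _ _)).
  apply: (le_trans (ler_sum _ ub)).
  apply: (@le_trans _ _ (\sum_b (K1 * t ^+ 3 + t ^+ 2 * (`|bs| * `|Rr b|) +
    t ^+ 2 * (`|bs| * (m%:R * (K2 * r)))))).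
    rewrite [leRHS](bigD1 a)//= lerDr.
    by rewrite !addr_ge0// !mulr_ge0// ?exprn_ge0.
  rewrite !big_split/= !sumr_const card_ord.
  rewrite -(mulr_natr (K1 * _)) -(mulr_natr (t ^+ 2 * _)).
  rewrite -!mulr_sumr lerD// ?lerD//.
  - rewrite (_ : K1 * t ^+ 3 * _ = K1 * t * (t ^+ 2 * #|` N|%:R)); last by ring.
    by rewrite tn mulr1.
  - rewrite (_ : `|bs| * K3 * t ^+ 2 = t ^+ 2 * (`|bs| * K3)); last by ring.
    by rewrite ler_wpM2l ?exprn_ge0// ler_wpM2l//; exact: HK3.
  - rewrite (_ : t ^+ 2 * _ * _ = `|bs| * (m%:R * K2) * r * (t ^+ 2 * #|` N|%:R)).
      by rewrite tn mulr1.
    by ring.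
apply: (le_trans main).
have tt : t ^+ 2 <= t by rewrite expr2 ler_piMl.
have x1 : `|bs| * K3 * t ^+ 2 <= `|bs| * K3 * t by rewrite ler_wpM2l// mulr_ge0.
have x2 : 0 <= bD * K2 * t by rewrite !mulr_ge0.
have x3 : 0 <= Ka * r by rewrite mulr_ge0.
have x4 : 0 <= K1 * r by rewrite mulr_ge0.
have x5 : 0 <= `|bs| * K3 * r by rewrite !mulr_ge0.
have x6 : 0 <= `|bs| * (m%:R * K2) * t by rewrite !mulr_ge0.
have -> : K * (r + t) = bD * K2 * r + bD * K2 * t + (Ka * r + Ka * t +
  (K1 * r + K1 * t + (`|bs| * K3 * r + `|bs| * K3 * t) +
   (`|bs| * (m%:R * K2) * r + `|bs| * (m%:R * K2) * t))) by rewrite /K; ring.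
lra.
Qed.

(** In [deviation_step] one chooses first [eta], then [delta], then [#|N|]. *)
Lemma deviation_small m (eps : R) : 0 < eps -> exists n0 : nat,
  forall N (phi : nat -> 'I_#|` N| -> R) a, phi_rec phi -> (n0 <= #|` N|)%N ->
  Ex P (fun w => deviation phi m a w ^+ 2) <= eps.
Proof.
elim/ltn_ind: m eps => -[_|m IH] eps eps0.
  exists 0%N => N phi a rphi _.
  under eq_fun do rewrite /deviation expr0 mxE eqxx (phi_rec1 _ rphi) subrr expr0n/=.
  by rewrite Ex_cst ltW.
have [K K0 HK] := deviation_step m.
pose eta := eps / (3 * (K + 1)).
have K1 : 0 < K + 1 by rewrite ltr_wpDl.
have eta0 : 0 < eta by rewrite divr_gt0// mulr_gt0.
pose delta := eta * eta.
have delta0 : 0 < delta by rewrite mulr_gt0.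
have [n0 Hn0] : exists n0 : nat, forall j N (phi : nat -> 'I_#|` N| -> R) a,
    (j < m.+1)%N -> phi_rec phi -> (n0 <= #|` N|)%N ->
    Ex P (fun w => deviation phi j a w ^+ 2) <= delta.
  have {}IH j : (j < m.+1)%N -> exists n0 : nat,
      forall N (phi : nat -> 'I_#|` N| -> R) a, phi_rec phi -> (n0 <= #|` N|)%N ->
      Ex P (fun w => deviation phi j a w ^+ 2) <= delta.
    by move=> jm; exact: IH.
  elim: m.+1 IH => [|m' IHm] IH.
    by exists 0%N.
  have [j jm|n1 Hn1] := IHm; first by apply: IH; rewrite ltnW.
  have [n2 Hn2] := IH m' (ltnSn _).
  exists (maxn n1 n2) => j N phi a; rewrite ltnS leq_eqVlt geq_max.
  by move=> /orP[/eqP ->|jm] rphi /andP[h1 h2]; [exact: Hn2|exact: Hn1].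
have [n1 Hn1] : exists n1 : nat, forall N, (n1 <= #|` N|)%N -> scaling N <= eta.
  exists (Num.truncn (eta ^- 2)).+1 => N nN.
  have h : eta ^- 2 <= #|` N|%:R.
    apply: ltW; apply: (lt_le_trans (truncnS_gt _)); by rewrite ler_nat.
  rewrite -[leRHS]invrK lef_pV2 ?posrE ?invr_gt0// ?sqrtr_gt0.
    rewrite -(@ler_pXn2r _ 2)// ?nnegrE ?sqrtr_ge0 ?invr_ge0 ?(ltW eta0)//.
    by rewrite sqr_sqrtr// exprVn.
  by rewrite ltr0n (leq_trans _ nN).
exists (maxn n0 n1) => N phi a rphi; rewrite geq_max => /andP[h1 h2].
apply: (le_trans (HK _ _ delta eta a rphi eta0 _)).
  by move=> j b jm; exact: Hn0.
rewrite /delta mulrA mulVf ?gt_eqF// mul1r.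
apply: (@le_trans _ _ (K * (3 * eta))).
  by rewrite ler_wpM2l//; have := Hn1 _ h2; lra.
have <- : (K + 1) * (3 * eta) = eps by rewrite /eta; field; rewrite gt_eqF.
by rewrite ler_wpM2r ?lerDl// mulr_ge0// ltW.
Qed.

Lemma mean_sq_le N (f : 'I_#|` N| -> R) : mean f ^+ 2 <= mean (fun a => f a ^+ 2).
Proof.
case: (posnP #|` N|) => [N0|N0].
  have i0 : #|` N|%:R^-1 = 0 :> R by rewrite N0 invr0.
  by rewrite /mean i0 !mul0r expr0n.
have n0 : #|` N|%:R != 0 :> R by rewrite pnatr_eq0 -lt0n.
have h : 0 <= mean (fun a => (f a - mean f) ^+ 2).
  by rewrite /mean mulr_ge0 ?invr_ge0// sumr_ge0// => a _; exact: sqr_ge0.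
suff E : mean (fun a => (f a - mean f) ^+ 2) = mean (fun a => f a ^+ 2) - mean f ^+ 2.
  by rewrite -subr_ge0 -E.
set M := mean f; have fM : \sum_a f a = #|` N|%:R * M by rewrite /M /mean mulrA divff ?mul1r.
rewrite {1}/mean.
under eq_bigr do rewrite sqrrB.
rewrite big_split big_split/= sumrN sumr_const card_ord.
under [X in _ - X + _]eq_bigr do rewrite -mulrnAr.
rewrite -mulr_suml fM /mean -(mulr_natl (M ^+ 2)) -(mulr_natl M).
by field.
Qed.

Lemma trace_small m (eps : R) : 0 < eps -> exists n0 : nat,
  forall N (phi : nat -> 'I_#|` N| -> R), phi_rec phi -> (n0 <= #|` N|)%N ->
  Ex P (fun w => (#|` N|%:R^-1 * \tr (matrix_of N w ^+ m) - mean (phi m.+1)) ^+ 2)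
    <= eps.
Proof.
move=> eps0; have [n0 Hn0] := deviation_small m eps0.
exists n0 => N phi rphi nN.
have hd a := deviation_moments phi m a.
apply: (@le_trans _ _ (Ex P (fun w => mean (fun a => deviation phi m a w ^+ 2)))).
  have hm (F : Omega -> 'I_#|` N| -> R) : (forall a, has_moments P (F ^~ a)) ->
      has_moments P (fun w => mean (F w)).
    by move=> hF; apply: has_momentsZ; exact: has_moments_sum.
  have E w : #|` N|%:R^-1 * \tr (matrix_of N w ^+ m) - mean (phi m.+1) =
      mean (fun a => deviation phi m a w).
    by rewrite /mean -mulrBr -sumrB.
  under eq_fun do rewrite E.
  apply: le_Ex; last by move=> w; exact: mean_sq_le.
    by apply: has_momentsX; exact: hm.
  by apply: hm => a; exact: has_momentsX.
have hd2 a : has_moments P (fun w => deviation phi m a w ^+ 2) by exact: has_momentsX.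
rewrite /mean ExZ ?Ex_sum//; last exact: has_moments_sum.
apply: (le_trans (ler_norm _)); apply: mean_bound; last exact: ltW.
move=> a; rewrite ger0_norm; first exact: Hn0.
by apply: Ex_ge0 => w; exact: sqr_ge0.
Qed.

End band_model.

(** * The equation for Phi as a recursion *)

Section fps.
Context (R : realType).
Implicit Types a b c : nat -> R.

Definition fps_trunc n a : {poly R} := \poly_(i < n.+1) a i.

Lemma coef_fps_trunc n a i : (i <= n)%N -> (fps_trunc n a)`_i = a i.
Proof. by move=> im; rewrite coef_poly ltnS im. Qed.

(** Reduces identities between power series to the ring of polynomials. *)
Lemma fps_mulE n a b k : (k <= n)%N ->
  fps_mul a b k = (fps_trunc n a * fps_trunc n b)`_k.
Proof.
move=> kn; rewrite coefM; apply: eq_bigr => i _.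
have ik : (i <= k)%N by rewrite -ltnS.
by rewrite !coef_fps_trunc// ?(leq_trans (leq_subr _ _))// (leq_trans ik).
Qed.

Lemma fps_mulC a b : fps_mul a b = fps_mul b a.
Proof. by apply/funext => n; rewrite !(@fps_mulE n)// mulrC. Qed.

Lemma fps_mulA a b c : fps_mul a (fps_mul b c) = fps_mul (fps_mul a b) c.
Proof.
apply/funext => n; transitivity ((fps_trunc n a * (fps_trunc n b * fps_trunc n c))`_n).
  rewrite coefM; apply: eq_bigr => i _; have im : (i <= n)%N by rewrite -ltnS.
  by rewrite coef_fps_trunc// (@fps_mulE n)// leq_subr.
rewrite mulrA coefM; apply: eq_bigr => i _; have im : (i <= n)%N by rewrite -ltnS.
by rewrite (@fps_mulE n _ _ i)// coef_fps_trunc// leq_subr.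
Qed.

Lemma fps_mul1 a : fps_mul a (@fps1 R) = a.
Proof.
apply/funext => n; rewrite /fps_mul big_ord_recr/= subnn /fps1/= mulr1.
rewrite big1 ?add0r// => i _.
by rewrite subn_eq0 leqNgt ltn_ord mulr0.
Qed.

Lemma fps_mulBr a b c : fps_mul a (b \- c) = fps_mul a b \- fps_mul a c.
Proof.
apply/funext => n; rewrite /fps_mul/= -sumrB.
by apply: eq_bigr => i _; rewrite mulrBr.
Qed.

Lemma fps_mulX a n : fps_mul (@fpsX R) a n = if n is m.+1 then a m else 0.
Proof.
rewrite /fps_mul; case: n => [|n]; first by rewrite big_ord1 /fpsX mul0r.
rewrite big_ord_recl big_ord_recl/= /fpsX/= mul0r add0r mul1r subSS subn0.
by rewrite big1 ?addr0// => i _; rewrite mul0r.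
Qed.

Lemma fps_mulZ (r : R) a b : fps_mul (fun n => r * a n) b = (fun n => r * fps_mul a b n).
Proof.
apply/funext => n; rewrite /fps_mul mulr_sumr.
by apply: eq_bigr => i _; rewrite mulrA.
Qed.

(** Clearing the denominators in [F = W / (1 - W * S)], [W = t / (1 - r * t)]
    gives [F = t + r * t * F + t * F * S]. *)
Lemma fps_solve (r : R) (F S : nat -> R) :
  let W := fps_mul (@fpsX R) (fps_inv (@fps1 R \- (fun n => r * fpsX R n))) in
  S 0%N = 0 ->
  F = fps_mul W (fps_inv (@fps1 R \- fps_mul W S)) ->
  forall n, F n.+1 = (n == 0%N)%:R + r * F n + \sum_(i < n.+1) F i * S (n - i)%N.
Proof.
move=> W S0 FE n.
pose U := @fps1 R \- (fun n => r * fpsX R n).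
have WU : fps_mul W U = @fpsX R.
  rewrite /W -fps_mulA (fps_mulC _ U) fps_mulV ?fps_mul1//.
  by rewrite /U/= /fps1 /fpsX/= mulr0 subr0 oner_neq0.
have W0 : W 0%N = 0 by rewrite /W fps_mulX.
have FW : fps_mul F (@fps1 R \- fps_mul W S) = W.
  rewrite FE -fps_mulA (fps_mulC (fps_inv _)) fps_mulV ?fps_mul1//.
  by rewrite /= /fps_mul big_ord1/= W0 mul0r subr0 oner_neq0.
have FU : fps_mul F (U \- fps_mul (@fpsX R) S) = @fpsX R.
  have -> : U \- fps_mul (@fpsX R) S = fps_mul U (@fps1 R \- fps_mul W S).
    by rewrite fps_mulBr fps_mul1 fps_mulA (fps_mulC U) WU.
  by rewrite (fps_mulC U) fps_mulA FW WU.
have := congr1 (@^~ n.+1) FU.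
rewrite fps_mulBr /U fps_mulBr fps_mul1 /=.
rewrite (fps_mulC F (fun _ => _)) fps_mulZ fps_mulX.
rewrite (fps_mulC F) -fps_mulA fps_mulX fps_mulC /fpsX eqSS => h.
by rewrite -h -/(fps_mul F S n) -addrA; ring.
Qed.

End fps.

(** * Convergence of integrals of varying integrands *)

Section truncated_distance.
Context (R : realType) (C : completePseudoMetricType R).
Implicit Types x y z : C.

(* A finite distance inducing the topology of [C]. *)
Definition tdist x y : R := fine (Order.min (edist (x, y)) 1%E).

Lemma tdist_fin x y : (Order.min (edist (x, y)) 1%E) \is a fin_num.
Proof.
by case: (leP (edist (x, y)) 1%E) => // h; rewrite ge0_fin_numE ?edist_ge0// (le_lt_trans h)// ltry.
Qed.

Lemma EFin_tdist x y : (tdist x y)%:E = Order.min (edist (x, y)) 1%E.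
Proof. by rewrite fineK// tdist_fin. Qed.

Lemma tdist_ge0 x y : 0 <= tdist x y.
Proof. by rewrite -lee_fin EFin_tdist le_min edist_ge0 lee_fin ler01. Qed.

Lemma tdist_refl x : tdist x x = 0.
Proof. by apply/EFin_inj; rewrite EFin_tdist edist_refl min_l// lee_fin. Qed.

Lemma tdist_sym x y : tdist x y = tdist y x.
Proof. by rewrite /tdist edist_sym. Qed.

Lemma tdist_triangle x y z : tdist x z <= tdist x y + tdist y z.
Proof.
have le1 a b : tdist a b <= 1 by rewrite -lee_fin EFin_tdist ge_min lexx orbT.
have [x1|x1] := leP 1%E (edist (x, y)).
  apply: (le_trans (le1 _ _)); rewrite {1}/tdist min_r//=.
  by rewrite lerDl tdist_ge0.
have [y1|y1] := leP 1%E (edist (y, z)).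
  apply: (le_trans (le1 _ _)); rewrite {2}/tdist min_r//=.
  by rewrite lerDr tdist_ge0.
rewrite -lee_fin EFinD !EFin_tdist (min_l (ltW x1)) (min_l (ltW y1)) ge_min.
by rewrite edist_triangle.
Qed.

Lemma tdist_lt_ball r x y : tdist x y < r -> r <= 1 -> ball x r y.
Proof.
rewrite -lte_fin EFin_tdist => h r1; apply: (@edist_lt_ball _ _ r (x, y)).
move: h; rewrite gt_min => /orP[//|]; rewrite lte_fin => h.
by have := le_lt_trans r1 h; rewrite ltxx.
Qed.

Lemma ball_tdist_le r x y : 0 < r -> ball x r y -> tdist x y <= r.
Proof.
move=> r0 xy; rewrite -lee_fin EFin_tdist ge_min; apply/orP; left.
exact: edist_fin.
Qed.

Lemma lipschitz_continuous (f : C -> R) K :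
  (forall x y, f x - f y <= K * tdist x y) -> continuous f.
Proof.
move=> fK x; apply/cvgrPdist_le => /= e e0.
pose K' := `|K| + 1.
have K'0 : 0 < K' by rewrite ltr_wpDl.
near=> y.
have xy : tdist x y <= e / K'.
  apply: ball_tdist_le; first by rewrite divr_gt0.
  by near: y; apply: nbhsx_ballx; rewrite divr_gt0.
have h : K * tdist x y <= e.
  apply: (@le_trans _ _ (K' * tdist x y)).
    rewrite ler_wpM2r ?tdist_ge0// (le_trans (ler_norm _))// lerDl//.
  by rewrite mulrC -ler_pdivlMr.
rewrite ler_norml; apply/andP; split; last exact: le_trans (fK x y) h.
by rewrite lerNl opprB (le_trans (fK y x))// tdist_sym.
Unshelve. all: by end_near. Qed.

Lemma continuous_borel_measurable (f : C -> R) : continuous f ->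
  measurable_fun [set: borel C] (f : borel C -> R).
Proof.
move=> /continuousP cf; apply: (measurability _ (RGenOpens.measurableE R)) => //.
move=> _ [_ [a [b ->]] <-]; rewrite setTI; apply: sub_sigma_algebra.
by apply: cf; exact: interval_open.
Qed.

End truncated_distance.

Section extended_mapping.
Context (R : realType) (C : completePseudoMetricType R).
Variable theta : probability (borel C) R.
Context (I : Type) (F : set_system I) (FF : ProperFilter F).
Variable V : nat -> set I.
Hypothesis FV : forall K, F (V K).
Hypothesis V_dec : forall K, V K.+1 `<=` V K.
Hypothesis V_basis : forall A, F A -> exists K, V K `<=` A.

Definition continuously_cvg (f : I -> C -> R) (g : C -> R) c :=
  f p.1 p.2 @[p --> (F, nbhs c)] --> g c.

Variable nu : I -> {measure set (borel C) -> \bar R}.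
Hypothesis nuT : forall i, nu i [set: borel C] = 1%E.
Hypothesis nu_cvg : forall u, Cb R C u ->
  (\int[nu i]_x (u : borel C -> R) x)%R @[i --> F] -->
  (\int[theta]_x (u : borel C -> R) x)%R.

Lemma bounded_integrable (m : {measure set (borel C) -> \bar R}) (u : C -> R) B :
  m [set: borel C] = 1%E -> measurable_fun [set: borel C] (u : borel C -> R) ->
  (forall c, `|u c| <= B) -> m.-integrable [set: borel C] (EFin \o u).
Proof.
move=> m1 mu uB; apply: measurable_bounded_integrable => //.
  by rewrite m1 ltry.
exists B; split; first exact: num_real.
by move=> x Bx c _; apply: le_trans (uB c) _; exact: ltW.
Qed.

Section envelope.
Variables (f : I -> C -> R) (B : R).
Hypothesis fB : forall i c, `|f i c| <= B.

Let vals K c : set R :=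
  [set r | exists i c', V K i /\ r = f i c' - K%:R * tdist c c'].

(* The smallest [K]-Lipschitz function above all [f i] with [i] in [V K]. *)
Definition upper_envelope K c : R := sup (vals K c).

Let B_ge0 : 0 <= B.
Proof.
have [i _] := filter_ex (FV 0).
by apply: le_trans (fB i point).
Qed.

Let vals_ub K c : ubound (vals K c) B.
Proof.
move=> _ [i [c' [_ ->]]]; apply: (@le_trans _ _ (f i c')).
  by rewrite gerBl mulr_ge0// tdist_ge0.
by rewrite (le_trans (ler_norm _)).
Qed.

Let vals_sup K c : has_sup (vals K c).
Proof.
split; last by exists B; exact: vals_ub.
have [i Vi] := filter_ex (FV K).
by exists (f i c - K%:R * tdist c c), i, c.
Qed.

Lemma upper_envelope_ge K i c c' : V K i ->
  f i c' - K%:R * tdist c c' <= upper_envelope K c.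
Proof.
move=> Vi; apply: ub_le_sup; first by have [] := vals_sup K c.
by exists i, c'.
Qed.

Lemma upper_envelope_le K c : upper_envelope K c <= B.
Proof. by apply: ge_sup; [have [] := vals_sup K c|exact: vals_ub]. Qed.

Lemma le_upper_envelope K i c : V K i -> f i c <= upper_envelope K c.
Proof.
by move=> Vi; have := upper_envelope_ge c c Vi; rewrite tdist_refl mulr0 subr0.
Qed.

Lemma upper_envelope_bound K c : `|upper_envelope K c| <= B.
Proof.
rewrite ler_norml upper_envelope_le andbT.
have [i Vi] := filter_ex (FV K).
apply: le_trans (le_upper_envelope c Vi).
by have := fB i c; rewrite ler_norml => /andP[].
Qed.

Lemma upper_envelope_continuous K : continuous (upper_envelope K).
Proof.
apply: (@lipschitz_continuous _ _ _ K%:R) => x y; rewrite lerBlDr.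
apply: ge_sup; first by have [] := vals_sup K x.
move=> _ [i [c' [Vi ->]]]; have := upper_envelope_ge y c' Vi.
have := tdist_triangle y x c'; rewrite (tdist_sym y x) => h1 h2.
have : K%:R * tdist y c' <= K%:R * (tdist x y + tdist x c') by rewrite ler_wpM2l.
lra.
Qed.

Lemma upper_envelope_Cb K : Cb R C (upper_envelope K).
Proof.
split; first exact: upper_envelope_continuous.
exists B; split; first exact: num_real.
by move=> x Bx c _; apply: le_trans (upper_envelope_bound _ _) _; exact: ltW.
Qed.

(** Points [c'] far from [c] are excluded by the penalty [K * tdist c c'] once
    [K] is large, and for points close to [c] the convergence is assumed. *)
Lemma upper_envelope_cvg g c : continuously_cvg f g c ->
  upper_envelope K c @[K --> \oo] --> g c.
Proof.
move=> /cvgrPdist_le fg; apply/cvgrPdist_le => /= e e0.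
have [[/= A D] [FA cD] AD] := fg e e0.
have [K0 VK0] := V_basis FA.
have /nbhs_ballP[/= r r0 rD] := cD.
have fge i c' : V K0 i -> D c' -> `|g c - f i c'| <= e.
  by move=> Vi Dc'; apply: (AD (i, c')); split => //; exact: VK0.
have V_le K K' : (K <= K')%N -> V K' `<=` V K.
  elim: K' => [|K' IH]; first by rewrite leqn0 => /eqP ->.
  rewrite leq_eqVlt => /orP[/eqP -> //|]; rewrite ltnS => KK'.
  by apply: subset_trans (IH KK'); exact: V_dec.
pose q := Num.min r 1.
have q0 : 0 < q by rewrite lt_min r0 ltr01.
near=> K.
have K0K : (K0 <= K)%N by near: K; exact: nbhs_infty_ge.
have Kq : 2 * B / q <= K%:R by near: K; exact: nbhs_infty_ger.
rewrite distrC ler_norml; apply/andP; split.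
  have [i Vi] := filter_ex (FV K).
  have h1 := le_upper_envelope c Vi.
  have := fge i c (V_le _ _ K0K _ Vi) (nbhs_singleton cD).
  rewrite ler_norml => /andP[_ h2]; lra.
rewrite lerBlDr; apply: ge_sup; first by have [] := vals_sup K c.
move=> _ [i [c' [Vi ->]]].
have [dq|dq] := ltP (tdist c c') q.
  have cc' : ball c r c'.
    have qr : q <= r by rewrite ge_min lexx.
    have : ball c q c' by apply: tdist_lt_ball => //; rewrite ge_min lexx orbT.
    exact: le_ball.
  have := fge i c' (V_le _ _ K0K _ Vi) (rD _ cc').
  rewrite ler_norml => /andP[h1 _].
  have : 0 <= K%:R * tdist c c' by rewrite mulr_ge0// tdist_ge0.
  lra.
have h1 : 2 * B <= K%:R * tdist c c'.
  rewrite ler_pdivrMr// in Kq; apply: (le_trans Kq).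
  by rewrite ler_wpM2l.
have [j Vj] := filter_ex (FV K).
have := fge j c (V_le _ _ K0K _ Vj) (nbhs_singleton cD).
rewrite ler_norml => /andP[h2 _].
have := fB j c; have := fB i c'; rewrite !ler_norml => /andP[_ h3] /andP[h4 _].
lra.
Unshelve. all: by end_near. Qed.

End envelope.

Lemma extended_mapping_le (f : I -> C -> R) (g : C -> R) (B : R) (Z : set C) :
  (forall i, measurable_fun [set: borel C] (f i : borel C -> R)) ->
  measurable_fun [set: borel C] (g : borel C -> R) ->
  (forall i c, `|f i c| <= B) ->
  theta.-negligible Z -> (forall c, ~ Z c -> continuously_cvg f g c) ->
  forall e, 0 < e -> \forall i \near F,
  (\int[nu i]_x (f i : borel C -> R) x)%R <=
  (\int[theta]_x (g : borel C -> R) x)%R + e.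
Proof.
move=> mf mg fB nZ fg e e0.
have thetaT : theta [set: borel C] = 1%E by exact: probability_setT.
pose U K : borel C -> R := upper_envelope f K.
have mU K : measurable_fun [set: borel C] (U K).
  by apply: continuous_borel_measurable; exact: upper_envelope_continuous fB K.
have [ig _ cU] : [/\ theta.-integrable setT (EFin \o (g : borel C -> R)),
    [sequence (\int[theta]_x `|(EFin \o U n) x - (EFin \o (g : borel C -> R)) x|)%E]_n
       @ \oo --> 0%E &
    [sequence (\int[theta]_x (EFin \o U n) x)%E]_n @ \oo -->
      (\int[theta]_x (EFin \o (g : borel C -> R)) x)%E].
  apply: (@dominated_convergence _ _ _ theta _ _ _ _ (cst B%:E)) => //.
  - by move=> K; exact/measurable_EFinP.
  - exact/measurable_EFinP.
  - apply: negligibleS nZ => c /= h; apply: contrapT => Zc; apply: h => _.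
    by apply: cvg_EFin; [near=> x|exact: upper_envelope_cvg fB _ _ (fg c Zc)].
  - exact: (finite_measure_integrable_cst theta B).
  - by apply: aeW => c K _ /=; rewrite lee_fin; exact: upper_envelope_bound.
have gE : (\int[theta]_x (EFin \o (g : borel C -> R)) x)%E =
    ((\int[theta]_x (g : borel C -> R) x)%R)%:E.
  by rewrite fineK// integrable_fin_num.
have [K HK] : exists K, (\int[theta]_x U K x)%R <=
    (\int[theta]_x (g : borel C -> R) x)%R + e / 2.
  move: cU; rewrite gE => /fine_cvg/cvgrPdist_le /(_ (e / 2)).
  rewrite divr_gt0// => /(_ isT) /filter_ex[K /= hK]; exists K.
  move: hK; rewrite ler_norml => /andP[+ _].
  rewrite /Rintegral; set x := fine _; set y := fine _ => h; lra.
have hnu := nu_cvg (upper_envelope_Cb fB K).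
move/cvgrPdist_le : hnu => /(_ (e / 2)); rewrite divr_gt0// => /(_ isT) hnu.
have FVK := FV K.
near=> i.
have Vi : V K i by near: i.
have h1 : (\int[nu i]_x (f i : borel C -> R) x)%R <= (\int[nu i]_x U K x)%R.
  apply: le_Rintegral => //.
  - exact: (bounded_integrable (nuT i) (mf i) (fB i)).
  - exact: (bounded_integrable (nuT i) (mU K) (upper_envelope_bound fB K)).
  - by move=> x _; exact: (le_upper_envelope fB x Vi).
have : `|(\int[theta]_x U K x)%R - (\int[nu i]_x U K x)%R| <= e / 2.
  by near: i.
rewrite ler_norml => /andP[h2 h3]; lra.
Unshelve. all: by end_near. Qed.

(** The integrands are squeezed between Lipschitz envelopes [upper_envelope f K]
    and their analogues from below.  Weak convergence applies to the envelopes,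
    and by dominated convergence their integrals against [theta] tend to that of
    [g] when [K] grows. *)
Theorem extended_mapping (f : I -> C -> R) (g : C -> R) (B : R) (Z : set C) :
  (forall i, measurable_fun [set: borel C] (f i : borel C -> R)) ->
  measurable_fun [set: borel C] (g : borel C -> R) ->
  (forall i c, `|f i c| <= B) -> (forall c, `|g c| <= B) ->
  theta.-negligible Z -> (forall c, ~ Z c -> continuously_cvg f g c) ->
  (\int[nu i]_x (f i : borel C -> R) x)%R @[i --> F] -->
  (\int[theta]_x (g : borel C -> R) x)%R.
Proof.
move=> mf mg fB gB nZ fg; apply/cvgrPdist_le => e e0.
have up := extended_mapping_le mf mg fB nZ fg e0.
have thetaT : theta [set: borel C] = 1%E by exact: probability_setT.
pose f' i c := - f i c; pose g' c := - g c.
have mf' i : measurable_fun [set: borel C] (f' i : borel C -> R).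
  exact: measurable_funN.
have mg' : measurable_fun [set: borel C] (g' : borel C -> R).
  exact: measurable_funN.
have fB' i c : `|f' i c| <= B by rewrite normrN.
have fg' c : ~ Z c -> continuously_cvg f' g' c.
  by move=> Zc; apply: cvgN; exact: fg.
have lo := extended_mapping_le mf' mg' fB' nZ fg' e0.
have ig := bounded_integrable thetaT mg gB.
near=> i.
have Ni : (\int[nu i]_x (f' i : borel C -> R) x)%R =
    - (\int[nu i]_x (f i : borel C -> R) x)%R.
  rewrite -mulN1r -RintegralZl//; last exact: bounded_integrable (nuT i) (mf i) (fB i).
  by apply: eq_Rintegral => x _; rewrite mulN1r.
have Ng : (\int[theta]_x (g' : borel C -> R) x)%R =
    - (\int[theta]_x (g : borel C -> R) x)%R.
  rewrite -mulN1r -RintegralZl//.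
  by apply: eq_Rintegral => x _; rewrite mulN1r.
rewrite ler_norml; apply/andP; split.
  have h : (\int[nu i]_x (f i : borel C -> R) x)%R <=
    (\int[theta]_x (g : borel C -> R) x)%R + e by near: i.
  lra.
have h : (\int[nu i]_x (f' i : borel C -> R) x)%R <=
  (\int[theta]_x (g' : borel C -> R) x)%R + e by near: i.
rewrite Ni Ng in h; lra.
Unshelve. all: by end_near. Qed.

End extended_mapping.

(** * Convergence of the moments of the limiting measures *)

Section Phi_convergence.
Context (R : realType) (C : completePseudoMetricType R).
Variables (D : C -> R) (s2 : C * C -> R).
Hypothesis s2_meas :
  measurable_fun [set: borel C * borel C] (s2 : borel C * borel C -> R).
Variables (bD bs : R).
Hypothesis D_bound : forall c, `|D c| <= bD.
Hypothesis s2_bound : forall cc, `|s2 cc| <= bs.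

Implicit Types sigma : {measure set (borel C) -> \bar R}.

Definition kernel_op sigma (u : C -> R) (c : C) : R :=
  (\int[sigma]_(c' in [set: borel C]) (s2 (c, c') * u c'))%R.

Lemma is_Phi_rec sigma Phi : is_Phi D s2 sigma Phi -> forall n c,
  Phi n.+1 c = (n == 0%N)%:R + D c * Phi n c +
    \sum_(i < n.+1) Phi i c * kernel_op sigma (Phi (n - i)%N) c.
Proof.
move=> [_ _ Phi0 PhiE] n c.
apply: (@fps_solve R (D c) (Phi ^~ c) (fun n => kernel_op sigma (Phi n) c)).
  rewrite /kernel_op Phi0; under eq_Rintegral do rewrite mulr0.
  by rewrite /Rintegral integral0.
exact: PhiE.
Qed.

Lemma section_measurable (u : C -> R) c :
  measurable_fun [set: borel C] (u : borel C -> R) ->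
  measurable_fun [set: borel C] ((fun c' => s2 (c, c') * u c') : borel C -> R).
Proof.
move=> mu; apply: measurable_funM => //.
exact: (measurableT_comp s2_meas (pair1_measurable (c : borel C))).
Qed.

Lemma Rintegral_bound sigma (u : C -> R) B : sigma [set: borel C] = 1%E ->
  measurable_fun [set: borel C] (u : borel C -> R) ->
  (forall c, `|u c| <= B) ->
  `|(\int[sigma]_(c in [set: borel C]) u c)%R| <= B.
Proof.
move=> s1 mu uB; have iu := bounded_integrable s1 mu uB.
apply: (le_trans (le_normr_Rintegral _ iu)) => //.
have icst : sigma.-integrable [set: borel C] (EFin \o (cst B : borel C -> R)).
  by apply: (bounded_integrable (B := `|B|) s1).
have -> : B = (\int[sigma]_(c in [set: borel C]) (cst B c))%R.
  by rewrite Rintegral_cst// s1 mulr1.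
have inu : sigma.-integrable [set: borel C] (EFin \o (fun c : borel C => `|u c|)).
  apply: (@bounded_integrable _ _ _ (fun c => `|u c|) B s1).
    exact: measurableT_comp.
  by move=> c; rewrite normr_id.
by apply: le_Rintegral => // c _; exact: uB.
Qed.

Lemma is_Phi_bound m : exists2 B : R, 0 <= B & forall sigma Phi,
  sigma [set: borel C] = 1%E -> is_Phi D s2 sigma Phi ->
  forall j c, (j <= m)%N -> `|Phi j c| <= B.
Proof.
elim: m => [|m [B B0 HB]].
  exists 0 => // sigma Phi _ [_ _ Phi0 _] j c; rewrite leqn0 => /eqP ->.
  by rewrite Phi0 normr0.
have bs0 : 0 <= bs by exact: le_trans (s2_bound point).
have bD0 : 0 <= bD by exact: le_trans (D_bound point).
exists (B + (1 + bD * B + \sum_(i < m.+1) (B * (bs * B)))).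
  by rewrite !addr_ge0// ?mulr_ge0// sumr_ge0// => i _; rewrite !mulr_ge0.
move=> sigma Phi s1 hPhi j c; rewrite leq_eqVlt => /orP[/eqP ->|jm]; last first.
  rewrite (le_trans (HB _ _ s1 hPhi _ _ jm))// lerDl.
  by rewrite !addr_ge0// ?mulr_ge0// sumr_ge0// => i _; rewrite !mulr_ge0.
apply: (le_trans _ (_ : 1 + bD * B + \sum_(i < m.+1) (B * (bs * B)) <= _)); last first.
  by rewrite lerDr.
rewrite (is_Phi_rec hPhi); apply: (le_trans (ler_normD _ _)); apply: lerD.
  apply: (le_trans (ler_normD _ _)); apply: lerD.
    by case: (m == 0)%N; rewrite ?normr1 ?normr0.
  by rewrite normrM ler_pM// (HB _ _ s1 hPhi).
apply: (le_trans (ler_norm_sum _ _ _)); apply: ler_sum => i _.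
rewrite normrM ler_pM//; first by rewrite (HB _ _ s1 hPhi)// -ltnS.
have [mPhi _ _ _] := hPhi.
apply: Rintegral_bound => //; first exact: section_measurable.
by move=> c'; rewrite normrM ler_pM// (HB _ _ s1 hPhi)// leq_subr.
Qed.

Variable theta : probability (borel C) R.
Hypothesis D_cont : theta.-negligible (discontinuity_set D).
Hypothesis s2_cont : (theta \x theta)%E.-negligible (discontinuity_set s2).

(** The colors at which joint convergence of the coefficients may fail. *)
Definition bad_color : set C := discontinuity_set D `|`
  [set c | ~ theta.-negligible [set c' | discontinuity_set s2 (c, c')]].

(** Almost every section of a null set is null. *)
Lemma bad_color_negligible : theta.-negligible bad_color.
Proof.
apply: negligibleU => //.
have [A [mA A0 sA]] := s2_cont.
have mx : measurable_fun [set: borel C] (theta \o xsection A).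
  exact: measurable_fun_xsection.
have : ae_eq theta [set: borel C] (theta \o xsection A) (cst 0%E).
  apply/ae_eq_integral_abs => //; rewrite -[RHS]A0; apply: eq_integral => c _.
  by rewrite gee0_abs.
apply: negligibleS => c /= h; apply: contra_not h => /(_ I) xA0.
exists (xsection A c); split => //; first exact: measurable_xsection.
by move=> c' /= h; rewrite /xsection/= inE; exact: sA.
Qed.

Variable nu : nat -> {measure set (borel C) -> \bar R}.
Hypothesis nuT : forall k, nu k [set: borel C] = 1%E.
Hypothesis nu_cvg : weak_cvg (T := borel C) (Cb R C) nu theta.
Variables (Phis : nat -> nat -> C -> R) (Phi : nat -> C -> R).
Hypothesis Phis_def : forall k, is_Phi D s2 (nu k) (Phis k).
Hypothesis Phi_def : is_Phi D s2 theta Phi.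

Let thetaT : theta [set: borel C] = 1%E. Proof. exact: probability_setT. Qed.

(** [extended_mapping] indexed by pairs [(k, c1)], for the integrands
    [s2 (c1, _) * Phis k j]. *)
Lemma kernel_op_cvg j :
  (forall c, ~ bad_color c ->
     Phis p.1 j p.2 @[p --> (\oo, nbhs c)] --> Phi j c) ->
  forall c, ~ bad_color c ->
  kernel_op (nu p.1) (Phis p.1 j) p.2 @[p --> (\oo, nbhs c)] --> kernel_op theta (Phi j) c.
Proof.
move=> cvgPhi c cZ; have [B B0 HB] := is_Phi_bound j.
have bs0 : 0 <= bs by exact: le_trans (s2_bound point).
pose V K : set (nat * C) := [set p | (K <= p.1)%N /\ ball c K.+1%:R^-1 p.2].
have mPhi : measurable_fun [set: borel C] (Phi j : borel C -> R) by case: Phi_def.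
have mPhis k : measurable_fun [set: borel C] (Phis k j : borel C -> R).
  by case: (Phis_def k).
pose f (p : nat * C) c' := s2 (p.2, c') * Phis p.1 j c'.
pose g c' := s2 (c, c') * Phi j c'.
pose Z : set C := bad_color `|` [set c' | discontinuity_set s2 (c, c')].
have nZ : theta.-negligible Z.
  apply: negligibleU; first exact: bad_color_negligible.
  by apply: contrapT => h; apply: cZ; right.
apply: (@extended_mapping R C theta _ (filter_prod \oo (nbhs c)) _ V _ _ _
  (fun p => nu p.1) _ _ f g (bs * B) Z) => //.
- move=> K; exists ([set n | (K <= n)%N], ball c K.+1%:R^-1) => /=.
    by split; [exact: nbhs_infty_ge|apply: nbhsx_ballx].
  by move=> p [].
- move=> K p [Kp cp]; split; first exact: ltnW.
  by apply: le_ball cp; rewrite lef_pV2 ?posrE// ler_nat.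
- move=> A [[/= A1 A2] [[K1 _ KA1] /nbhs_ballP[r r0 rA2]] AA].
  pose K := maxn K1 (Num.truncn r^-1).
  exists K => -[k c'] [/= Kk cc']; apply: AA; split => /=.
    by apply: KA1; rewrite /= (leq_trans (leq_maxl _ _) Kk).
  apply: rA2; apply: le_ball cc'.
  rewrite -[leRHS]invrK lef_pV2 ?posrE ?invr_gt0//.
  rewrite ltW// (lt_le_trans (truncnS_gt _))// ler_nat ltnS leq_maxr//.
- move=> u Cu; apply: cvg_comp (nu_cvg Cu); exact: cvg_fst.
- by move=> p; exact: section_measurable.
- exact: section_measurable.
- by move=> p c'; rewrite normrM ler_pM// (HB _ _ (nuT p.1) (Phis_def p.1)).
- by move=> c'; rewrite normrM ler_pM// (HB _ _ thetaT Phi_def).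
- move=> c' /not_orP[c'Z c'cont].
  have {}c'cont : {for (c, c'), continuous s2}.
    by apply: contrapT => h; exact: c'cont.
  apply: cvgM.
    apply: (cvg_comp (fun p : (nat * C) * C => (p.1.2, p.2)) s2 _ c'cont).
    apply: cvg_pair.
      by apply: cvg_comp; [exact: cvg_fst|exact: cvg_snd].
    exact: cvg_snd.
  have := cvgPhi c' c'Z.
  apply: (cvg_comp (fun p : (nat * C) * C => (p.1.1, p.2))
    (fun p => Phis p.1 j p.2)).
  apply: cvg_pair.
    by apply: cvg_comp; [exact: cvg_fst|exact: cvg_fst].
  exact: cvg_snd.
Qed.

(** Each coefficient is obtained from smaller ones by sums, products and
    integration against [s2], all of which preserve joint convergence. *)
Lemma Phi_cvg j c : ~ bad_color c ->
  Phis p.1 j p.2 @[p --> (\oo, nbhs c)] --> Phi j c.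
Proof.
elim/ltn_ind: j c => -[_|m IH] c cZ.
  have [_ _ -> _] := Phi_def.
  have -> : (fun p : nat * C => Phis p.1 0 p.2) = cst 0.
    by apply/funext => p; case: (Phis_def p.1) => _ _ -> _.
  exact: cvg_cst.
rewrite (is_Phi_rec Phi_def).
under eq_fun do rewrite (is_Phi_rec (Phis_def _)).
have cD : (fun p : nat * C => D p.2) @ filter_prod \oo (nbhs c) --> D c.
  apply: (cvg_comp snd D); first exact: cvg_snd.
  by apply: contrapT => h; apply: cZ; left.
apply: cvgD.
  apply: cvgD; first exact: cvg_cst.
  by apply: cvgM => //; exact: IH.
apply: cvg_big => [|i _].
  exact: add_continuous.
apply: cvgM; first exact: IH.
apply: kernel_op_cvg => //.
by move=> c' c'Z; apply: IH => //; rewrite ltnS leq_subr.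
Qed.

Lemma Phi_integral_cvg j :
  (\int[nu k]_(c in [set: borel C]) Phis k j c)%R @[k --> \oo] -->
  (\int[theta]_(c in [set: borel C]) Phi j c)%R.
Proof.
have [B B0 HB] := is_Phi_bound j.
apply: (@extended_mapping R C theta nat \oo _ (fun K => [set n | (K <= n)%N]) _ _ _
  nu _ _ (fun k => Phis k j) (Phi j) B bad_color) => //.
- by move=> K; exact: nbhs_infty_ge.
- by move=> K n /=; exact: ltnW.
- by move=> A [K _ KA]; exists K.
- by move=> k; case: (Phis_def k).
- by case: Phi_def.
- by move=> k c; exact: (HB _ _ (nuT k) (Phis_def k)).
- by move=> c; exact: (HB _ _ thetaT Phi_def).
- exact: bad_color_negligible.
- by move=> c cZ; exact: Phi_cvg.
Qed.

End Phi_convergence.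

(** * Traces of powers and eigenvalues *)

Section spectrum.
Context (R : realType) (n : nat).
Implicit Types (A : 'M[R]_n) (s : seq R).

Lemma char_poly_conj (F : fieldType) (A B Q : 'M[F]_n) : Q \in unitmx ->
  A = invmx Q *m B *m Q -> char_poly A = char_poly B.
Proof.
move=> uQ AE; pose Q1 := map_mx polyC Q; pose Q2 := map_mx polyC (invmx Q).
have QQ : Q2 *m Q1 = 1%:M by rewrite -map_mxM mulVmx// map_mx1.
rewrite /char_poly (_ : char_poly_mx A = Q2 *m char_poly_mx B *m Q1).
  by rewrite !det_mulmx mulrC mulrA -det_mulmx (mulmx1C QQ) det1 mul1r.
rewrite /char_poly_mx mulmxBr mulmxBl -!map_mxM -AE; congr (_ - _).
by rewrite scalar_mxC -mulmxA QQ mulmx1.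
Qed.

Lemma expr_conj (F : fieldType) (A B Q : 'M[F]_n) m : Q \in unitmx ->
  A = invmx Q *m B *m Q -> A ^+ m = invmx Q *m B ^+ m *m Q.
Proof.
move=> uQ AE; elim: m => [|m IH]; first by rewrite !expr0 mulmx1 mulVmx.
rewrite !exprS -![_ * _]/(_ *m _) IH {1}AE.
by rewrite -!mulmxA; congr (_ *m (_ *m _)); rewrite !mulmxA mulmxV// mul1mx.
Qed.

Lemma trace_diagX (F : fieldType) (d : 'rV[F]_n) m :
  \tr (diag_mx d ^+ m) = \sum_i d 0 i ^+ m.
Proof.
have -> : diag_mx d ^+ m = diag_mx (\row_i d 0 i ^+ m).
  elim: m => [|m IH].
    apply/matrixP => i j; rewrite expr0 !mxE expr0.
    by case: (i == j).
  rewrite exprS IH -[_ * _]/(_ *m _) mulmx_diag; congr diag_mx.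
  by apply/rowP => i; rewrite !mxE exprS.
by rewrite mxtrace_diag; apply: eq_bigr => i _; rewrite mxE.
Qed.

(** Over the complex extension of [R] the matrix is diagonalizable, and the roots
    of the characteristic polynomial are determined up to order. *)
Lemma trace_spectrumX A s m : A^T = A -> is_spectrum A s ->
  \tr (A ^+ m) = \sum_(a <- s) a ^+ m.
Proof.
move=> symA [_ sA]; pose f := real_complex R; pose B : 'M[R[i]]_n := map_mx f A.
have hB : B \is hermsymmx.
  apply: realsym_hermsym.
    by apply/is_hermitianmxP; rewrite expr0 scale1r map_mx_id// /B map_trmx symA.
  by apply/mxOverP => i j; rewrite mxE complex_real eqxx.
have /orthomx_spectralP := hermitian_normalmx hB.
set Q := spectralmx B; set d := spectral_diag B => defB.
have uQ : Q \in unitmx by exact: spectral_unit.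
have cB : \prod_(a <- map f s) ('X - a%:P) = \prod_(a <- [seq d 0 i | i <- enum 'I_n]) ('X - a%:P).
  transitivity (char_poly B).
    rewrite /B -map_char_poly sA rmorph_prod big_map; apply: eq_bigr => a _ /=.
    by rewrite rmorphB /= map_polyX map_polyC.
  rewrite (char_poly_conj uQ defB) char_poly_trig ?diag_mx_is_trig//.
  rewrite big_map big_enum/=.
  by apply: eq_bigr => i _; rewrite mxE eqxx.
have perm := prod_XsubC_eq cB.
apply: (fmorph_inj f); rewrite -trace_map_mx.
have -> : map_mx f (A ^+ m) = B ^+ m.
  elim: m => [|m IH]; first by rewrite !expr0 map_mx1.
  by rewrite !exprS -![_ * _]/(_ *m _) map_mxM IH.
rewrite (expr_conj m uQ defB) mxtrace_mulC mulmxA mulmxV// mul1mx trace_diagX.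
rewrite rmorph_sum /=; under [RHS]eq_bigr do rewrite rmorphXn/=.
transitivity (\sum_(z <- map f s) z ^+ m); last by rewrite big_map.
by rewrite (perm_big _ perm)/= big_map big_enum.
Qed.

Lemma size_spectrum A s : is_spectrum A s -> size s = n.
Proof.
move=> [_ sA]; have := size_char_poly A.
by rewrite sA size_prod_XsubC => -[].
Qed.

Lemma trace_horner A s (p : {poly R}) : A^T = A -> is_spectrum A s ->
  \sum_(a <- s) p.[a] = \sum_(i < size p) p`_i * \tr (A ^+ i).
Proof.
move=> symA sA; under eq_bigr do rewrite horner_coef.
rewrite exchange_big/=; apply: eq_bigr => i _.
by rewrite (trace_spectrumX _ symA sA) mulr_sumr.
Qed.

End spectrum.

(** * Polynomial approximation on a segment *)

Section weierstrass.
Context (R : realType).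
Implicit Types (f : R -> R) (g h : nat -> R) (x y M : R).

(** Heine's theorem, from the covering form of compactness. *)
Lemma uniform_modulus f M (e : R) : continuous f -> 0 < e -> exists2 delta : R, 0 < delta &
  forall x y, x \in `[- M, M] -> `|x - y| < delta -> `|f x - f y| <= e.
Proof.
move=> cf e0.
have cK : compact `[- M, M] by exact: segment_compact.
have /compact_near_coveringP nK := cK.
have := nK R (0^'+) (fun delta x => forall y, `|x - y| < delta -> `|f x - f y| <= e).
case.
- move=> x _; have /cvgrPdist_le /(_ (e / 2)) := cf x.
  rewrite divr_gt0// => /(_ isT) /nbhs_ballP[r /= r0 rf].
  near=> x' delta => y x'y.
  have xx' : ball x (r / 2) x'.
    by near: x'; apply: nbhsx_ballx; rewrite divr_gt0.
  have dr : delta <= r / 2 by near: delta; apply: nbhs_right_le; rewrite divr_gt0.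
  have bx' : ball x r x'.
    by apply: le_ball xx'; lra.
  have bxy : ball x r y.
    rewrite [r](splitr r); apply: ball_triangle xx' _.
    by rewrite /ball/=; exact: lt_le_trans dr.
  have := rf _ bx'; have := rf _ bxy; rewrite /= !ler_norml => /andP[h1 h2] /andP[h3 h4].
  by apply/andP; split; lra.
- move=> d /= d0 Hd.
  have d2 : 0 < d / 2 by rewrite divr_gt0.
  exists (d / 2) => // x y xM xy; apply: (Hd (d / 2)) => //=.
  by rewrite sub0r normrN gtr0_norm//; lra.
Unshelve. all: by end_near. Qed.

(* The Bernstein polynomial [\sum_k 'C(n, k) 'X^k (1 - 'X)^(n - k) g k], in the
   recursive form that makes its first moments a one-line induction. *)
Fixpoint bernstein n g : {poly R} :=
  if n is m.+1 then
    'X * bernstein m (fun k => g k.+1) + (1 - 'X) * bernstein m g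
  else (g 0%N)%:P.

Lemma bernsteinS n g x : (bernstein n.+1 g).[x] =
  x * (bernstein n (fun k => g k.+1)).[x] + (1 - x) * (bernstein n g).[x].
Proof. by rewrite /= hornerD !hornerM hornerX hornerD hornerC hornerN hornerX. Qed.

Lemma bernstein_le n g h x : 0 <= x <= 1 ->
  (forall k, (k <= n)%N -> g k <= h k) -> (bernstein n g).[x] <= (bernstein n h).[x].
Proof.
move=> /andP[x0 x1]; elim: n g h => [|n IH] g h gh.
  by rewrite !hornerC gh.
rewrite !bernsteinS lerD// ler_wpM2l ?subr_ge0//; apply: IH => k kn; apply: gh => //.
exact: leqW.
Qed.

Lemma bernstein_lin n a b g h x :
  (bernstein n (fun k => a * g k + b * h k)).[x] =
  a * (bernstein n g).[x] + b * (bernstein n h).[x].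
Proof.
elim: n g h => [|n IH] g h; first by rewrite !hornerC.
by rewrite !bernsteinS !IH; ring.
Qed.

Lemma bernstein_cst n a x : (bernstein n (fun=> a)).[x] = a.
Proof.
by elim: n => [|n IH]; rewrite ?hornerC// bernsteinS IH; ring.
Qed.

Lemma bernstein_sq n a x :
  (bernstein n (fun k => (k%:R - a) ^+ 2)).[x] = n%:R * (x * (1 - x)) + (n%:R * x - a) ^+ 2.
Proof.
elim: n a => [|n IH] a; first by rewrite hornerC; ring.
rewrite bernsteinS IH.
have -> : (fun k : nat => (k.+1%:R - a) ^+ 2) = (fun k => (k%:R - (a - 1)) ^+ 2).
  by apply/funext => k; rewrite -natr1; ring.
by rewrite IH -natr1; ring.
Qed.

(** By uniform continuity [`|f x - f y| <= e / 2 + A * (x - y) ^+ 2], and the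
    Bernstein operator averages the second term down to order [n^-1]. *)
Theorem weierstrass f M (e : R) : Cb R R f -> 0 < e ->
  exists p : {poly R}, forall x, x \in `[- M, M] -> `|f x - p.[x]| <= e.
Proof.
move=> [cf [B0 [_ fB]]] e0.
pose B := `|B0| + 1.
have BB : B0 < B by rewrite ltr_pwDr// ler_norm.
have {}fB x : `|f x| <= B by exact: (fB B BB x I).
have B_ge0 : 0 <= B by rewrite addr_ge0.
have e2 : 0 < e / 2 by rewrite divr_gt0.
have [delta d0 fd] := uniform_modulus M cf e2.
have [M0|M0] := leP M 0.
  exists (f 0)%:P => x; rewrite in_itv/= hornerC => /andP[x1 x2].
  have x0 : x = 0 by lra.
  by rewrite x0 subrr normr0 ltW.
pose L := 2 * M; have L0 : 0 < L by rewrite mulr_gt0.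
pose A := 2 * B / delta ^+ 2.
have A0 : 0 <= A by apply: divr_ge0; [exact: mulr_ge0|exact: sqr_ge0].
have fA x y : x \in `[- M, M] -> `|f x - f y| <= e / 2 + A * (x - y) ^+ 2.
  move=> xM; have [xy|xy] := ltP `|x - y| delta.
    by rewrite (le_trans (fd x y xM xy))// lerDl mulr_ge0// sqr_ge0.
  have h1 : `|f x - f y| <= 2 * B.
    by rewrite (le_trans (ler_normB _ _))//; have := fB x; have := fB y; lra.
  apply: (le_trans h1); apply: (@le_trans _ _ (A * (x - y) ^+ 2)); last first.
    by rewrite lerDr ltW.
  rewrite /A -mulrA ler_peMr ?mulr_ge0// mulrC ler_pdivlMr ?exprn_gt0// mul1r.
  by rewrite -(real_normK (num_real (x - y))) lerXn2r ?nnegrE ?(ltW d0).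
pose n := (Num.truncn (A * L ^+ 2 / (e / 2))).+1.
have n0 : 0 < n%:R :> R by rewrite ltr0n.
have An : A * L ^+ 2 / n%:R <= e / 2.
  rewrite ler_pdivrMr// -ler_pdivrMl// mulrC ltW// /n.
  exact: truncnS_gt.
pose node (k : nat) : R := L * (k%:R / n%:R) - M.
pose g k := f (node k).
exists (bernstein n g \Po ((L^-1)%:P * ('X + M%:P))) => x xM.
rewrite horner_comp (_ : (_ * _).[x] = L^-1 * (x + M)); last by rewrite !hornerE.
set y := L^-1 * (x + M).
have xy : x = L * y - M by rewrite /y mulrA divff ?gt_eqF// mul1r addrK.
have y01 : 0 <= y <= 1.
  move: xM; rewrite in_itv/= => /andP[x1 x2].
  rewrite /y mulr_ge0 ?invr_ge0 ?(ltW L0)//=; last by lra.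
  by rewrite mulrC ler_pdivrMr// mul1r /L; lra.
pose E k := e / 2 * 1 + (A * (L / n%:R) ^+ 2) * (k%:R - n%:R * y) ^+ 2.
have EE : (bernstein n E).[y] <= e.
  rewrite bernstein_lin bernstein_cst bernstein_sq subrr expr0n/= addr0 mulr1.
  have -> : A * (L / n%:R) ^+ 2 * (n%:R * (y * (1 - y))) =
    A * L ^+ 2 / n%:R * (y * (1 - y)) by field; rewrite gt_eqF.
  have y1 : 0 <= y * (1 - y) <= 1.
    by case/andP: y01 => y0 y1; apply/andP; split; nra.
  have : A * L ^+ 2 / n%:R * (y * (1 - y)) <= e / 2.
    apply: le_trans An; rewrite ler_piMr//; last by case/andP: y1.
    by apply: divr_ge0 => //; apply: mulr_ge0 => //; exact: sqr_ge0.
  lra.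
have gE k : `|f x - g k| <= E k.
  have -> : E k = e / 2 + A * (x - node k) ^+ 2.
    rewrite /E xy /node mulr1; congr (_ + _); field; rewrite gt_eqF//.
  exact: fA.
rewrite ler_norml; apply/andP; split.
- rewrite lerBrDr addrC lerBlDr -lerBlDl.
  have -> : (bernstein n g).[y] - f x = (bernstein n (fun k => 1 * g k + (-1) * f x)).[y].
    by rewrite (bernstein_lin n 1 (-1) g (fun=> f x)) bernstein_cst; ring.
  apply: le_trans EE; apply: bernstein_le => // k _.
  by have := gE k; rewrite ler_norml => /andP[]; lra.
- have -> : f x - (bernstein n g).[y] = (bernstein n (fun k => (-1) * g k + 1 * f x)).[y].
    by rewrite (bernstein_lin n (-1) 1 g (fun=> f x)) bernstein_cst; ring.
  apply: le_trans EE; apply: bernstein_le => // k _.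
  by have := gE k; rewrite ler_norml => /andP[]; lra.
Qed.

End weierstrass.

(** * Empirical measures and compactly supported measures *)

Section empirical_measure.
Context d (T : measurableType d) (R : realType).
Implicit Types (s : seq T) (f : T -> R).

Lemma ge0_integral_empirical s f : measurable_fun [set: T] f ->
  (forall x, 0 <= f x) ->
  (\int[empirical R s]_x (f x)%:E)%E =
  ((size s)%:R^-1 * \sum_(a <- s) f a)%:E.
Proof.
move=> mf f0; have mEf : measurable_fun [set: T] (EFin \o f) by exact/measurable_EFinP.
rewrite /empirical ge0_integral_mscale//; last by move=> x _; rewrite lee_fin.
rewrite EFinM; congr (_ * _)%E.
rewrite ge0_integral_measure_sum//; last by move=> x _; rewrite lee_fin.
rewrite (big_nth point) big_mkord -sumEFin; apply: eq_bigr => i _.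
by rewrite integral_dirac// diracT mul1e.
Qed.

Lemma Rintegral_empirical s f : measurable_fun [set: T] f ->
  (\int[empirical R s]_x f x)%R = (size s)%:R^-1 * \sum_(a <- s) f a.
Proof.
move=> mf; rewrite /Rintegral integralE.
have mp : measurable_fun [set: T] (f ^\+)%R by exact: measurable_funrpos.
have mn : measurable_fun [set: T] (f ^\-)%R by exact: measurable_funrneg.
have -> : (fun x => (f x)%:E)^\+%E = (fun x => ((f ^\+)%R x)%:E) := funerpos f.
have -> : (fun x => (f x)%:E)^\-%E = (fun x => ((f ^\-)%R x)%:E) := funerneg f.
rewrite (ge0_integral_empirical _ mp) ?(ge0_integral_empirical _ mn) => [|x|x].
- rewrite -EFinB/= -mulrBr -sumrB; congr (_ * _); apply: eq_bigr => a _.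
  by rewrite -[RHS](congr1 (@^~ a) (funrposBneg f)).
- exact: funrneg_ge0.
- exact: funrpos_ge0.
Qed.

Lemma empirical_setT s : s != [::] -> empirical R s [set: T] = 1%E.
Proof.
move=> s0.
have E1 : (\int[empirical R s]_x (cst 1%E) x)%E = ((size s)%:R^-1 * \sum_(a <- s) 1)%:E.
  apply: (@ge0_integral_empirical s (cst 1)) => //.
rewrite integral_cst// mul1e in E1; rewrite E1.
rewrite big_const_seq count_predT iter_addr addr0 -[_ *+ _]mulr_natl mulr1.
by rewrite mulVf// pnatr_eq0 size_eq0.
Qed.

End empirical_measure.

Section compact_support.
Context (R : realType) (mu : probability R R).
Implicit Types (f g : R -> R).

(** The complement of the support is null, being covered by the countably many
    null intervals with rational endpoints. *)
Lemma msupport_null (A : set R) : measurable A -> msupport mu `<=` A ->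
  mu (~` A) = 0%E.
Proof.
move=> mA sA; apply: (measure_negligible (measurableC mA)).
pose F (n : nat) : set R := if (choice.unpickle n : option (rat * rat)) is Some q then
  let J : set R := `]ratr q.1, ratr q.2[%classic in
  if mu J == 0%E then J else set0 else set0.
have nF n : mu.-negligible (F n).
  rewrite /F; case: choice.unpickle => [q|]; last exact: negligible_set0.
  by case: eqP => [h|_]; [exists `]ratr q.1, ratr q.2[%classic; split|exact: negligible_set0].
apply: negligibleS (negligible_bigcup nF) => x Ax.
have : ~ msupport mu x by move=> /sA.
move=> /existsNP[U /not_implyP[oU /not_implyP[Ux]]].
move=> /negP; rewrite -leNgt => U0.
have /nbhs_ballP[/= r r0 rU] := open_nbhs_nbhs (conj oU Ux).
have [q1 q1x] : exists q1 : rat, ratr q1 \in `]x - r, x[.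
  by apply: rat_in_itvoo; rewrite ltrBlDr ltrDl.
have [q2 q2x] : exists q2 : rat, ratr q2 \in `]x, x + r[.
  by apply: rat_in_itvoo; rewrite ltrDl.
move: q1x q2x; rewrite !in_itv/= => /andP[a1 a2] /andP[b1 b2].
exists (choice.pickle (q1, q2)); first exact: I.
rewrite /F choice.pickleK.
have -> : mu `]ratr q1, ratr q2[%classic == 0%E.
  rewrite -measure_le0; apply: le_trans U0; apply: le_measure; rewrite ?inE//.
    exact: open_measurable.
  move=> y /=; rewrite in_itv/= => /andP[c1 c2]; apply: rU.
  by rewrite /ball/= ltr_norml; apply/andP; split; lra.
by rewrite /= in_itv/= a2 b1.
Qed.

Variable K : R.
Hypothesis mu_supp : msupport mu `<=` `[- K, K].

Let Itv : set R := `[- K, K].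

Let mItv : measurable Itv. Proof. exact: measurable_itv. Qed.

Let muItv : mu (~` Itv) = 0%E.
Proof. by apply: msupport_null => // x /mu_supp. Qed.

Lemma ae_bounded_integrable f B : measurable_fun [set: R] f ->
  (forall x, x \in `[- K, K] -> `|f x| <= B) ->
  mu.-integrable [set: R] (EFin \o f).
Proof.
move=> mf fB; have mEf : measurable_fun [set: R] (EFin \o f) by exact/measurable_EFinP.
apply/integrableP; split => //.
have -> : (\int[mu]_x `|(EFin \o f) x| = \int[mu]_(x in Itv) `|(EFin \o f) x|)%E.
  rewrite -(setUv Itv) ge0_integral_setU//.
  - rewrite [X in (_ + X)%E](_ : _ = 0%E) ?adde0//.
    apply: null_set_integral => //; first exact: measurableC.
    by apply: measurableT_comp => //; exact: measurable_funTS.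
  - exact: measurableC.
  - by rewrite setUv; apply: measurableT_comp.
  - by apply/disj_set2P; rewrite setICr.
have /integrableP[_] // : mu.-integrable Itv (EFin \o f).
apply: measurable_bounded_integrable => //.
- by rewrite -ge0_fin_numE// fin_num_measure.
- exact: measurable_funTS.
- exists B; split; first exact: num_real.
  by move=> y By x xI; apply: le_trans (fB x xI) (ltW By).
Qed.

Lemma ae_Rintegral_bound f B : measurable_fun [set: R] f ->
  (forall x, x \in `[- K, K] -> `|f x| <= B) -> 0 <= B ->
  `|(\int[mu]_x f x)%R| <= B.
Proof.
move=> mf fB B0; have iF := ae_bounded_integrable mf fB.
have -> : (\int[mu]_x f x)%R = (\int[mu]_(x in Itv) f x)%R.
  rewrite /Rintegral (@negligible_integral _ _ _ mu setT (~` Itv))//.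
    by rewrite setTD setCK.
  exact: measurableC.
have iI : mu.-integrable Itv (EFin \o f).
  exact: (@integrableS _ _ _ mu setT Itv).
apply: (le_trans (le_normr_Rintegral mItv iI)).
apply: (@le_trans _ _ (\int[mu]_(x in Itv) (cst B x))%R); last first.
  rewrite Rintegral_cst// ler_piMr//.
  by rewrite -[leRHS]/(fine 1%E) fine_le ?fin_num_measure// probability_le1.
have iB : mu.-integrable Itv (EFin \o cst B).
  apply: (@integrableS _ _ _ mu setT Itv) => //.
  exact: (finite_measure_integrable_cst mu B measurableT).
have iN : mu.-integrable Itv (EFin \o (fun x => `|f x|)).
  have := iI => /integrable_abse; exact: eq_integrable.
by apply: le_Rintegral => // x xI; exact: fB.
Qed.

Lemma horner_bound (p : {poly R}) : exists B, forall x, x \in `[- K, K] -> `|p.[x]| <= B.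
Proof.
exists (\sum_(i < size p) `|p`_i| * `|K| ^+ i) => x; rewrite in_itv/= => /andP[x1 x2].
rewrite horner_coef; apply: (le_trans (ler_norm_sum _ _ _)); apply: ler_sum => i _.
rewrite normrM ler_wpM2l// normrX lerXn2r ?nnegrE//.
by rewrite ler_norml; have := ler_norm K; move=> ?; apply/andP; split; lra.
Qed.

Lemma measurable_horner (p : {poly R}) : measurable_fun [set: R] (horner p).
Proof.
have -> : horner p = (fun x => \sum_(i < size p) p`_i * x ^+ i).
  by apply/funext => x; rewrite horner_coef.
apply: measurable_sum => i; apply: measurable_funM => //; exact: measurable_funX.
Qed.

Lemma horner_integrable (p : {poly R}) : mu.-integrable [set: R] (EFin \o horner p).
Proof.
have [B pB] := horner_bound p.
exact: ae_bounded_integrable (measurable_horner p) pB.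
Qed.

Lemma Rintegral_horner (p : {poly R}) :
  (\int[mu]_x p.[x])%R = \sum_(i < size p) p`_i * (\int[mu]_x (x ^+ i))%R.
Proof.
have iX i : mu.-integrable [set: R] (EFin \o (fun x : R => x ^+ i)).
  by apply: eq_integrable (horner_integrable 'X^i) => // x _; rewrite /= hornerXn.
have [q qE] : exists q : nat -> R, q = (fun i => p`_i) by exists (fun i => p`_i).
have -> : (fun x => p.[x]) = (fun x => \sum_(i < size p) q i * x ^+ i).
  by apply/funext => x; rewrite horner_coef qE.
have -> : \sum_(i < size p) p`_i * (\int[mu]_x (x ^+ i))%R =
  \sum_(i < size p) q i * (\int[mu]_x (x ^+ i))%R by rewrite qE.
elim: (size p) => [|n IH].
  rewrite big_ord0; under eq_Rintegral do rewrite big_ord0.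
  by rewrite /Rintegral integral0.
rewrite big_ord_recr/= -IH; under eq_Rintegral do rewrite big_ord_recr/=.
have iq i : mu.-integrable [set: R] (EFin \o (fun x : R => q i * x ^+ i)).
  have := integrableZl measurableT (q i) (iX i).
  by apply: eq_integrable => // x _; rewrite /= EFinM.
rewrite RintegralD// ?RintegralZl//.
elim: n {IH} => [|n IH].
  under eq_fun do rewrite /= big_ord0; exact: integrable0.
have := integrableD measurableT IH (iq n).
by apply: eq_integrable => // x _; rewrite /= big_ord_recr/= EFinD.
Qed.

Lemma Rintegral_approx f (p : {poly R}) e : Cb R R f -> 0 <= e ->
  (forall x, x \in `[- K, K] -> `|f x - p.[x]| <= e) ->
  `|(\int[mu]_x f x)%R - (\int[mu]_x p.[x])%R| <= e.
Proof.
move=> [cf [B0 [_ fB]]] e0 fp.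
have mf : measurable_fun [set: R] f by exact: continuous_measurable_fun.
have iF : mu.-integrable [set: R] (EFin \o f).
  apply: (@ae_bounded_integrable f (`|B0| + 1)) => // x _.
  by apply: (fB (`|B0| + 1)) => //; rewrite ltr_pwDr// ler_norm.
rewrite -RintegralB//; last exact: horner_integrable.
apply: ae_Rintegral_bound => //.
by apply: measurable_funB => //; exact: measurable_horner.
Qed.

End compact_support.

(** * From moments to weak convergence *)

Section method_of_moments.
Context (R : realType).
Implicit Types (f : R -> R) (p : {poly R}).

Lemma Rintegral_horner_cvg (mus : nat -> probability R R) (mu : probability R R) (K : R) p :
  (forall k, msupport (mus k) `<=` `[- K, K]) -> msupport mu `<=` `[- K, K] ->
  (forall i, (\int[mus k]_x (x ^+ i))%R @[k --> \oo] --> (\int[mu]_x (x ^+ i))%R) ->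
  (\int[mus k]_x p.[x])%R @[k --> \oo] --> (\int[mu]_x p.[x])%R.
Proof.
move=> sk s mom; rewrite (Rintegral_horner s).
under eq_fun do rewrite (Rintegral_horner (sk _)).
apply: cvg_big => [|i _]; first exact: add_continuous.
by apply: cvgM; [exact: cvg_cst|exact: mom].
Qed.

Lemma weak_cvg_of_moments (mus : nat -> probability R R) (mu : probability R R) K :
  (forall k, msupport (mus k) `<=` `[- K, K]) -> msupport mu `<=` `[- K, K] ->
  (forall i, (\int[mus k]_x (x ^+ i))%R @[k --> \oo] --> (\int[mu]_x (x ^+ i))%R) ->
  weak_cvg (T := R) (Cb R R) mus mu.
Proof.
move=> sk s mom f Cf; apply/cvgrPdist_le => /= e e0.
have e3 : 0 < e / 3 by rewrite divr_gt0.
have [p fp] := weierstrass K Cf e3.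
have /cvgrPdist_le /(_ _ e3) := @Rintegral_horner_cvg mus mu K p sk s mom.
apply: filterS => k.
have := Rintegral_approx s Cf (ltW e3) fp.
have := Rintegral_approx (sk k) Cf (ltW e3) fp.
rewrite !ler_norml => /andP[a1 a2] /andP[b1 b2] /andP[c1 c2].
by apply/andP; split; lra.
Qed.

(** Take [p] close to [f] on a segment of half-length [K1 > `|K|].  Outside of it
    [f - p] is at most a multiple of [x ^+ (2 * q)], hence of
    [x ^+ (2 * q) * (x / K1) ^+ (2 * r)] for every [r], and the integral of the
    latter against a measure carried by [- K, K] tends to 0 when [r] grows. *)
Lemma polynomial_majorant (mu : probability R R) K f eta : Cb R R f -> 0 < eta ->
  msupport mu `<=` `[- K, K] -> exists p h : {poly R},
  [/\ forall x, `|f x - p.[x]| <= eta + h.[x], forall x, 0 <= h.[x],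
      `|(\int[mu]_x h.[x])%R| <= eta &
      `|(\int[mu]_x f x)%R - (\int[mu]_x p.[x])%R| <= eta].
Proof.
move=> Cf eta0 sK; pose K1 := `|K| + 1.
have K10 : 0 < K1 by rewrite ltr_pwDr.
have K11 : 1 <= K1 by rewrite lerDr.
have [p fp] := weierstrass K1 Cf eta0.
have [_ [B0 [_ fB]]] := Cf.
pose B := `|B0| + 1.
have BB : B0 < B by rewrite ltr_pwDr// ler_norm.
have {}fB x : `|f x| <= B by exact: (fB B BB x I).
pose q := size p.
pose A := B + \sum_(i < size p) `|p`_i|.
have A0 : 0 <= A by rewrite addr_ge0 ?sumr_ge0// addr_ge0.
pose rho := (`|K| / K1) ^+ 2.
have rho0 : 0 <= rho by rewrite sqr_ge0.
have rho1 : `|rho| < 1.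
  rewrite ger0_norm// expr_lt1// ?divr_ge0// ?ltW//.
  by rewrite ltr_pdivrMr// mul1r /K1 ltrDl.
have [r Hr] : exists r, A * (`|K| ^+ 2) ^+ q * rho ^+ r <= eta.
  have : A * (`|K| ^+ 2) ^+ q * rho ^+ r @[r --> \oo] --> A * (`|K| ^+ 2) ^+ q * 0.
    by apply: cvgM; [exact: cvg_cst|exact: cvg_expr].
  rewrite mulr0 => /cvgrPdist_le /(_ _ eta0) /filter_ex[r]; rewrite sub0r normrN => h.
  by exists r; exact: le_trans (ler_norm _) h.
pose c := A / (K1 ^+ 2) ^+ r.
have c0 : 0 <= c by rewrite divr_ge0// exprn_ge0// sqr_ge0.
pose h := c *: 'X^(2 * (q + r)).
have hE x : h.[x] = c * (x ^+ 2) ^+ (q + r) by rewrite hornerZ hornerXn exprM.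
have h0 x : 0 <= h.[x] by rewrite hE mulr_ge0// exprn_ge0// sqr_ge0.
exists p, h; split => //.
- move=> x; have [xK|xK] := boolP (x \in `[- K1, K1]).
    by rewrite (le_trans (fp x xK))// lerDl.
  have xK1 : K1 <= `|x|.
    move: xK; rewrite in_itv/= -ler_norml -ltNge; exact: ltW.
  have x1 : 1 <= `|x| by exact: le_trans xK1.
  have h1 : `|f x - p.[x]| <= A * (x ^+ 2) ^+ q.
    rewrite (le_trans (ler_normB _ _))// /A mulrDl lerD//.
      rewrite (le_trans (fB x))// ler_peMr ?addr_ge0//.
      by rewrite exprn_ege1// -real_normK ?num_real// exprn_ege1.
    rewrite horner_coef mulr_suml (le_trans (ler_norm_sum _ _ _))//.
    apply: ler_sum => i _; rewrite normrM ler_wpM2l// normrX.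
    rewrite -real_normK ?num_real// -exprM ler_weXn2l//.
    by rewrite mul2n -addnn (leq_trans (ltnW (ltn_ord i)))// leq_addr.
  apply: (le_trans h1); rewrite hE exprD /c.
  apply: (@le_trans _ _ (A / (K1 ^+ 2) ^+ r * ((x ^+ 2) ^+ q * (x ^+ 2) ^+ r))); last first.
    by rewrite lerDr ltW.
  have -> : A / (K1 ^+ 2) ^+ r * ((x ^+ 2) ^+ q * (x ^+ 2) ^+ r) =
    A * (x ^+ 2) ^+ q * ((x ^+ 2) ^+ r / (K1 ^+ 2) ^+ r) by ring.
  rewrite ler_peMr//; first by rewrite mulr_ge0// exprn_ge0// sqr_ge0.
  rewrite ler_pdivlMr ?mul1r ?exprn_gt0//.
  rewrite -[x ^+ 2]real_normK ?num_real//.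
  by rewrite lerXn2r ?nnegrE ?sqr_ge0// lerXn2r ?nnegrE// ltW.
- apply: (ae_Rintegral_bound sK); [exact: measurable_horner| |exact: ltW].
  move=> x; rewrite in_itv/= => /andP[x1' x2'].
  have xK : x ^+ 2 <= `|K| ^+ 2.
    rewrite -real_normK ?num_real// lerXn2r ?nnegrE//.
    by rewrite ler_norml; have := ler_norm K; move=> ?; apply/andP; split; lra.
  rewrite ger0_norm// hE; apply: le_trans Hr.
  have -> : A * (`|K| ^+ 2) ^+ q * rho ^+ r = c * (`|K| ^+ 2) ^+ (q + r).
    rewrite /rho /c exprD expr_div_n expr_div_n; ring.
  by rewrite ler_wpM2l// lerXn2r ?nnegrE ?sqr_ge0.
- apply: (Rintegral_approx sK Cf (ltW eta0)) => x xK; apply: fp.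
  move: xK; rewrite !in_itv/= => /andP[x1 x2].
  by have := ler_norm K; rewrite /K1 => ?; apply/andP; split; lra.
Qed.

Context disp (Omega : measurableType disp) (P : probability Omega R).

(** Markov's inequality. *)
Lemma markov_Ex (W : Omega -> R) a : 0 < a -> has_moments P W ->
  (P [set w | (a <= `|W w|)%R] <= (a^-1 * Ex P (fun w => `|W w|))%:E)%E.
Proof.
move=> a0 hW; have [mW _] := hW.
have := @le_integral_abse _ _ _ P setT measurableT (EFin \o W) a.
move=> /(_ _ a0); rewrite setTI => H.
have E : (\int[P]_w `|(EFin \o W) w|)%E = (Ex P (fun w => `|W w|))%:E.
  by rewrite fineK//; apply: integrable_fin_num => //;
    exact: has_moments_integrable (has_moments_norm hW).
have {}H : (a%:E * P [set w | (a <= `|W w|)%R] <= (Ex P (fun w => `|W w|))%:E)%E.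
  by rewrite -E; apply: H; exact/measurable_EFinP.
by rewrite EFinM lee_pdivlMl.
Qed.

Variable n : nat -> nat.
Hypothesis n0 : forall k, (0 < n k)%N.
Variable A : forall k, Omega -> 'M[R]_(n k).
Hypothesis A_sym : forall k w, (A k w)^T = A k w.
Hypothesis A_trace : forall k m, has_moments P (fun w => \tr (A k w ^+ m)).
Variables (mu : probability R R) (K : R).
Hypothesis mu_supp : msupport mu `<=` `[- K, K].
Hypothesis A_cvg : forall m,
  Ex P (fun w => `|(n k)%:R^-1 * \tr (A k w ^+ m) - (\int[mu]_x (x ^+ m))%R|)
    @[k --> \oo] --> (0 : R).

Let S k f w : R := (n k)%:R^-1 * \sum_(a <- eigenvalues (A k w)) f a.

Let size_eig k w : size (eigenvalues (A k w)) = n k.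
Proof. by apply: size_spectrum; exact: eigenvaluesP. Qed.

Let nV_ge0 k : 0 <= (n k)%:R^-1 :> R. Proof. by rewrite invr_ge0. Qed.

Let S_cst k (r : R) w : S k (fun=> r) w = r.
Proof.
rewrite /S big_const_seq count_predT iter_addr addr0 size_eig -[r *+ _]mulr_natl.
by rewrite mulrA mulVf ?mul1r// pnatr_eq0 -lt0n.
Qed.

Let S_horner k p w : S k (horner p) w =
  \sum_(i < size p) p`_i * ((n k)%:R^-1 * \tr (A k w ^+ i)).
Proof.
rewrite /S (trace_horner p (A_sym k w) (eigenvaluesP (A_sym k w))) mulr_sumr.
by apply: eq_bigr => i _; rewrite mulrCA.
Qed.

Let S_horner_moments k p : has_moments P (S k (horner p)).
Proof.
have -> : S k (horner p) =
    (fun w => \sum_(i < size p) p`_i * ((n k)%:R^-1 * \tr (A k w ^+ i))).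
  by apply/funext => w; rewrite S_horner.
by apply: has_moments_sum => i; do 2!apply: has_momentsZ.
Qed.

Let S_dist k f g (e : R) w :
  (forall x, x \in eigenvalues (A k w) -> `|f x - g x| <= e) ->
  `|S k f w - S k g w| <= e.
Proof.
move=> fg; rewrite -mulrBr -sumrB normrM ger0_norm//.
apply: (@le_trans _ _ ((n k)%:R^-1 * \sum_(a <- eigenvalues (A k w)) e)); last first.
  by rewrite -/(S k (fun=> e) w) S_cst.
rewrite ler_wpM2l// (le_trans (ler_norm_sum _ _ _))// big_seq [leRHS]big_seq.
by apply: ler_sum => a; exact: fg.
Qed.

(** Linear statistics of the eigenvalues are pointwise limits of traces of
    polynomials of the matrix. *)
Let S_measurable k f : Cb R R f -> measurable_fun [set: Omega] (S k f).
Proof.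
move=> Cf.
have ej (j : nat) : 0 < j.+1%:R^-1 :> R by rewrite invr_gt0.
pose p j := projT1 (cid (weierstrass j%:R Cf (ej j))).
have pE j x : x \in `[- j%:R, j%:R] -> `|f x - (p j).[x]| <= j.+1%:R^-1.
  by rewrite /p; case: cid => q /= + xj; exact.
apply: (@measurable_fun_cvg _ _ _ setT (fun j => S k (horner (p j)))).
  by move=> j; case: (S_horner_moments k (p j)).
move=> w _; apply/cvgrPdist_le => e e0.
pose M : R := \sum_(a <- eigenvalues (A k w)) `|a|.
near=> j; apply: (@le_trans _ _ j.+1%:R^-1).
  apply: S_dist => x xe; apply: pE; rewrite in_itv/= -ler_norml.
  apply: (@le_trans _ _ M).
    by rewrite /M (big_rem x)//= lerDl sumr_ge0.
  by near: j; exact: nbhs_infty_ger.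
by apply: ltW; near: j; exact: (near_infty_natSinv_lt (PosNum e0)).
Unshelve. all: by end_near. Qed.

Let S_horner_cvg p :
  Ex P (fun w => `|S k (horner p) w - (\int[mu]_x p.[x])%R|) @[k --> \oo] --> (0 : R).
Proof.
pose T k i w := (n k)%:R^-1 * \tr (A k w ^+ i) - (\int[mu]_x (x ^+ i))%R.
have hT k i : has_moments P (T k i).
  by apply: has_momentsB; [exact: has_momentsZ|exact: has_moments_cst].
apply: (@squeeze_cvgr _ _ _ _ (fun=> 0)
  (fun k => \sum_(i < size p) `|p`_i| * Ex P (fun w => `|T k i w|))).
- near=> k; apply/andP; split; first by apply: Ex_ge0.
  have hN i : has_moments P (fun w => `|p`_i| * `|T k i w|).
    by apply: has_momentsZ; exact: has_moments_norm.
  have -> : \sum_(i < size p) `|p`_i| * Ex P (fun w => `|T k i w|) =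
      \sum_(i < size p) Ex P (fun w => `|p`_i| * `|T k i w|).
    by apply: eq_bigr => i _; rewrite ExZ//; exact: has_moments_norm.
  rewrite -Ex_sum//; apply: le_Ex.
  + apply: has_moments_norm; apply: has_momentsB; first exact: S_horner_moments.
    exact: has_moments_cst.
  + exact: has_moments_sum.
  + move=> w; rewrite S_horner (Rintegral_horner mu_supp) -sumrB.
    rewrite (le_trans (ler_norm_sum _ _ _))//; apply: ler_sum => i _.
    by rewrite -mulrBr normrM.
- exact: cvg_cst.
- rewrite [X in _ --> X](_ : 0 = \sum_(i < size p) `|p`_i| * 0); last first.
    by rewrite big1// => i _; rewrite mulr0.
  apply: cvg_big => [|i _]; first exact: add_continuous.
  by apply: cvgM; [exact: cvg_cst|exact: A_cvg].
Unshelve. all: by end_near. Qed.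

(** Linear statistics of polynomials converge in mean by assumption.  For a
    general [f], [polynomial_majorant] bounds the error made outside a segment by
    the linear statistic of a polynomial with small limit, so that eigenvalues
    outside the support need no separate control. *)
Lemma spectral_cvg f : Cb R R f ->
  cvg_in_probability P
    (fun k w => (\int[empirical R (eigenvalues (A k w))]_x f x)%R) (\int[mu]_x f x)%R.
Proof.
move=> Cf e e0.
have mf : measurable_fun [set: R] f.
  by apply: continuous_measurable_fun; case: Cf.
have E k w : (\int[empirical R (eigenvalues (A k w))]_x f x)%R = S k f w.
  by rewrite Rintegral_empirical// size_eig.
under eq_fun do under eq_set do rewrite E.
pose eta := e / 6; have eta0 : 0 < eta by rewrite divr_gt0.
have [p [h [fp h0 muh mup]]] := polynomial_majorant Cf eta0 mu_supp.
pose Wp k w := `|S k (horner p) w - (\int[mu]_x p.[x])%R|.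
pose Wh k w := `|S k (horner h) w - (\int[mu]_x h.[x])%R|.
have hWp k : has_moments P (Wp k).
  apply: has_moments_norm; apply: has_momentsB; first exact: S_horner_moments.
  exact: has_moments_cst.
have hWh k : has_moments P (Wh k).
  apply: has_moments_norm; apply: has_momentsB; first exact: S_horner_moments.
  exact: has_moments_cst.
pose W k w := Wp k w + Wh k w.
have hW k : has_moments P (W k) by exact: has_momentsD.
have dist k w : `|S k f w - (\int[mu]_x f x)%R| <= 3 * eta + W k w.
  have h1 : `|S k f w - S k (horner p) w| <= eta + S k (horner h) w.
    rewrite -mulrBr -sumrB normrM ger0_norm// -[X in X + _](S_cst k eta w).
    rewrite -mulrDr -big_split/= ler_wpM2l// (le_trans (ler_norm_sum _ _ _))//.
    by apply: ler_sum => a _; exact: fp.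
  have h2 : S k (horner h) w <= Wh k w + eta.
    have := ler_norm (S k (horner h) w - (\int[mu]_x h.[x])%R).
    have := ler_norm (\int[mu]_x h.[x])%R; rewrite /Wh; lra.
  have h3 := ler_norm (S k (horner p) w - (\int[mu]_x p.[x])%R).
  have h4 := ler_norm (- (S k (horner p) w - (\int[mu]_x p.[x])%R)).
  rewrite normrN in h4.
  move: h1 mup; rewrite /W /Wp !ler_norml => /andP[a1 a2] /andP[b1 b2].
  by apply/andP; split; lra.
have PW k : (P [set w | (e <= `|S k f w - (\int[mu]_x f x)|)%R] <=
    ((3 * eta)^-1 * (Ex P (Wp k) + Ex P (Wh k)))%:E)%E.
  have eta3 : 0 < 3 * eta by rewrite mulr_gt0.
  have := markov_Ex eta3 (hW k).
  rewrite (_ : Ex P (fun w => `|W k w|) = Ex P (Wp k) + Ex P (Wh k)); last first.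
    rewrite -ExD//; congr (Ex P); apply/funext => w.
    by rewrite ger0_norm// /W addr_ge0 ?normr_ge0.
  apply: le_trans; apply: le_measure; rewrite ?inE.
  - rewrite -[X in measurable X]setTI.
    have : measurable_fun [set: Omega] (fun w => `|S k f w - (\int[mu]_x f x)%R|).
      by apply: measurableT_comp => //; apply: measurable_funB => //; exact: S_measurable.
    move=> /(_ measurableT `[e, +oo[%classic (measurable_itv _)).
    rewrite (_ : _ @^-1` _ = [set w | (e <= `|S k f w - (\int[mu]_x f x)|)%R])//.
    by apply/seteqP; split => w /=; rewrite in_itv/= andbT.
  - rewrite -[X in measurable X]setTI.
    have : measurable_fun [set: Omega] (fun w => `|W k w|).
      by case: (has_moments_norm (hW k)).
    move=> /(_ measurableT `[3 * eta, +oo[%classic (measurable_itv _)).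
    rewrite (_ : _ @^-1` _ = [set w | (3 * eta <= `|W k w|)%R])//.
    by apply/seteqP; split => w /=; rewrite in_itv/= andbT.
  - move=> w /= ew; have := dist k w; have := ler_norm (W k w).
    move: ew; rewrite (_ : e = 6 * eta); last by rewrite /eta; field.
    lra.
have cW : ((3 * eta)^-1 * (Ex P (Wp k) + Ex P (Wh k)))%:E @[k --> \oo] --> 0%E.
  apply: cvg_EFin; first by near=> k.
  have : (3 * eta)^-1 * (Ex P (Wp k) + Ex P (Wh k)) @[k --> \oo] -->
      (3 * eta)^-1 * (0 + 0).
    apply: cvgM; first exact: cvg_cst.
    by apply: cvgD; exact: S_horner_cvg.
  by rewrite addr0 mulr0.
apply: (squeeze_cvge _ (cvg_cst 0%E) cW).
by near=> k; rewrite measure_ge0 PW.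
Unshelve. all: by end_near. Qed.

End method_of_moments.

(** * The band matrix model *)

Lemma sum_letters (R : realType) (L : choiceType) (C : completePseudoMetricType R)
    (kappa : L -> C) (N : {fset L}) (g : C -> R) :
  \sum_(c <- [seq kappa a | a <- enum_fset N]) g c =
  \sum_(b < #|` N|) g (kappa (letter b)).
Proof. by rewrite big_map big_tnth. Qed.

Lemma mk_upair_ex (L : choiceType) (e : upair L) : exists a b, e = mk_upair a b.
Proof.
case: e => A /= hA; have [A0 A2] := andP hA.
have /fset0Pn[a aA] : A != fset0 by rewrite -cardfs_gt0.
have A1 : (#|` (A `\ a)%fset| <= 1)%N by move: A2; rewrite (cardfsD1 a A) aA.
have [/eqP A_0|/fset0Pn[b bA]] := boolP ((A `\ a)%fset == fset0).
  exists a, a; apply: val_inj => /=; apply/fsetP => x; rewrite !inE orbb.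
  apply/idP/eqP => [xA|->//]; apply/eqP; apply: contraT => xa.
  have : x \in (A `\ a)%fset by rewrite !inE xa.
  by rewrite A_0 inE.
exists a, b; apply: val_inj => /=; apply/fsetP => x; rewrite !inE.
apply/idP/orP => [xA|[/eqP ->//|/eqP ->]]; last by move: bA; rewrite inE => /andP[].
have [->|xa] := eqVneq x a; [by left|right].
have : x \in (A `\ a)%fset by rewrite !inE xa.
have -> : (A `\ a)%fset = [fset b]%fset.
  apply/eqP; rewrite eq_sym eqEfcard fsub1set bA cardfs1 A1//.
by rewrite inE.
Qed.

Lemma bounded_norm_le (R : realType) (T : Type) (f : T -> R) :
  [bounded f x | x in [set: T]] -> exists2 B, 0 <= B & forall x, `|f x| <= B.
Proof.
move=> [B0 [_ fB]]; exists (`|B0| + 1); first by rewrite addr_ge0.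
have BB : B0 < `|B0| + 1 by rewrite ltr_pwDr// ler_norm.
by move=> x; exact: (fB _ BB x I).
Qed.

Lemma mean_theta (R : realType) (L : choiceType) (C : completePseudoMetricType R)
    (kappa : L -> C) (N : {fset L}) (u : C -> R) :
  measurable_fun [set: borel C] (u : borel C -> R) ->
  (\int[theta_ R kappa N]_(c in [set: borel C]) u c)%R =
  mean (fun b : 'I_#|` N| => u (kappa (letter b))).
Proof.
move=> mu; rewrite Rintegral_empirical// size_map /mean.
by rewrite -(sum_letters kappa N u).
Qed.

Theorem theorem3p2 (R : realType)
  (C : completePseudoMetricType R)
  (C_hausdorff : hausdorff_space C) (C_separable : separable C)
  (theta : probability (borel C) R)
  (D : C -> R)
  (D_meas : measurable_fun [set: borel C] (D : borel C -> R))
  (D_bound : [bounded D c | c in [set: C]])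
  (d : nat -> C -> R)
  (d_meas : forall k, (0 < k)%N ->
    measurable_fun [set: borel C] (d k : borel C -> R))
  (d_bound : forall k, (0 < k)%N -> [bounded d k c | c in [set: C]])
  (d_ge0 : forall k c, (0 < k)%N -> 0 <= d k c)
  (s : nat -> C * C -> R)
  (s_meas : forall k, (0 < k)%N ->
    measurable_fun [set: borel C * borel C] (s k : borel C * borel C -> R))
  (s_bound : forall k, (0 < k)%N -> [bounded s k cc | cc in [set: C * C]])
  (s_ge0 : forall k cc, (0 < k)%N -> 0 <= s k cc)
  (s_sym : forall k c c', (0 < k)%N -> s k (c, c') = s k (c', c))
  (d_const : forall k, (0 < k)%N -> k <> 2%N ->
    exists r : R, forall c, d k c = r)
  (s_const : forall k, (0 < k)%N -> k <> 2%N -> k <> 4%N ->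
    exists r : R, forall cc, s k cc = r)
  (s_cont : forall k, (0 < k)%N ->
    (theta \x theta)%E.-negligible (discontinuity_set (s k)))
  (D_cont : theta.-negligible (discontinuity_set D))
  (d_cont : forall k, (0 < k)%N -> theta.-negligible (discontinuity_set (d k)))
  (s_diag_cont : forall k, (0 < k)%N ->
    theta.-negligible (discontinuity_set (fun c => s k (c, c))))
  (L : countType) (L_infinite : infinite_set [set: L]) (kappa : L -> C)
  (disp : measure_display) (Omega : measurableType disp)
  (P : probability Omega R)
  (xi : upair L -> {RV P >-> R})
  (xi_indep : mutually_independent P xi)
  (xi_mean0 : forall e, ('E_P[xi e] = 0)%E)
  (xi_offdiag : forall (a b : L) k, (0 < k)%N -> a <> b ->
    ('E_P[fun w => (`|xi (mk_upair a b) w| ^+ k)%R] <= (s k (kappa a, kappa b))%:E)%E)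
  (xi_diag : forall (a : L) k, (0 < k)%N ->
    ('E_P[fun w => (`|xi (mk_upair a a) w| ^+ k)%R] <= (d k (kappa a))%:E)%E)
  (xi_offdiag_eq : forall (a b : L) k, k = 2%N \/ k = 4%N -> a <> b ->
    ('E_P[fun w => (`|xi (mk_upair a b) w| ^+ k)%R] = (s k (kappa a, kappa b))%:E)%E)
  (xi_diag_eq : forall a : L,
    ('E_P[fun w => (`|xi (mk_upair a a) w| ^+ 2)%R] = (d 2%N (kappa a))%:E)%E)
  (N : nat -> {fset L}) (N_neq0 : forall k, N k != fset0)
  (N_infty : #|` N k| @[k --> \oo] --> \oo)
  (N_theta : weak_cvg (T := borel C) (Cb R C)
    (fun k => theta_ R kappa (N k)) theta)
  (mu : probability R R) (mu_theta : is_mu D (s 2%N) theta mu)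
  (muN : nat -> probability R R)
  (mu_thetaN : forall k, is_mu D (s 2%N) (theta_ R kappa (N k)) (muN k)) :
  (forall f : R -> R, Cb R R f ->
     cvg_in_probability P
       (fun k w =>
          (\int[empirical R
             (eigenvalues (band_matrix kappa D (xi ^~ w) (N k)))]_x f x)%R)
       (\int[mu]_x f x)%R) /\
  weak_cvg (T := R) (Cb R R) muN mu.
Proof.
have C2 : (0 < 2)%N by [].
have [bD bD0 bDE] := bounded_norm_le D_bound.
have [bs bs0 bsE] := bounded_norm_le (s_bound 2%N C2).
have Ex_E Z : fine 'E_P[Z] = Ex P Z by rewrite unlock.
have abs_bound k : exists c : R, 0 <= c /\
    forall e, ('E_P[fun w => (`|xi e w| ^+ k)%R] <= c%:E)%E.
  case: k => [|k].
    exists 1; split => // e; rewrite (_ : (fun w => _) = cst 1).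
      by rewrite expectation_cst.
    by apply/funext => w; rewrite expr0.
  have [B B0 sB] := bounded_norm_le (@s_bound k.+1 isT).
  have [B' B'0 dB] := bounded_norm_le (@d_bound k.+1 isT).
  exists (B + B'); split; first exact: addr_ge0.
  move=> e; have [a [b ->]] := mk_upair_ex e.
  have [<-|/eqP ab] := eqVneq a b.
    apply: (le_trans (xi_diag a k.+1 isT)); rewrite lee_fin.
    by rewrite (le_trans (ler_norm _))// (le_trans (dB _))// lerDr.
  apply: (le_trans (xi_offdiag a b k.+1 isT ab)); rewrite lee_fin.
  by rewrite (le_trans (ler_norm _))// (le_trans (sB _))// lerDl.
have [c cE] := choice abs_bound.
have c0 k : 0 <= c k by case: (cE k).
have xi_moments e : has_moments P (xi e).
  split; first exact: measurable_funPT.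
  move=> p; apply/integrableP; split.
    apply/measurable_EFinP; apply: measurable_funX.
    by apply: measurableT_comp => //; exact: measurable_funPT.
  have [_ /(_ e)] := cE p; rewrite unlock => h.
  apply: le_lt_trans (ltry (c p)); apply: le_trans h.
  rewrite le_eqVlt; apply/orP; left; apply/eqP; apply: eq_integral => w _ /=.
  by rewrite ger0_norm// exprn_ge0.
have xi_bnd e k : Ex P (fun w => `|xi e w| ^+ k) <= c k.
  have [_ /(_ e)] := cE k; rewrite -Ex_E.
  have i := has_moments_integrable (has_momentsX k (has_moments_norm (xi_moments e))).
  move=> h; rewrite -lee_fin fineK// unlock.
  exact: integrable_fin_num.
have xi_mean e : Ex P (xi e) = 0 by rewrite -Ex_E xi_mean0.
have xi_var a b : a <> b -> Ex P (fun w => xi (mk_upair a b) w ^+ 2) =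
    s 2%N (kappa a, kappa b).
  move=> ab; have := @xi_offdiag_eq a b 2%N (or_introl erefl) ab.
  move=> /(congr1 fine); rewrite Ex_E /= => <-; congr (Ex P); apply/funext => w.
  by rewrite real_normK// num_real.
(* The limiting measures: their moments are integrals of the coefficients
   [Phis k] and [Phi]. *)
have N_gt0 k : (0 < #|` N k|)%N by rewrite cardfs_gt0.
pose nu k := theta_ R kappa (N k).
have nuT k : nu k [set: borel C] = 1%E.
  by apply: empirical_setT; rewrite -size_eq0 size_map -lt0n.
have [mu_supp [Phi Phi_def muE]] := mu_theta.
set K := 2 * (supnorm D + Num.sqrt (supnorm (s 2%N))) in mu_supp.
have muN_supp k : msupport (muN k) `<=` `[- K, K] by case: (mu_thetaN k).
have : forall k, exists F, is_Phi D (s 2%N) (nu k) F /\ forall m,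
    (\int[muN k]_x (x ^+ m))%R = (\int[nu k]_(c in [set: borel C]) F m.+1 c)%R.
  by move=> k; have [_ [F ? ?]] := mu_thetaN k; exists F.
move=> /choice[Phis PhisP].
have Phis_def k : is_Phi D (s 2%N) (nu k) (Phis k) by case: (PhisP k).
have muNE k m : (\int[muN k]_x (x ^+ m))%R =
    (\int[nu k]_(c in [set: borel C]) Phis k m.+1 c)%R by case: (PhisP k).
have mPhis k m : measurable_fun [set: borel C] (Phis k m : borel C -> R).
  by case: (Phis_def k).
have moments_cvg m : (\int[muN k]_x (x ^+ m))%R @[k --> \oo] --> (\int[mu]_x (x ^+ m))%R.
  rewrite muE; under eq_fun do rewrite muNE.
  exact: (Phi_integral_cvg (bD := bD) (bs := bs) (s_meas 2%N C2) bDE bsE D_cont (s_cont 2%N C2) nuT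
    N_theta Phis_def Phi_def).
split; last exact: weak_cvg_of_moments muN_supp mu_supp moments_cvg.
have phi_rec_Phis k : phi_rec kappa D (s 2%N)
    (fun m (b : 'I_#|` N k|) => Phis k m (kappa (letter b))).
  split=> [a|m a]; first by have [_ _ -> _] := Phis_def k.
  rewrite (is_Phi_rec (Phis_def k)); congr (_ + _); apply: eq_bigr => i _.
  rewrite /kernel_op mean_theta//; apply: (section_measurable (s_meas 2%N C2)).
  exact: mPhis.
(* Convergence in mean of the moments of the empirical measures. *)
pose A k w := band_matrix kappa D (xi ^~ w) (N k).
apply: (@spectral_cvg R _ _ P (fun k => #|` N k|) N_gt0 A _ _ mu K mu_supp).
- by move=> k w; exact: band_matrix_tr.
- move=> k m.
  have h := entry_moments kappa D xi_moments (N := N k) m.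
  exact: has_moments_sum.
move=> m; apply/cvgrPdist_le => /= eps eps0.
pose eta := eps / 3; have eta0 : 0 < eta by rewrite divr_gt0.
have eta2 : 0 < eta * eta by exact: mulr_gt0.
have [n0 Hn0] := trace_small xi_indep xi_moments xi_mean c0 xi_bnd bD0 bDE xi_var bsE m eta2.
have /cvgrPdist_le /(_ _ eta0) mcvg := moments_cvg m.
have Nn0 : \forall k \near \oo, (n0 <= #|` N k|)%N.
  exact: (N_infty [set j | (n0 <= j)%N] (nbhs_infty_ge n0)).
near=> k.
have h1 : (n0 <= #|` N k|)%N by near: k.
have h2 : `|(\int[mu]_x (x ^+ m))%R - (\int[muN k]_x (x ^+ m))%R| <= eta by near: k.
have h3 := Hn0 _ _ (phi_rec_Phis k) h1.
rewrite -(mean_theta kappa (N k) (mPhis k m.+1)) -muNE in h3.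
pose Z w := #|` N k|%:R^-1 * \tr (A k w ^+ m) - (\int[muN k]_x (x ^+ m))%R.
have hZ : has_moments P Z.
  apply: has_momentsB; last exact: has_moments_cst.
  apply: has_momentsZ; apply: has_moments_sum => i.
  exact: (entry_moments kappa D xi_moments (N := N k) m i i).
rewrite sub0r normrN ger0_norm; last exact: Ex_ge0.
apply: (@le_trans _ _ (Ex P (fun w => eta^-1 * Z w ^+ 2 + (eta + eta)))).
  apply: le_Ex.
  - apply: has_moments_norm; apply: has_momentsB; last exact: has_moments_cst.
    apply: has_momentsZ; apply: has_moments_sum => i.
    exact: (entry_moments kappa D xi_moments (N := N k) m i i).
  - apply: has_momentsD; last exact: has_moments_cst.
    by apply: has_momentsZ; exact: has_momentsX.
  move=> w; have -> : #|` N k|%:R^-1 * \tr (A k w ^+ m) - (\int[mu]_x (x ^+ m))%R =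
      Z w - ((\int[mu]_x (x ^+ m))%R - (\int[muN k]_x (x ^+ m))%R) by rewrite /Z; ring.
  rewrite (le_trans (ler_normB _ _))// addrA lerD//.
  have : eta * `|Z w| <= Z w ^+ 2 + eta * eta.
    rewrite -[Z w ^+ 2]real_normK ?num_real//.
    by have := sqr_ge0 (`|Z w| - eta); have := sqr_ge0 (`|Z w|); nra.
  by move=> h; rewrite -(ler_pM2l eta0) mulrDr mulrA mulfV ?gt_eqF// mul1r.
rewrite ExD; [|by apply: has_momentsZ; exact: has_momentsX|exact: has_moments_cst].
rewrite ExZ; last exact: has_momentsX.
rewrite Ex_cst.
have : eta^-1 * Ex P (fun w => Z w ^+ 2) <= eta.
  rewrite mulrC ler_pdivrMr//; exact: h3.
have : eps = 3 * eta by rewrite /eta; field.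
lra.
Unshelve. all: by end_near. Qed.
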